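(* Let $c>0$, $\alpha\in(0,2]$, $\beta\in[-1,1]$, fix the reference stable distribution $\phi_{c,\alpha,\beta}$, and let $(X_n)_{n\in\mathbb N}$ be a sequence of real random variables with a zone of control $[-K(t_n)^\gamma,K(t_n)^\gamma]$ of index $(v,w)$, with constants $K_1,K_2$, where $(t_n)_{n\in\mathbb N}$ is a sequence growing to infinity. Assume in addition that $\gamma\le \frac{v-1}{\alpha}$. Let $Y$ be a random variable with law $\phi_{c,\alpha,\beta}$, and let $Y_n=X_n/(t_n)^{1/\alpha}$ if $\alpha\ne1$, $Y_n=\frac{X_n}{t_n}-\frac{2c\beta}{\pi}\log t_n$ if $\alpha=1$. Then there exists a constant $C(\alpha,c,v,K,K_1)$ such that $$d_{\mathrm{Kol}}(Y_n,Y)\le C(\alpha,c,v,K,K_1)\,\frac{1}{(t_n)^{1/\alpha+\gamma}}.$$ The constant is explicitly given by $$C(\alpha,c,v,K,K_1)=\min_{\lambda>0}\left(\frac{1+\lambda}{\alpha\pi c}\left(\frac{2^{\frac{v}{\alpha}}\,\Gamma(\frac{v}{\alpha})\,K_1}{c^{v-1}}+\frac{\Gamma(\frac1\alpha)}{\sqrt[3]{\pi}\,K}\left(4\sqrt[3]{1+\frac1\lambda}+3\sqrt[3]{3}\right)\right)\right).$$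
   Context: Kolmogorov distance: $d_{\mathrm{Kol}}(X,Y)=\sup_{a\in\mathbb R}|\mathbb P[X\le a]-\mathbb P[Y\le a]|$. Stable laws: $\phi_{c,\alpha,\beta}$ ($c>0$, $\alpha\in(0,2]$, $\beta\in[-1,1]$) is the probability law on $\mathbb R$ with $\int e^{ix\xi}\phi_{c,\alpha,\beta}(dx)=e^{\eta_{c,\alpha,\beta}(i\xi)}$, where $\eta_{c,\alpha,\beta}(i\xi)=-|c\xi|^\alpha(1-i\beta\,h(\alpha,\xi)\,\mathrm{sgn}(\xi))$, $h(\alpha,\xi)=\tan(\frac{\pi\alpha}{2})$ if $\alpha\neq1$ and $h(1,\xi)=-\frac2\pi\log|\xi|$. Zone of control: let $(t_n)_{n\in\mathbb N}$ be a sequence growing to infinity, $v>0$, $w>0$ and $\gamma\in\mathbb R$. The sequence $(X_n)$ has a zone of control $[-K(t_n)^\gamma,K(t_n)^\gamma]$ of index $(v,w)$ (with respect to $\phi_{c,\alpha,\beta}$) if the following two conditions hold for some positive constants $K_1,K_2$ independent of $n$. (Z1) For all $n$ and all $\xi\in[-K(t_n)^\gamma,K(t_n)^\gamma]$, setting $\theta_n(\xi)=\mathbb E[e^{i\xi X_n}]\,e^{-t_n\eta_{c,\alpha,\beta}(i\xi)}$, one has $|\theta_n(\xi)-1|\le K_1|\xi|^v\exp(K_2|\xi|^w)$. (Z2) $\alpha\le w$, $-\frac1\alpha\le\gamma\le\frac1{w-\alpha}$, and $0<K\le\left(\frac{c^\alpha}{2K_2}\right)^{\frac1{w-\alpha}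}$.
   Formalization: The formal theorem assumes every t_n > 0 and asserts the bound only for those n with t_n ≥ 1; for t_n < 1 the inequality as stated can fail (e.g. Gaussian X_n with one small t_0 and γ = -1/α). *)

(* Defs.v *)
From HB Require Import structures.
From mathcomp Require Import all_boot all_order all_algebra.
From mathcomp Require Import all_classical all_reals all_analysis.
From mathcomp Require Import measurable_realfun complex.

Set Implicit Arguments.
Unset Strict Implicit.
Unset Printing Implicit Defensive.

Import Order.TTheory GRing.Theory Num.Theory.
Import numFieldNormedType.Exports.

Local Open Scope classical_set_scope.
Local Open Scope ring_scope.

Definition cexp (R : realType) (z : R[i]) : R[i] :=
  Complex (expR (complex.Re z) * cos (complex.Im z))
          (expR (complex.Re z) * sin (complex.Im z)).

(* Only meant for f with integrable real and imaginary parts: [Rintegral]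
   returns a junk value otherwise.  Below, f is always bounded and measurable. *)
Definition cintegral d (T : measurableType d) (R : realType)
    (mu : {measure set T -> \bar R}) (f : T -> R[i]) : R[i] :=
  Complex (Rintegral mu setT (fun x => complex.Re (f x)))
          (Rintegral mu setT (fun x => complex.Im (f x))).

Definition charfun d (T : measurableType d) (R : realType)
    (P : probability T R) (X : T -> R) (xi : R) : R[i] :=
  cintegral P (fun w => cexp (Complex 0 (xi * X w))).

Definition Gamma (R : realType) (s : R) : R :=
  Rintegral lebesgue_measure `]0, +oo[ (fun x : R => x `^ (s - 1) * expR (- x)).

Definition stable_h (R : realType) (alpha xi : R) : R :=
  if alpha == 1 then - (2 / pi) * ln `|xi| else tan (pi * alpha / 2).

(* [stable_eta c alpha beta xi] is eta_{c,alpha,beta}(i xi), as a function of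
   the real number xi.  At alpha = 1 and xi = 0 the unspecified value of [ln 0]
   is multiplied by 0. *)
Definition stable_eta (R : realType) (c alpha beta xi : R) : R[i] :=
  - (`|c * xi| `^ alpha)%:C%C
  * (1 - Complex 0 (beta * stable_h alpha xi * Num.sg xi)).

Definition is_stable_law (R : realType) (c alpha beta : R)
    (mu : probability R R) : Prop :=
  forall xi : R, charfun mu (fun x => x) xi = cexp (stable_eta c alpha beta xi).

Definition dKol (R : realType) d (T : measurableType d) (P : probability T R)
    (X : {RV P >-> R}) d' (T' : measurableType d') (P' : probability T' R)
    (Y : {RV P' >-> R}) : R :=
  sup [set `|fine (cdf X a) - fine (cdf Y a)| | a in [set: R]].

Definition theta (R : realType) (c alpha beta t : R) d (T : measurableType d)
    (P : probability T R) (X : {RV P >-> R}) (xi : R) : R[i] :=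
  charfun P X xi * cexp (- t%:C%C * stable_eta c alpha beta xi).

Section ZoneOfControl.
Context (R : realType) (c alpha beta : R) (t : nat -> R).
Context (d : nat -> measure_display) (T : forall n, measurableType (d n)).
Context (P : forall n, probability (T n) R) (X : forall n, {RV (P n) >-> R}).

Definition zone_Z1 (K gamma v w K1 K2 : R) : Prop :=
  forall (n : nat) (xi : R),
    - (K * t n `^ gamma) <= xi <= K * t n `^ gamma ->
    `|theta c alpha beta (t n) (X n) xi - 1|
      <= (K1 * `|xi| `^ v * expR (K2 * `|xi| `^ w))%:C%C.

(* When w = alpha the exponent 1 / (w - alpha) is +oo: there is then no upper
   bound on gamma, and the bound on K, that is
   K `^ (w - alpha) <= c `^ alpha / (2 * K2), reads 1 <= c `^ alpha / (2 * K2). *)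
Definition zone_Z2 (K gamma w K2 : R) : Prop :=
  [/\ alpha <= w, - alpha^-1 <= gamma, 0 < K,
      alpha < w -> gamma <= (w - alpha)^-1 /\
                   K <= (c `^ alpha / (2 * K2)) `^ (w - alpha)^-1 &
      w = alpha -> 1 <= c `^ alpha / (2 * K2)].

Definition zone_of_control (K gamma v w K1 K2 : R) : Prop :=
  [/\ 0 < K1, 0 < K2, zone_Z1 K gamma v w K1 K2 & zone_Z2 K gamma w K2].

End ZoneOfControl.

Definition normalized_rv (R : realType) (c alpha beta t : R)
    d (T : measurableType d) (P : probability T R) (X : {RV P >-> R}) :
    {RV P >-> R} :=
  if alpha == 1
  then (t^-1 \o* X \- cst (2 * c * beta / pi * ln t) : {RV P >-> R})
  else ((t `^ alpha^-1)^-1 \o* X : {RV P >-> R}).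

Definition Kol_bound (R : realType) (alpha c v K K1 lambda : R) : R :=
  (1 + lambda) / (alpha * pi * c) *
  (2 `^ (v / alpha) * Gamma (v / alpha) * K1 / c `^ (v - 1) +
   Gamma alpha^-1 / (pi `^ (3^-1) * K) *
     (4 * (1 + lambda^-1) `^ (3^-1) + 3 * 3 `^ (3^-1))).

Definition is_minimum (R : realType) (A : set R) (m : R) : Prop :=
  A m /\ lbound A m.

(* Main.v *)
(* The sign function is replaced by the primitive [RT T] of a nonnegative kernel
   [rho T] whose Fourier transform is supported in [-T, T], so that the distance
   between the smoothed distribution functions only involves the characteristic
   functions on ]0, T].  There, with T = K t^(gamma + 1/alpha), the zone of
   control bounds their difference by a constant times
   xi^v exp(- (c xi)^alpha / 2); dividing by xi and integrating gives the factor
   Gamma(v / alpha).  The distribution function of Y is Lipschitz, with the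
   integral of |phi_Y| / pi as constant, which produces the factor
   Gamma(1 / alpha), and undoing the smoothing costs the Lipschitz constant times
   the radius beyond which the mass of [rho T] is at most lambda / (2 (1 + lambda)).
   The cube root in the bound comes from the choice of Bohman's kernel, which
   decays like y^-4 and hence has tails of order y^-3. *)
Require Import Defs.
From mathcomp Require Import all_boot all_order all_algebra.
From mathcomp Require Import all_classical all_reals all_analysis.
From mathcomp Require Import measurable_realfun complex ring lra.

Set Implicit Arguments.
Unset Strict Implicit.
Unset Printing Implicit Defensive.

Import Order.TTheory GRing.Theory Num.Theory.
Import numFieldNormedType.Exports.

Local Open Scope classical_set_scope.
Local Open Scope ring_scope.

(** The law of Y is known only through its characteristic function, so its Lipschitz constant is not
    read off a density: it is extracted from the same kernel, by letting the frequency cutoff T tend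
    to infinity. The smoothing step is self-referential: the supremum of the distance also bounds
    what the tail of the kernel sees, and moving that contribution to the other side produces the
    factor 1 + lambda. The Lipschitz slope is paid only over a distance h plus the first moment of
    the tail beyond h, because the linear terms at two symmetric points of the window cancel. The
    need for a finite first moment excludes kernels decaying like y^-2, such as Fejer's. The factor
    1 / xi at the origin forces a detour through a difference of two kernels before expectation and
    frequency integral can be exchanged. Since the constant is prescribed exactly, the choice of h
    is checked numerically, against an explicit upper bound on pi. *)

Lemma measurable_invr (R : realType) : measurable_fun [set: R] (@GRing.inv R).
Proof.
(* Squaring makes the base of the power nonnegative, so that the formula holds for both signs; at 0
   both sides are 0. *)
have -> : @GRing.inv R = fun x => x * (x ^+ 2) `^ (-1).
  apply/funext => x; rewrite powR_inv1 ?sqr_ge0//.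
  have [->|x0] := eqVneq x 0; first by rewrite mul0r invr0.
  by rewrite expr2 invfM mulrA divff// mul1r.
apply: measurable_funM => //.
exact: measurableT_comp (@measurable_powR _ (-1)) (measurable_funX _ _).
Qed.

(** * Fubini's theorem for dominated functions *)

Section Fubini_dominated.
Context d1 d2 (T1 : measurableType d1) (T2 : measurableType d2) (R : realType).
Variable m1 : {sigma_finite_measure set T1 -> \bar R}.
Variable m2 : {sigma_finite_measure set T2 -> \bar R}.
Variables (f : T1 * T2 -> R) (g : T1 -> R) (h : T2 -> R).
Hypothesis mf : measurable_fun setT f.
Hypothesis ig : m1.-integrable setT (EFin \o g).
Hypothesis ih : m2.-integrable setT (EFin \o h).
Hypothesis fgh : forall x y, `|f (x, y)| <= g x * h y.

Lemma dominated_integrable1 x : m2.-integrable setT (fun y => (f (x, y))%:E).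
Proof.
have := integrableZl measurableT (g x) ih.
apply: le_integrable => //.
  exact/measurable_EFinP/(measurableT_comp mf)/measurable_pair1.
by move=> y _ /=; rewrite lee_fin ler_normr fgh.
Qed.

Lemma dominated_integrable2 y : m1.-integrable setT (fun x => (f (x, y))%:E).
Proof.
have := integrableZl measurableT (h y) ig.
apply: le_integrable => //.
  exact/measurable_EFinP/(measurableT_comp mf)/measurable_pair2.
by move=> x _ /=; rewrite lee_fin ler_normr mulrC fgh.
Qed.

Lemma integrable_prod_dominated : (m1 \x m2)%E.-integrable setT (EFin \o f).
Proof.
apply/integrable12ltyP; first exact/measurable_EFinP.
apply: (@le_lt_trans _ _ (\int[m1]_x \int[m2]_y (`|(g x * h y)%:E|))%E).
  apply: ge0_le_integral => //.
  - by move=> *; apply: integral_ge0.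
  - apply: (@measurable_fun_fubini_tonelli_F _ _ _ _ _ m2 (fun z => `|f z|%:E)) => //.
    by apply/measurable_EFinP; exact: measurableT_comp.
  - apply: (@measurable_fun_fubini_tonelli_F _ _ _ _ _ m2 (fun z => `|g z.1 * h z.2|%:E)) => //.
    apply/measurable_EFinP; apply: measurableT_comp => //.
    apply: measurable_funM.
      apply: measurableT_comp; last exact: measurable_fst.
      by apply/measurable_EFinP; exact: measurable_int ig.
    apply: measurableT_comp; last exact: measurable_snd.
    by apply/measurable_EFinP; exact: measurable_int ih.
  - move=> x _; apply: ge0_le_integral => //.
    + apply: measurableT_comp => //; apply/measurable_EFinP.
      exact: measurableT_comp mf (measurable_pair1 _).
    + apply/measurable_EFinP; apply: measurableT_comp => //.
      apply: measurable_funM => //.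
      by apply/measurable_EFinP; exact: measurable_int ih.
    + by move=> y _; rewrite lee_fin ler_normr fgh.
rewrite (_ : (fun x => _) = fun x => (`|g x|%:E * \int[m2]_y `|h y|%:E)%E); last first.
  apply/funext => x; rewrite -ge0_integralZl//.
  - by apply: eq_integral => y _; rewrite /= normrM.
  - apply/measurable_EFinP; apply: measurableT_comp => //.
    by apply/measurable_EFinP; exact: measurable_int ih.
have /integrableP[_ ihy] := ih.
have /integrableP[mg igy] := ig.
rewrite ge0_integralZr//.
- by rewrite lte_mul_pinfty// ?integral_ge0//; rewrite ge0_fin_numE ?integral_ge0//.
- by apply/measurable_EFinP; apply: measurableT_comp => //; exact/measurable_EFinP.
- by apply: integral_ge0 => y _; rewrite lee_fin.
Qed.

(** Domination is assumed at every point, so every section is integrable and not only almost every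
    one; [fine] therefore loses nothing. *)
Lemma dominated_Fubini_EFin1 x :
  (\int[m2]_y f (x, y))%:E = (\int[m2]_y (f (x, y))%:E)%E.
Proof. by rewrite /Rintegral fineK//; exact: integrable_fin_num (dominated_integrable1 x). Qed.

Lemma dominated_Fubini_EFin2 y :
  (\int[m1]_x f (x, y))%:E = (\int[m1]_x (f (x, y))%:E)%E.
Proof. by rewrite /Rintegral fineK//; exact: integrable_fin_num (dominated_integrable2 y). Qed.

Lemma Rintegral_Fubini :
  \int[m1]_x \int[m2]_y f (x, y) = \int[m2]_y \int[m1]_x f (x, y).
Proof.
rewrite {1 3}/Rintegral.
under eq_integral do rewrite dominated_Fubini_EFin1.
under [in RHS]eq_integral do rewrite dominated_Fubini_EFin2.
congr fine; exact: (Fubini integrable_prod_dominated).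
Qed.

Lemma integrable_Rintegral1 :
  m1.-integrable setT (fun x => (\int[m2]_y f (x, y))%:E).
Proof.
apply: eq_integrable (integrable_fubini_F integrable_prod_dominated) => // x _.
by rewrite dominated_Fubini_EFin1.
Qed.

Lemma integrable_Rintegral2 :
  m2.-integrable setT (fun y => (\int[m1]_x f (x, y))%:E).
Proof.
apply: (@le_integrable _ _ _ _ _ _ _ (fun y => ((\int[m1]_x `|g x|) * h y)%:E)) => //.
- rewrite (_ : (fun _ => _) = fun y => \int[m1]_x (f (x, y))%:E)%E; last first.
    by apply/funext => y; rewrite dominated_Fubini_EFin2.
  exact: (measurable_fubini_G integrable_prod_dominated).
- move=> y _ /=; rewrite lee_fin normrM (@ger0_norm _ (\int[m1]_x `|g x|)); last first.
    exact: Rintegral_ge0.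
  have igy := integrable_norm ig.
  rewrite -RintegralZr//; apply: le_trans (le_normr_Rintegral _ _) _ => //.
    exact: (dominated_integrable2 y).
  apply: le_Rintegral => //.
  + exact: (integrable_norm (dominated_integrable2 y)).
  + have := integrableZr measurableT `|h y| igy.
    by apply: eq_integrable => // x _; rewrite /= EFinM.
  + by move=> x _; rewrite -normrM ler_normr fgh.
- exact: (integrableZl measurableT (\int[m1]_x `|g x|) ih).
Qed.

End Fubini_dominated.

(** * Calculus on the real line *)

Lemma Rintegral_FTC2 (R : realType) (f F : R -> R) (a b : R) : a <= b ->
  continuous f -> (forall x : R, is_derive x (1 : R) F (f x)) ->
  \int[lebesgue_measure]_(x in `[a, b]) f x = F b - F a.
Proof.
rewrite le_eqVlt => /predU1P[<- _ _|ab cf dF].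
  by rewrite subrr set_itv1 Rintegral_set1.
have cF : continuous F.
  by move=> x; apply/differentiable_continuous/derivable1_diffP.
rewrite /Rintegral (@continuous_FTC2 _ _ F)//.
- exact: continuous_subspaceT.
- split.
  + by move=> x _.
  + exact/cvg_at_right_filter/cF.
  + exact/cvg_at_left_filter/cF.
- by move=> x _; rewrite derive1E derive_val.
Qed.

(* Derivation rules for eta-expanded functions, the form that [derive_step] can
   unify with. *)
Section pointwise_derivation.
Context (R : realType).
Implicit Types (f g : R -> R) (x df dg : R).

Lemma is_derive_addr f g x df dg : is_derive x (1 : R) f df ->
  is_derive x (1 : R) g dg -> is_derive x (1 : R) (fun t => f t + g t) (df + dg).
Proof. exact: is_deriveD. Qed.

Lemma is_derive_oppr f x df : is_derive x (1 : R) f df ->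
  is_derive x (1 : R) (fun t => - f t) (- df).
Proof. exact: is_deriveN. Qed.

Lemma is_derive_mulr f g x df dg : is_derive x (1 : R) f df ->
  is_derive x (1 : R) g dg ->
  is_derive x (1 : R) (fun t => f t * g t) (f x * dg + g x * df).
Proof. exact: is_deriveM. Qed.

Lemma is_derive_exprn f n x df : is_derive x (1 : R) f df ->
  is_derive x (1 : R) (fun t => f t ^+ n) (n%:R * f x ^+ n.-1 * df).
Proof.
move=> fdf; rewrite (_ : (fun _ => _) = f ^+ n); first exact: is_deriveX.
by apply/funext => t; rewrite fctE.
Qed.

Lemma is_derive_invr f x df : f x != 0 -> is_derive x (1 : R) f df ->
  is_derive x (1 : R) (fun t => (f t)^-1) (- (f x) ^- 2 * df).
Proof. by move=> fx0 fdf; exact: is_deriveV. Qed.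

Lemma is_derive_comp_fun (h : R -> R) f x df dh : is_derive (f x) (1 : R) h dh ->
  is_derive x (1 : R) f df -> is_derive x (1 : R) (fun t => h (f t)) (dh * df).
Proof. by move=> hdh fdf; exact: (@is_derive1_comp _ h f). Qed.

Lemma derive_continuous f : (forall x, exists d, is_derive x (1 : R) f d) ->
  continuous f.
Proof.
move=> fd x; have [d dfx] := fd x.
exact/differentiable_continuous/derivable1_diffP.
Qed.

Lemma derive_ge0_ge f (f' : R -> R) a b : a <= b ->
  (forall x, is_derive x (1 : R) f (f' x)) -> (forall x, a <= x <= b -> 0 <= f' x) ->
  f a <= f b.
Proof.
move=> ab df f'0.
have cf : continuous f by apply: derive_continuous => x; exists (f' x).
have [c] := MVT_segment ab (fun x _ => df x) (continuous_subspaceT cf).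
rewrite in_itv/= => /f'0 c0 fE.
by rewrite -subr_ge0 fE mulr_ge0// subr_ge0.
Qed.

(* Separates the computation of a derivative from the proof that it has the
   requested form. *)
Lemma is_derive_exists f x df :
  (exists d, is_derive x (1 : R) f d /\ d = df) -> is_derive x (1 : R) f df.
Proof. by case=> d [fd <-]. Qed.

End pointwise_derivation.

(** The derivative is an existential variable, filled in from the shape of the function.
    [notypeclasses refine] leaves the premises as goals, and naming the outer function of a
    composition spares a higher-order unification problem. *)
Ltac derive_step := first
  [ exact: is_derive_id | exact: is_derive_cst | exact: is_derive_sin
  | exact: is_derive_cos | exact: is_derive_expR
  | notypeclasses refine (is_derive_addr _ _)
  | notypeclasses refine (is_derive_oppr _)
  | notypeclasses refine (is_derive_mulr _ _)
  | notypeclasses refine (is_derive_exprn _ _)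
  | notypeclasses refine (@is_derive_comp_fun _ (@sin _) _ _ _ _ _ _)
  | notypeclasses refine (@is_derive_comp_fun _ (@cos _) _ _ _ _ _ _)
  | notypeclasses refine (@is_derive_comp_fun _ (@expR _) _ _ _ _ _ _) ].
Ltac derive_rec := repeat derive_step.
Ltac derive_tac :=
  apply: is_derive_exists; eexists; split; [solve [derive_rec]|rewrite /=].
Ltac continuous_tac := apply: derive_continuous => ?; eexists; solve [derive_rec].

(** * Taylor bounds and a numerical bound on pi *)

Section pi_bound.
Context (R : realType).
Implicit Type x : R.

Lemma sin_le_id x : 0 <= x -> sin x <= x.
Proof.
move=> x0; rewrite -subr_ge0.
have := @derive_ge0_ge R (fun t => t - sin t) (fun t => 1 - cos t) 0 x x0.
rewrite sin0 subrr; by apply => y _; rewrite subr_ge0 cos_le1.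
Qed.

Lemma cos_ge_sqr x : 0 <= x -> 1 - x ^+ 2 / 2 <= cos x.
Proof.
move=> x0; rewrite -subr_ge0.
have := @derive_ge0_ge R (fun t => cos t - (1 - t ^+ 2 / 2)) (fun t => t - sin t) 0 x x0.
rewrite cos0 expr0n/= mul0r subr0 subrr; apply.
  by move=> y; derive_tac; field.
by move=> y /andP[y0 _]; rewrite subr_ge0 sin_le_id.
Qed.

Lemma sin_ge_cubic x : 0 <= x -> x - x ^+ 3 / 6 <= sin x.
Proof.
move=> x0; rewrite -subr_ge0.
have := @derive_ge0_ge R (fun t => sin t - (t - t ^+ 3 / 6))
  (fun t => cos t - (1 - t ^+ 2 / 2)) 0 x x0.
rewrite sin0 expr0n/= mul0r subrr subr0; apply.
  by move=> y; derive_tac; field.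
by move=> y /andP[y0 _]; rewrite subr_ge0 cos_ge_sqr.
Qed.

Lemma cos_le_quartic x : 0 <= x -> cos x <= 1 - x ^+ 2 / 2 + x ^+ 4 / 24.
Proof.
move=> x0; rewrite -subr_ge0.
have := @derive_ge0_ge R (fun t => 1 - t ^+ 2 / 2 + t ^+ 4 / 24 - cos t)
  (fun t => sin t - (t - t ^+ 3 / 6)) 0 x x0.
rewrite cos0 !expr0n/= !mul0r addr0 subr0 subrr; apply.
  by move=> y; derive_tac; field.
by move=> y /andP[y0 _]; rewrite subr_ge0 sin_ge_cubic.
Qed.

(** The quartic Taylor bound is negative at 8/5, whereas cosine is nonnegative up to pi / 2. This
    accuracy is enough for the explicit constant. *)
Lemma pi_lt_16div5 : pi < 16 / 5 :> R.
Proof.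
have h : @cos R (8 / 5) < 0.
  apply: le_lt_trans (@cos_le_quartic (8 / 5) _) _; first lra.
  by rewrite !exprS expr0; lra.
rewrite ltNge; apply/negP => pi_ge.
suff : 0 <= @cos R (8 / 5) by rewrite leNgt h.
by apply: cos_ge0_pihalf; apply/andP; split; lra.
Qed.

End pi_bound.

(** * The Bohman kernel *)

Section bohman.
Context (R : realType).

(* The self-convolution of a half period of the cosine, which is why its Fourier
   transform is nonnegative. *)
Definition bohman (x : R) := (1 - x) * cos (pi * x) + sin (pi * x) / pi.

Lemma is_derive_bohman (x : R) :
  is_derive x (1 : R) bohman (- (pi * (1 - x) * sin (pi * x))).
Proof.
rewrite /bohman; derive_tac.
by move: (@pi_gt0 R); generalize (@pi R) => p /lt0r_neq0 p0; field.
Qed.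

Lemma bohman0 : bohman 0 = 1.
Proof. by rewrite /bohman !mulr0 cos0 sin0 mul0r subr0 mul1r addr0. Qed.

Lemma bohman1 : bohman 1 = 0.
Proof. by rewrite /bohman !mulr1 sinpi mul0r subrr mul0r addr0. Qed.

Lemma bohman_le1 x : 0 <= x <= 1 -> bohman x <= 1.
Proof.
move=> /andP[x0 x1].
have := @derive_ge0_ge R (fun t => - bohman t) (fun t => pi * (1 - t) * sin (pi * t)) 0 x x0.
rewrite bohman0 lerN2; apply.
  by move=> y; rewrite -[X in is_derive _ _ _ X]opprK; apply: is_derive_oppr; exact: is_derive_bohman.
move=> y /andP[y0 yx]; have p0 := @pi_ge0 R.
rewrite !mulr_ge0// ?sin_ge0_pi//; first lra.
rewrite mulr_ge0//=; nra.
Qed.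

Lemma bohman_ge0 x : 0 <= x <= 1 -> 0 <= bohman x.
Proof.
move=> /andP[x0 x1].
have := @derive_ge0_ge R (fun t => - bohman t) (fun t => pi * (1 - t) * sin (pi * t)) x 1 x1.
rewrite bohman1 lerN2; apply.
  by move=> y; rewrite -[X in is_derive _ _ _ X]opprK; apply: is_derive_oppr; exact: is_derive_bohman.
move=> y /andP[y0 yx]; have p0 := @pi_ge0 R.
rewrite !mulr_ge0// ?sin_ge0_pi//; first lra.
rewrite mulr_ge0//=; nra.
Qed.

(** Flatness to second order at 0: it keeps the difference of two kernels bounded after division by
    xi, and it controls the error of replacing the kernel by 1 in the Abel argument. *)
Lemma bohman_ge_sqr x : 0 <= x <= 1 -> 1 - (pi * x) ^+ 2 / 2 <= bohman x.
Proof.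
move=> /andP[x0 x1].
have := @derive_ge0_ge R (fun t => bohman t - (1 - (pi * t) ^+ 2 / 2))
   (fun t => pi * (pi * t - (1 - t) * sin (pi * t))) 0 x x0.
rewrite bohman0 !mulr0 expr0n/= mul0r subr0 subrr subr_ge0; apply.
  move=> y; apply: is_derive_exists; eexists; split.
    notypeclasses refine (is_derive_addr _ _); first exact: is_derive_bohman.
    derive_rec.
  by rewrite /=; field.
move=> y /andP[y0 yx]; have p0 := @pi_ge0 R.
rewrite mulr_ge0// subr_ge0.
have s0 : 0 <= sin (pi * y) by apply: sin_ge0_pi; rewrite mulr_ge0//=; nra.
have : sin (pi * y) <= pi * y by apply: sin_le_id; rewrite mulr_ge0.
nra.
Qed.

Lemma continuous_bohman : continuous bohman.
Proof. by apply: derive_continuous => x; eexists; exact: is_derive_bohman. Qed.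

End bohman.

Section lipschitz.
Context (R : realType).

Lemma derive_bounded_lipschitz (f f' : R -> R) C :
  (forall x, is_derive x (1 : R) f (f' x)) -> (forall x, `|f' x| <= C) ->
  forall x y, `|f x - f y| <= C * `|x - y|.
Proof.
move=> df f'C; have cf : continuous f by apply: derive_continuous => x; exists (f' x).
have H x y : x <= y -> `|f y - f x| <= C * `|y - x|.
  move=> xy; have [c _ ->] := MVT_segment xy (fun x _ => df x) (continuous_subspaceT cf).
  by rewrite normrM ler_wpM2r.
move=> x y; have [/H|/ltW/H//] := leP x y.
by rewrite distrC (distrC y).
Qed.

Lemma lipschitz_sin (x y : R) : `|sin x - sin y| <= `|x - y|.
Proof.
rewrite -[leRHS]mul1r; apply: derive_bounded_lipschitz => z.
exact: cos_max.
Qed.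

Lemma lipschitz_cos (x y : R) : `|cos x - cos y| <= `|x - y|.
Proof.
rewrite -[leRHS]mul1r; apply: derive_bounded_lipschitz => z.
by rewrite normrN sin_max.
Qed.

Lemma lipschitz_fun_continuous (f : R -> R) C :
  (forall x y, `|f x - f y| <= C * `|x - y|) -> continuous f.
Proof.
move=> fC x; apply/cvgrPdist_le => e e0.
have C0 : 0 <= C.
  by have := le_trans (normr_ge0 _) (fC 1 0); rewrite subr0 normr1 mulr1.
near=> y; rewrite (le_trans (fC _ _))//.
rewrite (@le_trans _ _ ((C + 1) * `|x - y|))//.
  by rewrite ler_wpM2r// lerDl.
rewrite mulrC -ler_pdivlMr ?ltr_wpDl//.
near: y; apply: (@cvgr_dist_le _ _ _ (nbhs x) _ id x) => //.
by rewrite divr_gt0// ltr_wpDl.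
Unshelve. all: by end_near. Qed.

End lipschitz.

Section bohman_kernel.
Context (R : realType).
Local Notation leb := (@lebesgue_measure R).

(** Only positive frequencies are kept, Fourier integrals being written with cosines and sines. The
    point 0 is left out because a factor 1 / xi is to come. *)
Definition bker (T xi : R) := if 0 < xi <= T then bohman (xi / T) else 0.

Lemma bkerE (T xi : R) : bker T xi = bohman (xi / T) * \1_(`]0, T]) xi.
Proof.
rewrite /bker indicE mem_setE in_itv/=; case: ifPn; first by rewrite mulr1.
by rewrite mulr0.
Qed.

Lemma bker_bounds (T xi : R) : 0 <= bker T xi <= 1.
Proof.
rewrite /bker; case: ifPn => [/andP[x0 xT]|_]; last by rewrite lexx ler01.
have T0 := lt_le_trans x0 xT.
have h : 0 <= xi / T <= 1 by rewrite divr_ge0 ?(ltW x0) ?(ltW T0)//= ler_pdivrMr// mul1r.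
by rewrite bohman_ge0// bohman_le1.
Qed.

Lemma measurable_bker (T : R) : measurable_fun setT (bker T).
Proof.
rewrite (_ : bker T = fun xi => bohman (xi / T) * \1_(`]0, T]) xi); last first.
  by apply/funext => xi; rewrite bkerE.
apply: measurable_funM; last exact: measurable_indic.
apply: measurableT_comp.
  by apply: continuous_measurable_fun; exact: continuous_bohman.
exact: mulrr_measurable.
Qed.

Lemma integrable_cst_itv (C a b : R) :
  leb.-integrable setT (fun x => (C * \1_(`]a, b]) x)%:E).
Proof.
have := integrableZl measurableT C (@integrable_indic_itv R a b false false).
by apply: eq_integrable.
Qed.

Lemma integrable_bker (T : R) (g : R -> R) (C : R) : measurable_fun setT g ->
  (forall xi, 0 < xi <= T -> `|g xi| <= C) ->
  leb.-integrable setT (fun xi => (bker T xi * g xi)%:E).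
Proof.
move=> mg gC; have := integrable_cst_itv C 0 T.
apply: le_integrable => //.
  by apply/measurable_EFinP; apply: measurable_funM => //; exact: measurable_bker.
move=> xi _ /=; rewrite lee_fin !normrM.
have [xiT|xiT] := boolP (0 < xi <= T); last first.
  by rewrite /bker (negbTE xiT) normr0 mul0r mulr_ge0.
have C0 : 0 <= C by exact: le_trans (gC _ xiT).
rewrite indicE mem_set ?in_itv//= normr1 mulr1 (ger0_norm C0).
rewrite (le_trans _ (gC _ xiT))//.
have /andP[k0 k1] := bker_bounds T xi.
by rewrite (ger0_norm k0) ler_piMl.
Qed.

Lemma Rintegral_bker (T : R) (g : R -> R) : continuous g ->
  \int[leb]_xi (bker T xi * g xi) =
  \int[leb]_(xi in `[0, T]) (bohman (xi / T) * g xi).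
Proof.
move=> cg.
have cb : continuous (fun xi : R => bohman (xi / T)) by rewrite /bohman; continuous_tac.
have cbg : continuous (fun xi : R => bohman (xi / T) * g xi).
  by move=> x; apply: cvgM; [exact: cb|exact: cg].
rewrite -Rintegral_itv_obnd_cbnd; last first.
  have : leb.-integrable `[0, T] (EFin \o (fun xi => bohman (xi / T) * g xi)).
    apply: continuous_compact_integrable; first exact: segment_compact.
    exact: continuous_subspaceT.
  by apply: integrableS => //; apply: subset_itvr; rewrite bnd_simp.
rewrite [RHS]Rintegral_mkcond; apply: eq_Rintegral => xi _.
rewrite patchE mem_setE in_itv/= /bker.
by case: ifPn => // _; rewrite mul0r.
Qed.

(** The inverse Fourier transform of the even extension of [bker T]: the cosine integral over ]0, T]
    is half of the one over [-T, T], hence 1 / pi instead of 1 / (2 pi). *)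
Definition rho (T y : R) := pi^-1 * \int[leb]_xi (bker T xi * cos (xi * y)).

Lemma continuous_cosM (y : R) : continuous (fun xi : R => cos (xi * y)).
Proof. by continuous_tac. Qed.

(** Cleared of denominators, the formula has no exceptional point at y = pi / T or y = - pi / T, and
    the primitive [G] can be checked uniformly. The factor 1 + cos (T y) is at the same time the
    source of positivity and of the decay in y^-4. *)
Lemma bohman_cos_integral (T y : R) : 0 < T ->
  ((pi / T) ^+ 2 - y ^+ 2) ^+ 2 * \int[leb]_xi (bker T xi * cos (xi * y)) =
  2 * (pi / T) ^+ 2 * (1 + cos (T * y)) / T.
Proof.
move=> T0; rewrite Rintegral_bker; last exact: continuous_cosM.
have p0 := lt0r_neq0 (pi_gt0 R); have T1 := lt0r_neq0 T0.
have cf : continuous (fun xi : R => bohman (xi / T) * cos (xi * y)).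
  by rewrite /bohman; continuous_tac.
set a := pi / T.
pose D := a ^+ 2 - y ^+ 2.
pose G (x : R) := (1 - x / T) * (a * sin (a * x) * cos (x * y) - y * cos (a * x) * sin (x * y)) * D
  - ((a ^+ 2 + y ^+ 2) * cos (a * x) * cos (x * y) + 2 * a * y * sin (a * x) * sin (x * y)) / T
  - (a * cos (a * x) * cos (x * y) + y * sin (a * x) * sin (x * y)) * D / pi.
rewrite -RintegralZl//; last first.
  apply: continuous_compact_integrable; first exact: segment_compact.
  exact: continuous_subspaceT.
have dG x : is_derive x (1 : R) G (D ^+ 2 * (bohman (x / T) * cos (x * y))).
  rewrite /G /bohman /D; derive_tac.
  have -> : pi * (x / T) = a * x by rewrite /a; field.
  move: p0; rewrite /a; generalize (@pi R) => p p0.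
  by field; apply/andP.
have cDf : continuous (fun xi : R => D ^+ 2 * (bohman (xi / T) * cos (xi * y))).
  by move=> x; apply: cvgM; [exact: cvg_cst|exact: cf].
rewrite (Rintegral_FTC2 (ltW T0) cDf dG).
rewrite /G !mulr0 !mul0r !sin0 !cos0.
have -> : a * T = pi by rewrite /a mulfVK.
rewrite cospi sinpi /D /a; move: p0; generalize (@pi R) => p p0.
by field; apply/andP.
Qed.

(* The removable singularity of [bohman_cos_integral]. *)
Lemma bohman_cos_integral_pole (T : R) : 0 < T ->
  \int[leb]_xi (bker T xi * cos (xi * (pi / T))) = T / 4.
Proof.
move=> T0; rewrite Rintegral_bker; last exact: continuous_cosM.
have p0 := lt0r_neq0 (pi_gt0 R); have T1 := lt0r_neq0 T0.
have [a [aE aT]] : exists a, a = pi / T /\ a * T = pi.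
  by exists (pi / T); rewrite mulfVK.
rewrite -aE.
have a0 : a != 0 by rewrite aE mulf_neq0// invr_eq0.
pose G (x : R) := (1 - x / T) * (x / 2 + sin (a * x) * cos (a * x) / (2 * a))
  + (x ^+ 2 / 4 + sin (a * x) ^+ 2 / (4 * a ^+ 2)) / T + sin (a * x) ^+ 2 / (2 * a * pi).
have dG (x : R) : is_derive x (1 : R) G (bohman (x / T) * cos (x * a)).
  rewrite /G /bohman; derive_tac.
  have -> : pi * (x / T) = a * x by rewrite -aT; field.
  rewrite [x * a]mulrC.
  have := cos2Dsin2 (a * x).
  move: (cos _) (sin _) => u v uv; apply/eqP; rewrite -subr_eq0; apply/eqP.
  (* The two sides differ by a multiple of 1 - (cos^2 + sin^2), a relation that [field] does not
     know. *)
  transitivity ((1 - x / T) / 2 * (1 - (u ^+ 2 + v ^+ 2))); last first.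
    by rewrite uv subrr mulr0.
  by rewrite -aT; field; rewrite ?T1 ?a0.
have cf : continuous (fun xi : R => bohman (xi / T) * cos (xi * a)).
  by rewrite /bohman; continuous_tac.
rewrite (Rintegral_FTC2 (ltW T0) cf dG).
rewrite /G !mulr0 !mul0r !sin0 !cos0.
rewrite aT cospi sinpi -aT.
by field; rewrite ?T1 ?a0.
Qed.

Lemma Rintegral_bker_le (T : R) (g : R -> R) (C : R) : 0 <= T -> measurable_fun setT g ->
  (forall xi, 0 < xi <= T -> `|g xi| <= C) ->
  `|\int[leb]_xi (bker T xi * g xi)| <= C * T.
Proof.
move=> T0 mg gC; have ig := integrable_bker mg gC.
have iC := integrable_cst_itv C 0 T.
rewrite (le_trans (le_normr_Rintegral _ ig))//.
apply: (@le_trans _ _ (\int[leb]_xi (C * \1_(`]0, T]) xi))).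
  apply: le_Rintegral => //; first exact: (integrable_norm ig).
  move=> xi _; rewrite normrM.
  have [xiT|xiT] := boolP (0 < xi <= T); last first.
    rewrite /bker (negbTE xiT) normr0 mul0r indicE memNset ?mulr0//=.
    by rewrite in_itv/=; exact/negP.
  rewrite indicE mem_set ?in_itv//= mulr1.
  rewrite (le_trans _ (gC _ xiT))//.
  have /andP[k0 k1] := bker_bounds T xi.
  by rewrite (ger0_norm k0) ler_piMl.
rewrite RintegralZl//; last exact: integrable_indic_itv.
rewrite /Rintegral integral_indic//= setIT lebesgue_measure_itv/= lte_fin.
case: ltgtP T0 => //= [T0|<-] _; last by rewrite mulr0.
by rewrite subr0.
Qed.

Lemma rho_ge0 (T y : R) : 0 < T -> 0 <= rho T y.
Proof.
move=> T0; rewrite mulr_ge0// ?invr_ge0 ?pi_ge0//.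
have [yE|] := eqVneq ((pi / T) ^+ 2) (y ^+ 2); last first.
  move=> yE; have := bohman_cos_integral y T0.
  have D0 : 0 < ((pi / T) ^+ 2 - y ^+ 2) ^+ 2.
    by rewrite exprn_even_gt0//= subr_eq0.
  move=> h; rewrite -(pmulr_rge0 _ D0) h.
  have c0 : 0 <= 1 + cos (T * y) by have := cos_geN1 (T * y); lra.
  by rewrite !mulr_ge0 ?invr_ge0 ?sqr_ge0 ?(ltW T0) ?pi_ge0.
move/eqP : yE; rewrite eqf_sqr => /orP[] /eqP yE.
  by rewrite -yE bohman_cos_integral_pole// divr_ge0// ltW.
rewrite -[y]opprK -yE; under eq_Rintegral do rewrite mulrN cosN.
by rewrite bohman_cos_integral_pole// divr_ge0// ltW.
Qed.

Lemma rho_le (T y : R) : 0 <= T -> rho T y <= T / pi.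
Proof.
move=> T0; rewrite /rho mulrC ler_pM2r ?invr_gt0 ?pi_gt0//.
rewrite (le_trans (ler_norm _))// -[leRHS]mul1r.
apply: Rintegral_bker_le => //; last by move=> xi _; exact: cos_max.
by apply: continuous_measurable_fun; exact: continuous_cosM.
Qed.

Lemma rho_tail_le (T y : R) : 0 < T -> pi / T < y ->
  rho T y <= 4 * pi / T ^+ 3 / (y ^+ 2 - (pi / T) ^+ 2) ^+ 2.
Proof.
move=> T0 ay; have p0 := pi_gt0 R.
have a0 : 0 < pi / T by rewrite divr_gt0.
have h := bohman_cos_integral y T0.
have D0 : 0 < (y ^+ 2 - (pi / T) ^+ 2) ^+ 2.
  by rewrite exprn_even_gt0//= subr_eq0 gt_eqF// ltr_pXn2r// nnegrE ltW// (lt_trans a0).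
rewrite -sqrrN opprB in h.
rewrite ler_pdivlMr// /rho mulrAC -mulrA h.
have -> : 4 * pi / T ^+ 3 = pi^-1 * (2 * (pi / T) ^+ 2 * 2 / T).
  by move: p0 => /lt0r_neq0; generalize (@pi R) => p ?; field; rewrite lt0r_neq0.
rewrite ler_pM2l ?invr_gt0// ler_pM2r ?invr_gt0// ler_pM2l; last first.
  by rewrite mulr_gt0// exprn_gt0.
by have := cos_le1 (T * y); lra.
Qed.

Lemma continuous_rho (T : R) : 0 <= T -> continuous (rho T).
Proof.
move=> T0; apply: (@lipschitz_fun_continuous _ _ (pi^-1 * (T * T))) => y z.
have mc (u : R) : measurable_fun setT (fun xi : R => cos (xi * u)).
  by apply: continuous_measurable_fun; exact: continuous_cosM.
have ic (u : R) : leb.-integrable setT (fun xi => (bker T xi * cos (xi * u))%:E).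
  by apply: (@integrable_bker _ _ 1) => // xi _; exact: cos_max.
rewrite /rho -mulrBr normrM ger0_norm ?invr_ge0 ?pi_ge0// -mulrA ler_wpM2l ?invr_ge0 ?pi_ge0//.
rewrite -RintegralB//; [|exact: ic|exact: ic].
under eq_Rintegral do rewrite -mulrBr.
rewrite mulrAC; apply: Rintegral_bker_le => //.
  exact: measurable_funB.
move=> xi /andP[xi0 xiT]; rewrite (le_trans (lipschitz_cos _ _))//.
by rewrite -mulrBr normrM (gtr0_norm xi0) ler_wpM2r.
Qed.

End bohman_kernel.

Section bohman_primitive.
Context (R : realType).
Local Notation leb := (@lebesgue_measure R).

(* By [RT_int], the odd primitive of [rho T]. *)
Definition RT (T z : R) :=
  pi^-1 * \int[leb]_xi (bker T xi * (xi^-1 * sin (xi * z))).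

Lemma measurable_invM_sin (z : R) :
  measurable_fun setT (fun xi : R => xi^-1 * sin (xi * z)).
Proof.
apply: measurable_funM; first exact: measurable_invr.
by apply: continuous_measurable_fun; continuous_tac.
Qed.

Lemma RT_lipschitz (T z z' : R) : 0 <= T ->
  `|RT T z - RT T z'| <= T / pi * `|z - z'|.
Proof.
move=> T0.
have b (u : R) xi : 0 < xi <= T -> `|xi^-1 * sin (xi * u)| <= `|u|.
  move=> /andP[xi0 _]; rewrite normrM normfV (gtr0_norm xi0) ler_pdivrMl//.
  rewrite (le_trans (_ : _ <= `|xi * u|))//; last by rewrite normrM (gtr0_norm xi0).
  by have := lipschitz_sin (xi * u) 0; rewrite sin0 !subr0.
rewrite /RT -mulrBr -RintegralB//; last 2 first.
  exact: (integrable_bker (@measurable_invM_sin z) (@b z)).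
  exact: (integrable_bker (@measurable_invM_sin z') (@b z')).
under eq_Rintegral do rewrite -mulrBr.
rewrite normrM ger0_norm ?invr_ge0 ?pi_ge0// (mulrC T) -mulrA.
rewrite ler_pM2l ?invr_gt0 ?pi_gt0// mulrC; apply: Rintegral_bker_le => //.
  by apply: measurable_funB; exact: measurable_invM_sin.
move=> xi /andP[xi0 _]; rewrite -mulrBr normrM normfV (gtr0_norm xi0) ler_pdivrMl//.
by rewrite (le_trans (lipschitz_sin _ _))// -mulrBr normrM (gtr0_norm xi0).
Qed.

Lemma RT0 (T : R) : RT T 0 = 0.
Proof.
rewrite /RT; under eq_Rintegral do rewrite mulr0 sin0 !mulr0.
by rewrite /Rintegral integral0 mulr0.
Qed.

Lemma RTN (T z : R) : RT T (- z) = - RT T z.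
Proof.
have b (u : R) xi : 0 < xi <= T -> `|xi^-1 * sin (xi * u)| <= `|u|.
  move=> /andP[xi0 _]; rewrite normrM normfV (gtr0_norm xi0) ler_pdivrMl//.
  rewrite (le_trans (_ : _ <= `|xi * u|))//; last by rewrite normrM (gtr0_norm xi0).
  by have := lipschitz_sin (xi * u) 0; rewrite sin0 !subr0.
rewrite /RT; under eq_Rintegral do rewrite mulrN sinN !mulrN -mulN1r.
rewrite RintegralZl//; first by rewrite mulN1r mulrN.
exact: (integrable_bker (@measurable_invM_sin z) (@b z)).
Qed.

Lemma Rintegral_mkindic (D : set R) (f : R -> R) :
  \int[leb]_(x in D) f x = \int[leb]_x (f x * \1_D x).
Proof.
rewrite Rintegral_mkcond; apply: eq_Rintegral => x _.
by rewrite patchE indicE; case: ifPn => _; rewrite ?mulr1 ?mulr0.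
Qed.

(** The weight [q] is 1 when [rho] is integrated to [RT], and a decreasing exponential in the Abel
    argument. *)
Lemma rho_Fubini (T B C : R) (q : R -> R) : 0 <= T -> continuous q ->
  (forall y, 0 <= y <= B -> `|q y| <= C) ->
  \int[leb]_(y in `[0, B]) (q y * rho T y) =
  pi^-1 * \int[leb]_xi (bker T xi * \int[leb]_(y in `[0, B]) (q y * cos (xi * y))).
Proof.
move=> T0 cq qC.
pose f (z : measurableTypeR R * measurableTypeR R) := bker T z.1 * cos (z.1 * z.2) * (q z.2 * \1_(`[0, B]) z.2).
have mf : measurable_fun setT f.
  apply: measurable_funM.
    apply: measurable_funM.
      exact: measurableT_comp (measurable_bker T) measurable_fst.
    apply: measurableT_comp; first by apply: continuous_measurable_fun; exact: continuous_cos.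
    exact: measurable_funM.
  have mg : measurable_fun setT (fun y => q y * \1_(`[0, B]) y).
    by apply: measurable_funM => //; exact: continuous_measurable_fun.
  exact: measurableT_comp mg measurable_snd.
pose h (y : R) := C * \1_(`[0, B]) y.
have ih : leb.-integrable setT (EFin \o h).
  have := integrableZl measurableT C (@integrable_indic_itv R 0 B true false).
  by apply: eq_integrable.
have fgh x y : `|f (x, y)| <= 1 * \1_(`]0, T]) x * h y.
  rewrite /f /h/= !normrM mul1r; apply: ler_pM => //.
    rewrite indicE mem_setE in_itv/=; have /andP[k0 k1] := bker_bounds T x.
    rewrite (ger0_norm k0); move: k0 k1; rewrite /bker; case: ifPn => _ k0 k1.
      by rewrite -[leRHS]mul1r ler_pM// cos_max.
    by rewrite mul0r.
  rewrite indicE mem_setE in_itv/=; have [yB|_] := boolP (0 <= y <= B).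
    by rewrite normr1 !mulr1 qC.
  by rewrite normr0 !mulr0.
have igT := @integrable_cst_itv R 1 0 T.
have mc (y : R) : measurable_fun setT (fun xi : R => cos (xi * y)).
  by apply: continuous_measurable_fun; exact: continuous_cosM.
have mq : measurable_fun setT q by exact: continuous_measurable_fun.
have ic (y : R) : leb.-integrable setT (fun xi => (bker T xi * cos (xi * y))%:E).
  by apply: (@integrable_bker _ _ _ 1) => [|xi _]; [exact: mc|exact: cos_max].
have iq (xi : R) : leb.-integrable setT
    (fun y => (q y * cos (xi * y) * \1_(`[0, B]) y)%:E).
  apply: le_integrable ih => //.
    apply/measurable_EFinP; apply: measurable_funM; last exact: measurable_indic.
    apply: measurable_funM => //.
    by apply: continuous_measurable_fun; continuous_tac.
  move=> y _; rewrite /h /= lee_fin !normrM indicE mem_setE in_itv/=.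
  have [/qC yB|_] := boolP (0 <= y <= B); last by rewrite normr0 !mulr0.
  rewrite normr1 !mulr1 -[leRHS]mulr1; apply: ler_pM => //; last exact: cos_max.
  exact: le_trans yB (ler_norm _).
transitivity (pi^-1 * \int[leb]_y \int[leb]_xi
    (bker T xi * cos (xi * y) * (q y * \1_(`[0, B]) y))).
  rewrite (Rintegral_mkindic `[0, B]).
  rewrite -(RintegralZl _ measurableT (integrable_Rintegral2 mf igT ih fgh)).
  apply: eq_Rintegral => y _.
  have -> : \int[leb]_x f (x, y) =
      (\int[leb]_x (bker T x * cos (x * y))) * (q y * \1_(`[0, B]) y).
    by rewrite -(RintegralZr _ measurableT (ic y)).
  rewrite /rho.
  by rewrite [in RHS]mulrA [in RHS]mulrA [in RHS](mulrC _ (q y)).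
rewrite -(Rintegral_Fubini mf igT ih fgh); congr (_ * _); apply: eq_Rintegral => xi _.
rewrite (Rintegral_mkindic `[0, B]) -(RintegralZl _ measurableT (iq xi)).
by apply: eq_Rintegral => y _; rewrite /f/= -mulrA [cos _ * _]mulrA (mulrC (cos _)).
Qed.

Lemma cos_integral (xi B : R) : xi != 0 -> 0 <= B ->
  \int[leb]_(y in `[0, B]) cos (xi * y) = xi^-1 * sin (xi * B).
Proof.
move=> xi0 B0.
have dF (y : R) : is_derive y (1 : R) (fun y => xi^-1 * sin (xi * y)) (cos (xi * y)).
  by derive_tac; field.
have cf : continuous (fun y : R => cos (xi * y)) by continuous_tac.
by rewrite (Rintegral_FTC2 B0 cf dF) mulr0 sin0 mulr0 subr0.
Qed.

Lemma RT_int (T z : R) : 0 <= T -> 0 <= z ->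
  \int[leb]_(y in `[0, z]) rho T y = RT T z.
Proof.
move=> T0 z0; have := @rho_Fubini T z 1 (cst 1) T0.
under eq_Rintegral do rewrite /= mul1r.
move=> ->; last 2 first.
  by move=> x; exact: cst_continuous.
  by move=> *; rewrite normr1.
congr (_ * _); apply: eq_Rintegral => xi _.
rewrite /bker; case: ifPn => [/andP[xi0 _]|_]; last by rewrite !mul0r.
congr (_ * _); rewrite -cos_integral// ?gt_eqF//.
by apply: eq_Rintegral => y _; rewrite mul1r.
Qed.

Lemma exp_cos_integral (s xi B : R) : 0 < s -> 0 <= B ->
  \int[leb]_(y in `[0, B]) (expR (- (s * y)) * cos (xi * y)) =
  s / (s ^+ 2 + xi ^+ 2) +
  expR (- (s * B)) * ((xi * sin (xi * B) - s * cos (xi * B)) / (s ^+ 2 + xi ^+ 2)).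
Proof.
move=> s0 B0.
have d0 : s ^+ 2 + xi ^+ 2 != 0 by rewrite gt_eqF// ltr_pwDl ?sqr_ge0// exprn_gt0.
pose F (y : R) := expR (- (s * y)) * ((xi * sin (xi * y) - s * cos (xi * y)) / (s ^+ 2 + xi ^+ 2)).
have dF (y : R) : is_derive y (1 : R) F (expR (- (s * y)) * cos (xi * y)).
  by rewrite /F; derive_tac; field.
have cf : continuous (fun y : R => expR (- (s * y)) * cos (xi * y)) by continuous_tac.
rewrite (Rintegral_FTC2 B0 cf dF) /F !mulr0 oppr0 expR0 sin0 cos0.
by field.
Qed.

Lemma atan_integral (s T : R) : 0 < s -> 0 <= T ->
  \int[leb]_(xi in `[0, T]) (s / (s ^+ 2 + xi ^+ 2)) = atan (T / s).
Proof.
move=> s0 T0.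
have d0 (x : R) : s ^+ 2 + x ^+ 2 != 0.
  by rewrite gt_eqF// ltr_pwDl ?sqr_ge0// exprn_gt0.
have dF (y : R) : is_derive y (1 : R) (fun y => atan (y / s)) (s / (s ^+ 2 + y ^+ 2)).
  apply: is_derive_exists; eexists; split.
    notypeclasses refine (@is_derive_comp_fun _ (@atan _) _ _ _ _ _ _).
      exact: is_derive1_atan.
    by derive_rec.
  by rewrite /=; field; rewrite d0 lt0r_neq0.
have cf : continuous (fun y : R => s / (s ^+ 2 + y ^+ 2)).
  apply: derive_continuous => x; eexists.
  notypeclasses refine (is_derive_mulr _ _); first exact: is_derive_cst.
  notypeclasses refine (is_derive_invr _ _); first exact: d0.
  by derive_rec.
by rewrite (Rintegral_FTC2 T0 cf dF) mul0r atan0 subr0.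
Qed.

End bohman_primitive.

(** * Mass and tails of the kernel *)

Section bohman_mass.
Context (R : realType).
Local Notation leb := (@lebesgue_measure R).
Variable T : R.
Hypothesis T0 : 0 < T.

Let a := pi / T.
Let a0 : 0 < a. Proof. by rewrite divr_gt0 ?pi_gt0. Qed.

(** Since [rho T] is even, integration over the line is replaced by integration over y >= 0 of the
    symmetric pair of points x + y and x - y. *)
Definition rhop (y : R) := rho T y * \1_(`[0, +oo[) y.

Lemma rhop_ge0 y : 0 <= rhop y.
Proof. by rewrite mulr_ge0// rho_ge0. Qed.

Lemma rhopE y : 0 <= y -> rhop y = rho T y.
Proof. by move=> y0; rewrite /rhop indicE mem_setE in_itv/= y0 mulr1. Qed.

Lemma rhop_lt0 y : y < 0 -> rhop y = 0.
Proof. by move=> y0; rewrite /rhop indicE mem_setE in_itv/= leNgt y0 mulr0. Qed.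

Lemma measurable_rhop : measurable_fun setT rhop.
Proof.
apply: measurable_funM; last exact: measurable_indic.
by apply: continuous_measurable_fun; apply: continuous_rho; exact: ltW.
Qed.

Let c := 4 * pi / T ^+ 3.
Let c0 : 0 < c. Proof. by rewrite divr_gt0 ?exprn_gt0// mulr_gt0 ?pi_gt0. Qed.

Lemma tail_weight_integral h : a < h ->
  (\int[leb]_(y in `[h, +oo[) (c * y / (y ^+ 2 - a ^+ 2) ^+ 2)%:E =
   (c / 2 / (h ^+ 2 - a ^+ 2))%:E)%E.
Proof.
move=> ah.
have d0 (y : R) : h <= y -> 0 < y ^+ 2 - a ^+ 2.
  move=> hy; rewrite subr_gt0 ltr_pXn2r ?nnegrE ?(ltW a0)//.
    exact: lt_le_trans ah hy.
  by rewrite ltW// (lt_trans a0)// (lt_le_trans ah).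
pose F (y : R) := - (c / 2 * (y ^+ 2 - a ^+ 2)^-1).
have dF (y : R) : h <= y -> is_derive y (1 : R) F (c * y / (y ^+ 2 - a ^+ 2) ^+ 2).
  move=> hy; apply: is_derive_exists; eexists; split.
    rewrite /F; notypeclasses refine (is_derive_oppr _).
    notypeclasses refine (is_derive_mulr _ _); first exact: is_derive_cst.
    notypeclasses refine (is_derive_invr _ _); first by rewrite gt_eqF// d0.
    by derive_rec.
  by rewrite /=; field; rewrite gt_eqF// d0.
have cF (y : R) : h <= y -> {for y, continuous F}.
  by move=> hy; have := dF _ hy => dFy; apply/differentiable_continuous/derivable1_diffP.
have cf : {within `[h, +oo[, continuous (fun y : R => c * y / (y ^+ 2 - a ^+ 2) ^+ 2)}.
  apply: continuous_in_subspaceT => y; rewrite inE/= in_itv/= andbT => hy.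
  have : exists d, is_derive y (1 : R) (fun y : R => c * y / (y ^+ 2 - a ^+ 2) ^+ 2) d.
    eexists; notypeclasses refine (is_derive_mulr _ _); first by derive_rec.
    notypeclasses refine (is_derive_invr _ _); first by rewrite expf_neq0// gt_eqF// d0.
    by derive_rec.
  by move=> [d dd]; apply/differentiable_continuous/derivable1_diffP.
rewrite (@ge0_continuous_FTC2y _ _ F h 0).
- by rewrite /F -EFinN -EFinD sub0r opprK.
- move=> y hy; rewrite divr_ge0 ?sqr_ge0// mulr_ge0 ?(ltW c0)//.
  by rewrite ltW// (lt_trans a0)// (lt_le_trans ah).
- exact: cf.
- rewrite /F -[X in _ --> X]oppr0 -[X in _ --> - X](mulr0 (c / 2)).
  apply: cvgN; apply: cvgM; first exact: cvg_cst.
  apply/cvgrPdist_le => e e0; near=> y.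
  have y1 : a + 1 <= y by near: y; apply: nbhs_pinfty_ge; rewrite num_real.
  have ya : 0 < y - a by lra.
  have hy : 0 < y ^+ 2 - a ^+ 2.
    by rewrite subr_sqr mulr_gt0//; have := a0; lra.
  rewrite sub0r normrN normfV gtr0_norm// invf_ple// ?posrE//.
  have ey : e^-1 <= y by near: y; apply: nbhs_pinfty_ge; rewrite num_real.
  rewrite (le_trans ey)// subr_sqr (@le_trans _ _ (y + a)) ?lerDl ?(ltW a0)//.
  by rewrite ler_peMl; have := a0; lra.
- by move=> y /ltW/dF dFy.
- by apply: cvg_at_right_filter; exact: cF.
- move=> y; rewrite in_itv/= andbT => /ltW/dF dFy.
  by rewrite derive1E derive_val.
Unshelve. all: by end_near. Qed.

(** The bound of [rho_tail_le] multiplied by y. The factor y yields the first moment and also makes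
    the weight an exact derivative, that of - c / (2 (y^2 - a^2)). *)
Definition tailw h y := c * y / (y ^+ 2 - a ^+ 2) ^+ 2 * \1_(`[h, +oo[) y.

Lemma tailw_ge0 h y : a < h -> 0 <= tailw h y.
Proof.
move=> ah; rewrite /tailw indicE mem_setE in_itv/= andbT.
have [hy|_] := boolP (h <= y); rewrite ?mulr0 ?mulr1//.
rewrite divr_ge0 ?sqr_ge0// mulr_ge0 ?(ltW c0)//.
by rewrite ltW// (lt_trans a0)// (lt_le_trans ah).
Qed.

Lemma measurable_tailw h : measurable_fun setT (tailw h).
Proof.
apply: measurable_funM; last exact: measurable_indic.
apply: measurable_funM; first exact: mulrl_measurable.
apply: measurableT_comp; first exact: measurable_invr.
by apply: continuous_measurable_fun; continuous_tac.
Qed.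

Lemma integral_tailw h : a < h ->
  (\int[leb]_y (tailw h y)%:E = (c / 2 / (h ^+ 2 - a ^+ 2))%:E)%E.
Proof.
move=> ah; rewrite -tail_weight_integral// [RHS]integral_mkcond.
apply: eq_integral => y _; rewrite patchE /tailw indicE.
by case: ifPn => _; rewrite ?mulr0 ?mulr1.
Qed.

Lemma integrable_tailw h : a < h -> leb.-integrable setT (EFin \o tailw h).
Proof.
move=> ah; apply/integrableP; split.
  by apply/measurable_EFinP; exact: measurable_tailw.
rewrite (_ : (fun x => _) = fun y => (tailw h y)%:E).
  by rewrite integral_tailw// ltry.
by apply/funext => y /=; rewrite ger0_norm ?tailw_ge0.
Qed.

Lemma rhop_tailw h y : a < h -> h <= y -> y * rhop y <= tailw h y.
Proof.
move=> ah hy; have ay := lt_le_trans ah hy; have y0 := lt_trans a0 ay.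
rewrite rhopE ?(ltW y0)// /tailw indicE mem_setE in_itv/= hy mulr1.
rewrite [c * y]mulrC -mulrA ler_pM2l//.
exact: rho_tail_le.
Qed.

Lemma integrable_rhop : leb.-integrable setT (EFin \o rhop).
Proof.
have aa : a < 2 * a by have := a0; lra.
(* Up to 2 a the kernel is at most T / pi, and beyond it at most [tailw] divided by 2 a. Any
   negative left end puts 0 inside the half-open interval. *)
have h1 := integrable_cst_itv (T / pi) (-1) (2 * a).
have h2 := integrableZl measurableT (2 * a)^-1 (integrable_tailw aa).
have := integrableD measurableT h1 h2.
apply: le_integrable => //; first by apply/measurable_EFinP; exact: measurable_rhop.
move=> y _ /=; rewrite lee_fin ger0_norm ?rhop_ge0// (le_trans _ (ler_norm _))//.
have t0 := tailw_ge0 y aa.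
have [y0|y0] := ltP y 0.
  by rewrite rhop_lt0// addr_ge0// mulr_ge0// ?divr_ge0 ?(ltW T0) ?pi_ge0// invr_ge0 ltW// (lt_trans a0).
have [ya|ya] := leP y (2 * a).
  rewrite [X in _ * X + _]indicE mem_setE in_itv/= ya (lt_le_trans _ y0)//= mulr1.
  rewrite ler_wpDr//; last by rewrite rhopE// rho_le// ltW.
  by rewrite mulr_ge0// invr_ge0 ltW// (lt_trans a0).
rewrite ler_wpDl//; first by rewrite mulr_ge0// divr_ge0 ?(ltW T0) ?pi_ge0.
rewrite ler_pdivlMl ?(lt_trans a0)//.
rewrite (le_trans _ (rhop_tailw aa (ltW ya)))// ler_wpM2r ?rhop_ge0//.
exact: ltW.
Qed.

Definition mass := \int[leb]_y rhop y.

(** Moments of order one and zero of the part of the kernel beyond h. *)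
Definition tail1 h := \int[leb]_y (y * rhop y * \1_(`[h, +oo[) y).
Definition tail0 h := \int[leb]_y (rhop y * \1_(`[h, +oo[) y).

Lemma integrable_tail1 h : a < h ->
  leb.-integrable setT (fun y => (y * rhop y * \1_(`[h, +oo[) y)%:E).
Proof.
move=> ah; apply: le_integrable (integrable_tailw ah) => //.
  apply/measurable_EFinP; apply: measurable_funM; last exact: measurable_indic.
  by apply: measurable_funM => //; exact: measurable_rhop.
move=> y _; rewrite /= lee_fin indicE mem_setE in_itv/= andbT.
have [hy|_] := boolP (h <= y); last by rewrite mulr0 normr0.
have y0 : 0 < y by rewrite (lt_trans a0)// (lt_le_trans ah).
rewrite mulr1 ger0_norm; last by rewrite mulr_ge0 ?rhop_ge0// ltW.
by rewrite (le_trans _ (ler_norm _))// rhop_tailw.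
Qed.

Lemma integrable_rhopM (A : set R) : measurable A ->
  leb.-integrable setT (fun y => (rhop y * \1_A y)%:E).
Proof.
move=> mA; apply: le_integrable integrable_rhop => //.
  apply/measurable_EFinP; apply: measurable_funM; last exact: measurable_indic.
  exact: measurable_rhop.
move=> y _; rewrite /= lee_fin normrM ler_piMr// indicE.
by case: (_ \in _); rewrite ?normr1 ?normr0.
Qed.

Lemma tail1_le h : a < h -> tail1 h <= c / 2 / (h ^+ 2 - a ^+ 2).
Proof.
move=> ah; rewrite (_ : c / 2 / _ = \int[leb]_y tailw h y); last first.
  by rewrite /Rintegral integral_tailw.
apply: le_Rintegral => //; first exact: integrable_tail1.
  exact: integrable_tailw.
move=> y _; rewrite indicE mem_setE in_itv/= andbT.
have [hy|_] := boolP (h <= y); last by rewrite mulr0 tailw_ge0.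
by rewrite mulr1 rhop_tailw.
Qed.

(** Markov's inequality. *)
Lemma tail0_le h : a < h -> tail0 h <= tail1 h / h.
Proof.
move=> ah; have h0 := lt_trans a0 ah.
rewrite ler_pdivlMr// /tail0 -RintegralZr//; last exact: integrable_rhopM.
apply: le_Rintegral => //.
- have := integrableZr measurableT h (integrable_rhopM (measurable_itv `[h, +oo[)).
  by apply: eq_integrable.
- exact: integrable_tail1.
move=> y _; rewrite indicE mem_setE in_itv/= andbT.
have [hy|_] := boolP (h <= y); last by rewrite !mulr0 mul0r.
by rewrite !mulr1 mulrC ler_wpM2r// rhop_ge0.
Qed.

(* The mass is exactly 1/2; any bound uniform in [T] would do here. *)
Lemma mass_le3 : mass <= 3.
Proof.
have aa : a < 2 * a by have := a0; lra.
have a20 : 0 < 2 * a by have := a0; lra.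
have h1 := integrableZl measurableT (T / pi) (@integrable_indic_itv R 0 (2 * a) true false).
have h2 := integrableZl measurableT (2 * a)^-1 (integrable_tailw aa).
apply: (@le_trans _ _ (\int[leb]_y (T / pi * \1_(`[0, 2 * a]) y + (2 * a)^-1 * tailw (2 * a) y))).
  apply: le_Rintegral => //; first exact: integrable_rhop.
    by have := integrableD measurableT h1 h2; apply: eq_integrable.
  move=> y _; have t0 := tailw_ge0 y aa.
  have [y0|y0] := ltP y 0.
    by rewrite rhop_lt0// addr_ge0// mulr_ge0// ?divr_ge0 ?(ltW T0) ?pi_ge0// invr_ge0 ltW.
  have [ya|ya] := leP y (2 * a).
    rewrite [X in _ * X + _]indicE mem_setE in_itv/= ya y0 mulr1.
    rewrite ler_wpDr//; last by rewrite rhopE// rho_le// ltW.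
    by rewrite mulr_ge0// invr_ge0 ltW.
  rewrite ler_wpDl//; first by rewrite mulr_ge0// divr_ge0 ?(ltW T0) ?pi_ge0.
  rewrite ler_pdivlMl//.
  rewrite (le_trans _ (rhop_tailw aa (ltW ya)))// ler_wpM2r ?rhop_ge0//.
  exact: ltW.
rewrite RintegralD// RintegralZl//; last exact: integrable_indic_itv.
rewrite RintegralZl//; last exact: integrable_tailw.
rewrite {2}/Rintegral integral_tailw//=.
rewrite /Rintegral integral_indic//= setIT lebesgue_measure_itv/= lte_fin a20/= subr0.
rewrite /c /a.
have p2 := @pi_ge2 R.
have -> : T / pi * (2 * (pi / T)) + (2 * (pi / T))^-1 *
   (4 * pi / T ^+ 3 / 2 / ((2 * (pi / T)) ^+ 2 - (pi / T) ^+ 2)) = 2 + (3 * pi ^+ 2)^-1.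
  have := lt0r_neq0 (@pi_gt0 R); have := lt0r_neq0 T0.
  generalize (@pi R) => p T1 p1.
  have -> : (2 * (p / T)) ^+ 2 - (p / T) ^+ 2 = 3 * (p / T) ^+ 2 by ring.
  by field; rewrite T1 p1.
suff : (3 * pi ^+ 2)^-1 <= 1 :> R by lra.
by rewrite invf_le1//; nra.
Qed.

(* Layer-cake formula: [mass + RT T z] is the average over y >= 0 of the two
   unit steps located at -y and y. *)
Lemma RT_layer z :
  \int[leb]_y (rhop y * (\1_(`[- z, +oo[) y + \1_(`]-oo, z]) y)) = mass + RT T z.
Proof.
under eq_Rintegral do rewrite mulrDr.
rewrite RintegralD//; [|exact: integrable_rhopM|exact: integrable_rhopM].
have [z0|z0] := leP 0 z.
  congr (_ + _).
    apply: eq_Rintegral => y _; have [y0|y0] := ltP y 0.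
      by rewrite rhop_lt0// mul0r.
    by rewrite indicE mem_setE in_itv/= andbT (le_trans _ y0) ?mulr1// oppr_le0.
  rewrite -RT_int ?(ltW T0)// (Rintegral_mkindic `[0, z]); apply: eq_Rintegral => y _.
  by rewrite /rhop -mulrA !indicE !mem_setE !in_itv/= andbT -natrM mulnb.
have -> : \int[leb]_x (rhop x * \1_`]-oo, z] x) = 0.
  under eq_Rintegral => y _.
    rewrite (_ : rhop y * _ = 0); first over.
    have [y0|y0] := ltP y 0; first by rewrite rhop_lt0// mul0r.
    by rewrite indicE mem_setE in_itv/= leNgt (lt_le_trans z0 y0) mulr0.
  by rewrite /Rintegral integral0.
rewrite addr0; apply/eqP; rewrite -subr_eq; apply/eqP.
have nz : 0 <= - z by rewrite oppr_ge0 ltW.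
rewrite -RTN -RT_int ?(ltW T0)//.
have ic : leb.-integrable `[0, - z] (EFin \o rho T).
  apply: continuous_compact_integrable; first exact: segment_compact.
  by apply: continuous_subspaceT; apply: continuous_rho; exact: ltW.
rewrite -Rintegral_itv_bndo_bndc; last first.
  by apply: integrableS ic => //; apply: subset_itvl; rewrite bnd_simp.
rewrite (Rintegral_mkindic `[0, - z[) -RintegralD//; last 2 first.
- exact: integrable_rhopM.
- have := integrable_rhopM (measurable_itv `[0, - z[); apply: eq_integrable => // y _.
  rewrite /rhop /= -mulrA !indicE !mem_setE !in_itv/= andbT -natrM mulnb.
  by rewrite andbA andbb.
apply: eq_Rintegral => y _; rewrite /rhop -mulrA -mulrDr; congr (_ * _).
rewrite !indicE !mem_setE !in_itv/= !andbT -natrM mulnb -natrD.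
by have [y0|y0] := leP 0 y; have [yz|yz] := leP (- z) y.
Qed.

(** In the layer-cake formula both indicators are nondecreasing in z and carry nonnegative
    weights. *)
Lemma RT_nd z z' : z <= z' -> RT T z <= RT T z'.
Proof.
have i (u : R) : leb.-integrable setT (EFin \o
    (fun y => rhop y * (\1_(`[- u, +oo[) y + \1_(`]-oo, u]) y))).
  have := integrableD measurableT (integrable_rhopM (measurable_itv `[- u, +oo[))
    (integrable_rhopM (measurable_itv `]-oo, u])).
  by apply: eq_integrable => // y _; rewrite /= -EFinD mulrDr.
move=> zz; rewrite -(lerD2l mass) -!RT_layer; apply: le_Rintegral => //.
move=> y _; rewrite ler_wpM2l ?rhop_ge0// !indicE !mem_setE !in_itv/= !andbT.
rewrite lerD//.
  by have [zy|_] := boolP (- z <= y); rewrite ?ler0n// (le_trans _ zy) ?lerN2.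
by have [zy|_] := boolP (y <= z); rewrite ?ler0n// (le_trans zy).
Qed.

Lemma mass_sub_RT z : 0 <= z -> mass - RT T z =
  \int[leb]_y (rhop y * \1_(`]z, +oo[) y).
Proof.
move=> z0; rewrite -RT_int ?(ltW T0)//.
have -> : \int[leb]_(y in `[0, z]) rho T y = \int[leb]_y (rhop y * \1_(`]-oo, z]) y).
  rewrite Rintegral_mkindic; apply: eq_Rintegral => y _.
  by rewrite /rhop -mulrA !indicE !mem_setE !in_itv/= andbT -natrM mulnb.
rewrite -RintegralB//; [|exact: integrable_rhop|exact: integrable_rhopM].
apply: eq_Rintegral => y _; rewrite -{1}[rhop y]mulr1 -mulrBr; congr (_ * _).
rewrite !indicE !mem_setE !in_itv/= !andbT.
by case: ltP => _; rewrite ?subr0 ?subrr.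
Qed.

Lemma RT_le_mass z : RT T z <= mass.
Proof.
have [z0|z0] := leP 0 z.
  rewrite -subr_ge0 mass_sub_RT//; apply: Rintegral_ge0 => y _.
  by rewrite mulr_ge0 ?rhop_ge0.
rewrite (le_trans (RT_nd (ltW z0)))// RT0; apply: Rintegral_ge0 => y _.
exact: rhop_ge0.
Qed.

Lemma RT_norm_le z : `|RT T z| <= mass.
Proof.
by rewrite ler_norml RT_le_mass andbT lerNl -RTN RT_le_mass.
Qed.

Lemma RT_ge_tail z : a < z -> mass - tail0 z <= RT T z.
Proof.
move=> az; rewrite lerBlDr -lerBlDl mass_sub_RT; last by rewrite ltW// (lt_trans a0).
apply: le_Rintegral => //; [exact: integrable_rhopM|exact: integrable_rhopM|].
move=> y _; rewrite ler_wpM2l ?rhop_ge0// !indicE !mem_setE !in_itv/= !andbT.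
by have [zy|_] := ltP z y; rewrite ?ler0n// (ltW zy).
Qed.

End bohman_mass.

(** * Lower bound on the mass of the kernel *)

Section mass_lower_bound.
Context (R : realType).
Local Notation leb := (@lebesgue_measure R).
Variable T : R.
Hypothesis T0 : 0 < T.

(* Abel summation: the damping factor exp(- s y) makes the Fourier inversion
   integral explicit, up to errors that vanish for T / s large. *)
Lemma mass_ge_abel (s B : R) : 0 < s -> 0 <= B ->
  pi^-1 * (atan (T / s) - (s * (pi / T) ^+ 2 / 2 +
    expR (- (s * B)) * ((T + s) / s ^+ 2)) * T) <= mass T.
Proof.
move=> s0 B0.
have d0 (xi : R) : 0 < s ^+ 2 + xi ^+ 2 by rewrite ltr_pwDl ?sqr_ge0// exprn_gt0.
rewrite (le_trans _ (RT_le_mass T0 B))// -RT_int ?(ltW T0)//.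
have cr : continuous (rho T) by apply: continuous_rho; exact: ltW.
have ce : continuous (fun y : R => expR (- (s * y))) by continuous_tac.
apply: (@le_trans _ _ (\int[leb]_(y in `[0, B]) (expR (- (s * y)) * rho T y))); last first.
  apply: le_Rintegral => //.
  - apply: continuous_compact_integrable; first exact: segment_compact.
    apply: continuous_subspaceT => y; apply: cvgM; [exact: ce|exact: cr].
  - apply: continuous_compact_integrable; first exact: segment_compact.
    exact: continuous_subspaceT.
  - move=> y; rewrite /= in_itv/= => /andP[y0 _].
    by rewrite ler_piMl ?rho_ge0// -expR0 ler_expR oppr_le0 mulr_ge0// ltW.
rewrite (@rho_Fubini _ T B 1) ?(ltW T0)//; last first.
  move=> y /andP[y0 _]; rewrite ger0_norm ?expR_ge0//.
  by rewrite -expR0 ler_expR oppr_le0 mulr_ge0// ltW.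
rewrite ler_pM2l ?invr_gt0 ?pi_gt0//.
under eq_Rintegral do rewrite exp_cos_integral//.
have cL : continuous (fun xi : R => s / (s ^+ 2 + xi ^+ 2) +
   expR (- (s * B)) * ((xi * sin (xi * B) - s * cos (xi * B)) / (s ^+ 2 + xi ^+ 2))).
  apply: derive_continuous => x.
  have [dv dV] : exists dv, is_derive x (1 : R) (fun xi : R => (s ^+ 2 + xi ^+ 2)^-1) dv.
    eexists; notypeclasses refine (is_derive_invr _ _); first by rewrite gt_eqF.
    by derive_rec.
  eexists; notypeclasses refine (is_derive_addr _ _).
    notypeclasses refine (is_derive_mulr _ dV); exact: is_derive_cst.
  notypeclasses refine (is_derive_mulr _ _); first exact: is_derive_cst.
  notypeclasses refine (is_derive_mulr _ dV); derive_rec.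
rewrite Rintegral_bker//.
have cV : continuous (fun xi : R => s / (s ^+ 2 + xi ^+ 2)).
  apply: derive_continuous => x; eexists.
  notypeclasses refine (is_derive_mulr _ _); first exact: is_derive_cst.
  notypeclasses refine (is_derive_invr _ _); first by rewrite gt_eqF.
  by derive_rec.
(* [k] bounds two pointwise errors on [0, T]. Replacing the kernel by 1 in front of s / (s^2 + xi^2)
   costs at most s (pi / T)^2 / 2, because xi^2 <= s^2 + xi^2; the second summand is the boundary
   term at B. *)
set k := _ / 2 + _.
have iV : leb.-integrable `[0, T] (EFin \o (fun xi : R => s / (s ^+ 2 + xi ^+ 2))).
  apply: continuous_compact_integrable; first exact: segment_compact.
  exact: continuous_subspaceT.
have ik : leb.-integrable `[0, T] (EFin \o (fun _ : R => k)).
  apply: continuous_compact_integrable; first exact: segment_compact.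
  by apply: continuous_subspaceT => x; exact: cvg_cst.
have -> : atan (T / s) - k * T =
    \int[leb]_(xi in `[0, T]) (s / (s ^+ 2 + xi ^+ 2) - k).
  rewrite RintegralB// atan_integral ?(ltW T0)// Rintegral_cst//.
  by rewrite /= lebesgue_measure_itv/= lte_fin T0/= subr0.
have cb : continuous (fun xi : R => bohman (xi / T)) by rewrite /bohman; continuous_tac.
apply: le_Rintegral => //.
- apply: continuous_compact_integrable; first exact: segment_compact.
  by apply: continuous_subspaceT => y; apply: cvgB; [exact: cV|exact: cvg_cst].
- apply: continuous_compact_integrable; first exact: segment_compact.
  by apply: continuous_subspaceT => y; apply: cvgM; [exact: cb|exact: cL].
move=> xi; rewrite /= in_itv/= => /andP[xi0 xiT].
have h : 0 <= xi / T <= 1.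
  by rewrite divr_ge0 ?(ltW T0)//= ler_pdivrMr// mul1r.
have b0 := bohman_ge0 h; have b1 := bohman_le1 h; have bs := bohman_ge_sqr h.
rewrite mulrDr /k opprD addrA; apply: lerD.
  have V0 : 0 <= s / (s ^+ 2 + xi ^+ 2) by rewrite divr_ge0 ?(ltW (d0 _)) ?(ltW s0).
  apply: (@le_trans _ _ ((1 - (pi * (xi / T)) ^+ 2 / 2) * (s / (s ^+ 2 + xi ^+ 2)))); last first.
    by rewrite ler_wpM2r.
  rewrite mulrBl mul1r lerD2l lerN2.
  have -> : pi * (xi / T) = pi / T * xi by rewrite mulrA mulrAC.
  rewrite exprMn mulrA ler_pdivrMr//.
  have := sqr_ge0 s; have : 0 <= s * (pi / T) ^+ 2 by rewrite mulr_ge0 ?sqr_ge0// ltW.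
  nra.
set W := (_ - _) / _.
have WB : `|W| <= (T + s) / s ^+ 2.
  rewrite /W normrM normfV (gtr0_norm (d0 _)); apply: ler_pM => //.
  - by rewrite invr_ge0 ltW.
  - rewrite (le_trans (ler_normB _ _))// !normrM (ger0_norm xi0) (gtr0_norm s0).
    rewrite lerD//; last by rewrite ler_piMr ?cos_max// ltW.
    by rewrite (le_trans _ xiT)// ler_piMr ?sin_max.
  - by rewrite lef_pV2 ?posrE ?exprn_gt0// lerDl sqr_ge0.
rewrite [leRHS]mulrCA -mulrN ler_wpM2l ?expR_ge0//.
have : `|bohman (xi / T) * W| <= (T + s) / s ^+ 2.
  rewrite normrM (ger0_norm b0) (le_trans _ WB)// ler_piMl//.
by rewrite ler_norml => /andP[].
Qed.

Lemma mass_ge_half : 2^-1 <= mass T.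
Proof.
have p0 := @pi_gt0 R.
(* Here s = T / x and B = x^5 / T, so that s B = x^4 and exp (- x^4) <= x^-4 outweighs the factor of
   order x^2 of the boundary term. Both errors are then of order 1 / x, while atan x tends to pi /
   2. *)
have H x : 1 <= x -> pi^-1 * (atan x - (pi ^+ 2 / 2 + 2) / x) <= mass T.
  move=> x1; have x0 : 0 < x by apply: lt_le_trans x1.
  have s0 : 0 < T / x by rewrite divr_gt0.
  have B0 : 0 <= x ^+ 5 / T by rewrite divr_ge0 ?exprn_ge0 ?(ltW x0) ?(ltW T0).
  have := mass_ge_abel s0 B0; apply: le_trans.
  rewrite ler_pM2l ?invr_gt0//.
  have T1 := lt0r_neq0 T0; have x1' := lt0r_neq0 x0.
  have -> : T / (T / x) = x by field; rewrite T1 x1'.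
  have -> : T / x * (x ^+ 5 / T) = x ^+ 4 by field; rewrite T1 x1'.
  rewrite lerD2l lerN2 mulrDl.
  have -> : (pi ^+ 2 / 2 + 2) / x = T / x * (pi / T) ^+ 2 / 2 * T + 2 / x.
    by generalize (@pi R) => p; field; rewrite T1 x1'.
  rewrite lerD2l.
  have e4 : expR (- x ^+ 4) <= (x ^+ 4)^-1.
    rewrite expRN lef_pV2 ?posrE ?expR_gt0 ?exprn_gt0//.
    by rewrite (le_trans _ (expR_ge1Dx _))// lerDr.
  apply: (@le_trans _ _ ((x ^+ 4)^-1 * ((T + T / x) / (T / x) ^+ 2) * T)).
    rewrite ler_pM2r// ler_wpM2r// divr_ge0 ?sqr_ge0// addr_ge0 ?(ltW T0) ?(ltW s0)//.
  have -> : (x ^+ 4)^-1 * ((T + T / x) / (T / x) ^+ 2) * T = (1 + x^-1) / x / x.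
    by field; rewrite T1 x1'.
  rewrite ler_pM2r ?invr_gt0// ler_pdivrMr//.
  have : x^-1 <= 1 by rewrite invf_le1.
  lra.
have cv : (pi^-1 * (atan x - (pi ^+ 2 / 2 + 2) / x)) @[x --> +oo] --> (pi^-1 * (pi / 2 - (pi ^+ 2 / 2 + 2) * 0) : R).
  apply: cvgM; first exact: cvg_cst.
  apply: cvgB; first exact: cvgy_atan.
  apply: cvgM; first exact: cvg_cst.
  apply/cvgrPdist_le => e e0; near=> y.
  have y0 : 0 < y by near: y; apply: nbhs_pinfty_gt; rewrite num_real.
  have ey : e^-1 <= y by near: y; apply: nbhs_pinfty_ge; rewrite num_real.
  by rewrite sub0r normrN normfV gtr0_norm// invf_ple// ?posrE.
rewrite mulr0 subr0 mulrA mulVf ?gt_eqF// mul1r in cv.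
rewrite -(cvg_lim _ cv)//; apply: limr_le; first by apply/cvg_ex; eexists; exact: cv.
by near=> y; apply: H; near: y; apply: nbhs_pinfty_ge; rewrite num_real.
Unshelve. all: by end_near. Qed.

End mass_lower_bound.

(** * Smoothed distribution functions *)

Section smoothing_kernel_difference.
Context (R : realType).
Local Notation leb := (@lebesgue_measure R).

(* The difference with a kernel of small radius [e] removes the pole at 0, so that
   Fubini's theorem applies; [RT e] tends to 0 with [e]. *)
Definition wker (T e xi : R) := (bker T xi - bker e xi) * xi^-1.

Lemma measurable_wker (T e : R) : measurable_fun setT (wker T e).
Proof.
apply: measurable_funM; last exact: measurable_invr.
by apply: measurable_funB; exact: measurable_bker.
Qed.

Lemma wker_le_inv (T e xi : R) : e <= T ->
  `|wker T e xi| <= xi^-1 * \1_(`]0, T]) xi.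
Proof.
move=> eT; rewrite /wker indicE mem_setE in_itv/=.
have [/andP[x0 xT]|xT] := boolP (0 < xi <= T); last first.
  rewrite /bker (negbTE xT) ifN; last first.
    by apply: contra xT => /andP[-> /= xe]; exact: le_trans eT.
  by rewrite subrr mul0r mulr0 normr0.
rewrite mulr1 normrM [X in _ * X]ger0_norm ?invr_ge0 ?(ltW x0)//.
rewrite ler_piMl ?invr_ge0 ?(ltW x0)//.
have := bker_bounds T xi; have := bker_bounds e xi.
by rewrite ler_norml; lra.
Qed.

(** For xi <= e both kernels differ from 1 by a quadratic error, and xi^2 <= T xi makes that error
    linear, so it survives the division by xi. For xi > e the bound 1 / e suffices. *)
Lemma wker_bounded (T e xi : R) : 0 < e -> e <= T ->
  `|wker T e xi| <= (pi ^+ 2 * T / e ^+ 2 + e^-1) * \1_(`]0, T]) xi.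
Proof.
move=> e0 eT; have T0 := lt_le_trans e0 eT.
have [/andP[x0 xT]|xT] := boolP (0 < xi <= T); last first.
  rewrite (le_trans (wker_le_inv _ eT))// !indicE !mem_setE in_itv/= (negbTE xT).
  by rewrite !mulr0.
have [xe|xe] := leP xi e; last first.
  rewrite (le_trans (wker_le_inv _ eT))// ler_wpM2r//.
  rewrite ler_wpDl//.
    by rewrite divr_ge0 ?sqr_ge0// mulr_ge0 ?sqr_ge0// ltW.
  by rewrite lef_pV2 ?posrE// ltW.
rewrite indicE mem_setE in_itv/= x0 xT mulr1 /wker.
rewrite ler_wpDr ?invr_ge0 ?(ltW e0)// normrM normfV (gtr0_norm x0) ler_pdivrMr//.
have -> : pi ^+ 2 * T / e ^+ 2 * xi = (pi / e) ^+ 2 * (T * xi).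
  by have := lt0r_neq0 e0; generalize (@pi R) => p ?; field.
have z0 : 0 <= (pi / e) ^+ 2 * (T * xi).
  by rewrite mulr_ge0 ?sqr_ge0// mulr_ge0// ltW.
have b u : e <= u -> u <= T -> xi <= u -> 1 - (pi / e) ^+ 2 * (T * xi) / 2 <= bker u xi.
  move=> eu uT xu; have u0 := lt_le_trans e0 eu.
  have h : 0 <= xi / u <= 1 by rewrite divr_ge0 ?(ltW x0) ?(ltW u0)//= ler_pdivrMr// mul1r.
  rewrite /bker x0 xu (le_trans _ (bohman_ge_sqr h))// lerD2l lerN2 ler_pM2r ?invr_gt0//.
  have -> : pi * (xi / u) = pi / u * xi by rewrite mulrA mulrAC.
  rewrite exprMn ler_pM ?sqr_ge0//.
    rewrite ler_pXn2r ?nnegrE ?divr_ge0 ?pi_ge0 ?(ltW e0) ?(ltW u0)//.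
    by rewrite ler_pM2l ?pi_gt0// lef_pV2 ?posrE.
  by rewrite expr2 ler_pM2r.
have := b _ (lexx e) eT xe; have := b _ eT (lexx T) xT.
have := bker_bounds T xi; have := bker_bounds e xi.
by move: z0; generalize ((pi / e) ^+ 2 * (T * xi)) => z; rewrite ler_norml; lra.
Qed.

Lemma wker_sin_integral (T e z : R) : 0 < e -> e <= T ->
  pi^-1 * \int[leb]_xi (wker T e xi * sin (xi * z)) = RT T z - RT e z.
Proof.
move=> e0 eT; rewrite /RT -mulrBr.
have b (U : R) xi : 0 < xi <= U -> `|xi^-1 * sin (xi * z)| <= `|z|.
  move=> /andP[xi0 _]; rewrite normrM normfV (gtr0_norm xi0) ler_pdivrMl//.
  by have := lipschitz_sin (xi * z) 0; rewrite sin0 !subr0 normrM (gtr0_norm xi0).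
rewrite -RintegralB//; last 2 first.
- exact: (integrable_bker (@measurable_invM_sin R z) (@b T)).
- exact: (integrable_bker (@measurable_invM_sin R z) (@b e)).
by congr (_ * _); apply: eq_Rintegral => xi _; rewrite /wker -mulrBl mulrA.
Qed.

End smoothing_kernel_difference.

Section expectation_of_kernel.
Context (R : realType) d (Om : measurableType d) (P : probability Om R).
Variable X : {RV P >-> R}.
Local Notation leb := (@lebesgue_measure R).

Lemma bounded_integrable (f : Om -> R) (C : R) : measurable_fun setT f ->
  (forall w, `|f w| <= C) -> P.-integrable setT (EFin \o f).
Proof.
move=> mf fC; apply: (@le_integrable _ _ _ P setT _ _ (EFin \o cst C)) => //.
- exact/measurable_EFinP.
- by move=> w _; rewrite /= lee_fin (le_trans (fC w))// ler_norm.
- exact: finite_measure_integrable_cst.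
Qed.

Lemma Rintegral_cst_prob (C : R) : \int[P]_w C = C.
Proof. by rewrite Rintegral_cst//= probability_setT/= mulr1. Qed.

Lemma Rintegral_bounded (f : Om -> R) (C : R) : measurable_fun setT f ->
  (forall w, `|f w| <= C) -> `|\int[P]_w f w| <= C.
Proof.
move=> mf fC; have i := bounded_integrable mf fC.
rewrite (le_trans (le_normr_Rintegral _ i))// -[leRHS]Rintegral_cst_prob.
apply: le_Rintegral => //; first exact: (integrable_norm i).
exact: finite_measure_integrable_cst.
Qed.

Lemma Re_charfun xi : complex.Re (charfun P X xi) = \int[P]_w cos (xi * X w).
Proof.
by rewrite /charfun /cintegral/=; apply: eq_Rintegral => w _; rewrite expR0 mul1r.
Qed.

Lemma Im_charfun xi : complex.Im (charfun P X xi) = \int[P]_w sin (xi * X w).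
Proof.
by rewrite /charfun /cintegral/=; apply: eq_Rintegral => w _; rewrite expR0 mul1r.
Qed.

Lemma measurable_RV_comp (f : R -> R) : continuous f ->
  measurable_fun setT (fun w => f (X w)).
Proof. by move=> cf; apply: measurableT_comp => //; exact: continuous_measurable_fun. Qed.

Lemma Rintegral_sinB xi x : \int[P]_w sin (xi * (x - X w)) =
  sin (xi * x) * complex.Re (charfun P X xi) -
  cos (xi * x) * complex.Im (charfun P X xi).
Proof.
have ic : P.-integrable setT (EFin \o (fun w => cos (xi * X w))).
  apply: (@bounded_integrable _ 1) => [|w]; last exact: cos_max.
  by apply: (measurable_RV_comp (f := fun u => cos (xi * u))); continuous_tac.
have iS : P.-integrable setT (EFin \o (fun w => sin (xi * X w))).
  apply: (@bounded_integrable _ 1) => [|w]; last exact: sin_max.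
  by apply: (measurable_RV_comp (f := fun u => sin (xi * u))); continuous_tac.
rewrite Re_charfun Im_charfun -!RintegralZl// -RintegralB//.
- by apply: eq_Rintegral => w _; rewrite mulrBr sinB.
- exact: (integrableZl measurableT (sin (xi * x)) ic).
- exact: (integrableZl measurableT (cos (xi * x)) iS).
Qed.

(** By [wexpE] the law of X enters only through its characteristic function at xi: this is how
    information on characteristic functions reaches distribution functions. *)
Definition wexp (T e x xi : R) := \int[P]_w (wker T e xi * sin (xi * (x - X w))).

Lemma wexpE T e x xi : wexp T e x xi = wker T e xi *
  (sin (xi * x) * complex.Re (charfun P X xi) -
   cos (xi * x) * complex.Im (charfun P X xi)).
Proof.
rewrite /wexp -Rintegral_sinB RintegralZl//.
apply: (@bounded_integrable _ 1) => [|w]; last exact: sin_max.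
by apply: (measurable_RV_comp (f := fun u => sin (xi * (x - u)))); continuous_tac.
Qed.

Section Fubini_wker.
Variables (T e x : R).
Hypotheses (e0 : 0 < e) (eT : e <= T).

Let f (z : Om * measurableTypeR R) := wker T e z.2 * sin (z.2 * (x - X z.1)).

Let mf : measurable_fun setT f.
Proof.
apply: measurable_funM.
  exact: measurableT_comp (measurable_wker T e) measurable_snd.
apply: measurableT_comp; first by apply: continuous_measurable_fun; exact: continuous_sin.
apply: measurable_funM => //; apply: measurable_funB => //.
exact: measurableT_comp (measurable_fst).
Qed.

Let h (xi : R) := (pi ^+ 2 * T / e ^+ 2 + e^-1) * \1_(`]0, T]) xi.

Let ih : leb.-integrable setT (EFin \o h).
Proof. exact: integrable_cst_itv. Qed.

Let i1 : P.-integrable setT (EFin \o (cst 1 : Om -> R)).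
Proof. exact: finite_measure_integrable_cst. Qed.

Let fgh w xi : `|f (w, xi)| <= (cst 1 : Om -> R) w * h xi.
Proof.
rewrite /f/= normrM mul1r (le_trans _ (wker_bounded xi e0 eT))//.
by rewrite ler_piMr// sin_max.
Qed.

Lemma integrable_wexp : leb.-integrable setT (EFin \o wexp T e x).
Proof. exact: (integrable_Rintegral2 mf i1 ih fgh). Qed.

Lemma expectation_RTB :
  \int[P]_w (RT T (x - X w) - RT e (x - X w)) = pi^-1 * \int[leb]_xi wexp T e x xi.
Proof.
have <- := Rintegral_Fubini mf i1 ih fgh.
rewrite -(RintegralZl _ measurableT (integrable_Rintegral1 mf i1 ih fgh)).
by apply: eq_Rintegral => w _; rewrite -(wker_sin_integral _ e0 eT).
Qed.

End Fubini_wker.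

Lemma measurable_RT_RV (T x : R) : 0 <= T ->
  measurable_fun setT (fun w => RT T (x - X w)).
Proof.
move=> T0; apply: (measurable_RV_comp (f := fun u => RT T (x - u))).
apply: (@lipschitz_fun_continuous _ _ (T / pi)) => u v.
rewrite (le_trans (RT_lipschitz _ _ T0))//.
by rewrite (_ : x - u - (x - v) = v - u) 1?distrC//; ring.
Qed.

Lemma integrable_RT_RV (T x : R) : 0 < T ->
  P.-integrable setT (EFin \o (fun w => RT T (x - X w))).
Proof.
move=> T0; apply: (@bounded_integrable _ (mass T)) => [|w].
  exact: measurable_RT_RV (ltW T0).
exact: RT_norm_le.
Qed.

Definition step (u : R) : R := \1_(`[0, +oo[) u.

Lemma cdf_step a : fine (cdf X a) = \int[P]_w step (a - X w).
Proof.
rewrite /Rintegral (_ : (fun w => (step (a - X w))%:E) =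
  (fun w => (\1_(X @^-1` `]-oo, a]) w)%:E)).
  have mA : measurable (X @^-1` `]-oo, a]) by rewrite -[_ @^-1` _]setTI; exact: measurable_funP.
  by rewrite integral_indic//= setIT.
apply/funext => w; rewrite /step !indicE !mem_setE in_itv/= andbT subr_ge0.
by congr ((nat_of_bool _)%:R%:E); apply/idP/idP; rewrite inE/= in_itv.
Qed.

Lemma measurable_step : measurable_fun setT step.
Proof. exact: measurable_indic. Qed.

Lemma measurable_fine_cdf : measurable_fun setT (fun a => fine (cdf X a)).
Proof.
by apply: nondecreasing_measurable => //= r s rs;
  rewrite fine_le ?fin_num_measure// cdf_nondecreasing.
Qed.

(** Once expectation and integral are exchanged, each outcome contributes the layer-cake formula at
    z = x - X. Up to the constant [mass T], smoothing a distribution function thus amounts to taking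
    the expectation of [RT]. *)
Lemma rhop_cdf_integral (T x : R) : 0 < T ->
  \int[leb]_y (rhop T y * (fine (cdf X (x + y)) + fine (cdf X (x - y)))) =
  mass T + \int[P]_w RT T (x - X w).
Proof.
move=> T0.
pose f (z : Om * measurableTypeR R) :=
  rhop T z.2 * (step (x + z.2 - X z.1) + step (x - z.2 - X z.1)).
have mX : measurable_fun setT (fun z : Om * measurableTypeR R => X z.1).
  exact: measurableT_comp (measurable_fst).
have mf : measurable_fun setT f.
  apply: measurable_funM.
    exact: measurableT_comp (measurable_rhop T0) measurable_snd.
  apply: measurable_funD.
    apply: (measurableT_comp measurable_step); apply: measurable_funB => //.
    exact: measurable_funD.
  apply: (measurableT_comp measurable_step); apply: measurable_funB => //.
  exact: measurable_funB.
have s01 u : 0 <= step u <= 1 by rewrite /step indicE; case: (_ \in _); rewrite ?lexx ?ler01.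
pose h (y : R) := 2 * rhop T y.
have ih : leb.-integrable setT (EFin \o h).
  exact: (integrableZl measurableT 2 (integrable_rhop T0)).
have i1 : P.-integrable setT (EFin \o (cst 1 : Om -> R)).
  exact: finite_measure_integrable_cst.
have fgh w y : `|f (w, y)| <= (cst 1 : Om -> R) w * h y.
  have := s01 (x + y - X w); have := s01 (x - y - X w); have := rhop_ge0 T0 y.
  rewrite /f/= mul1r /h normrM => r0 s1 s2; rewrite (ger0_norm r0) mulrC ler_wpM2r//.
  by rewrite ger0_norm; lra.
have FE := Rintegral_Fubini mf i1 ih fgh.
transitivity (\int[P]_w \int[leb]_y f (w, y)).
  rewrite [RHS]FE; apply: eq_Rintegral => y _.
  have iS (u : R) : P.-integrable setT (EFin \o (fun w => step (u - X w))).
    apply: (@bounded_integrable _ 1) => [|w].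
      by apply: (measurableT_comp measurable_step); apply: measurable_funB.
    by have := s01 (u - X w); rewrite ler_norml; lra.
  rewrite /f/= !cdf_step RintegralZl//; last first.
    by have := integrableD measurableT (iS (x + y)) (iS (x - y)); apply: eq_integrable.
  by rewrite RintegralD.
transitivity (\int[P]_w (mass T + RT T (x - X w))); last first.
  rewrite RintegralD ?Rintegral_cst_prob//.
    exact: finite_measure_integrable_cst.
  exact: integrable_RT_RV.
apply: eq_Rintegral => w _; rewrite -RT_layer//; apply: eq_Rintegral => y _.
rewrite /f/= /step !indicE !mem_setE !in_itv/= !andbT; congr (_ * (_%:R + _%:R)).
  by congr nat_of_bool; apply/idP/idP; lra.
by congr nat_of_bool; apply/idP/idP; lra.
Qed.

End expectation_of_kernel.

Section kernel_lower_bound.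
Context (R : realType).
Local Notation leb := (@lebesgue_measure R).
Variables (T : R) (D : R -> R) (eta eta' l a h : R).
Hypotheses (T0 : 0 < T) (mD : measurable_fun setT D) (Deta : forall u, `|D u| <= eta).
Hypotheses (l0 : 0 <= l) (Da : forall s, 0 <= s -> eta' - l * s <= D (a + s)).
Hypothesis (hT : pi / T < h).

Lemma integrable_rhop_bounded (x : R) :
  leb.-integrable setT (fun y => (rhop T y * (D (x + y) + D (x - y)))%:E).
Proof.
have := integrableZl measurableT (2 * eta) (integrable_rhop T0).
apply: le_integrable => //.
  apply/measurable_EFinP; apply: measurable_funM; first exact: measurable_rhop.
  apply: measurable_funD.
    by apply: measurableT_comp mD _; apply: measurable_funD.
  by apply: measurableT_comp mD _; apply: measurable_funB.
move=> y _; rewrite /= lee_fin normrM (ger0_norm (rhop_ge0 T0 y)).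
have E0 : 0 <= eta := le_trans (normr_ge0 _) (Deta 0).
rewrite [leRHS]ger0_norm; last by apply: mulr_ge0; [rewrite mulr_ge0|exact: rhop_ge0].
rewrite mulrC ler_wpM2r ?rhop_ge0// (le_trans (ler_normD _ _))//.
by have := Deta (x + y); have := Deta (x - y); lra.
Qed.

(* The kernel is centred at [a + h], so that the whole window of radius [h] lies to
   the right of [a], where [D] stays above a line of slope [- l]. *)
Lemma rhop_lower_bound :
  2 * mass T * (eta' - l * h) - 2 * eta * tail0 T h - l * tail1 T h <=
  \int[leb]_y (rhop T y * (D (a + h + y) + D (a + h - y))).
Proof.
have h0 : 0 < h by rewrite (lt_trans _ hT)// divr_gt0 ?pi_gt0.
have i0 := integrable_rhopM T0 (measurable_itv `[h, +oo[).
have i1 := integrable_tail1 T0 hT.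
have ir := integrable_rhop T0.
have j0 := integrableZl measurableT (2 * eta) i0.
have j1 := integrableZl measurableT l i1.
have jr := integrableZl measurableT (2 * (eta' - l * h)) ir.
have j2 := integrableB measurableT jr j0.
have -> : 2 * mass T * (eta' - l * h) - 2 * eta * tail0 T h - l * tail1 T h =
  \int[leb]_y (2 * (eta' - l * h) * rhop T y - 2 * eta * (rhop T y * \1_(`[h, +oo[) y)
    - l * (y * rhop T y * \1_(`[h, +oo[) y)).
  rewrite RintegralB// RintegralB// !RintegralZl//.
  by rewrite /mass /tail0 /tail1 [in LHS]mulrAC.
apply: le_Rintegral => //.
- by have := integrableB measurableT j2 j1; apply: eq_integrable.
- exact: integrable_rhop_bounded.
move=> y _; have [y0|y0] := ltP y 0.
  by rewrite (rhop_lt0 T y0) !(mulr0, mul0r) !subr0.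
have r0 := rhop_ge0 T0 y.
have hy0 : 0 <= h + y by rewrite addr_ge0// ltW.
have := Da hy0; rewrite addrA => D1.
have := Deta (a + h - y); rewrite ler_norml => /andP[D2 _].
have := Deta a; rewrite ler_norml => /andP[_ D3].
have := Da (lexx 0); rewrite mulr0 subr0 addr0 => D4.
rewrite indicE mem_setE in_itv/= andbT.
(* For y < h both points lie to the right of a and the terms in l * y cancel. For y >= h the left
   point only has the bound - eta, and the loss is covered by eta' <= D a <= eta. *)
have [hy|hy] := leP h y.
  rewrite !mulr1.
  have -> : 2 * (eta' - l * h) * rhop T y - 2 * eta * rhop T y - l * (y * rhop T y) =
     rhop T y * (2 * eta' - 2 * (l * h) - 2 * eta - l * y) by ring.
  apply: ler_wpM2l => //.
  have : 0 <= l * h by rewrite mulr_ge0// ltW.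
  by move: D1; rewrite mulrDr; lra.
rewrite !mulr0 !subr0 mulrC; apply: ler_wpM2l => //.
have := @Da (h - y) _; rewrite addrA => D5.
have {}D5 : eta' - l * (h - y) <= D (a + h - y) by apply: D5; rewrite subr_ge0 ltW.
by move: D1 D5; rewrite mulrDr mulrBr; lra.
Qed.

End kernel_lower_bound.

(** * The smoothing inequality *)

Section smoothing_inequality.
Context (R : realType) d (Om : measurableType d) (P : probability Om R).
Context d' (Om' : measurableType d') (Q : probability Om' R).
Variables (X : {RV P >-> R}) (Y : {RV Q >-> R}).
Local Notation leb := (@lebesgue_measure R).

Let F a := fine (cdf X a).
Let G a := fine (cdf Y a).

Lemma fine_cdf_bounds d0 (O : measurableType d0) (M : probability O R) (Z : {RV M >-> R}) a :
  0 <= fine (cdf Z a) <= 1.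
Proof.
rewrite fine_ge0 ?cdf_ge0//= -lee_fin fineK ?fin_num_measure//.
exact: cdf_le1.
Qed.

Lemma fine_cdf_nd d0 (O : measurableType d0) (M : probability O R) (Z : {RV M >-> R}) a b :
  a <= b -> fine (cdf Z a) <= fine (cdf Z b).
Proof. by move=> ab; rewrite fine_le ?fin_num_measure// cdf_nondecreasing. Qed.

Lemma rhop_cdfB_integral (T x : R) : 0 < T ->
  \int[leb]_y (rhop T y * ((F (x + y) - G (x + y)) + (F (x - y) - G (x - y)))) =
  \int[P]_w RT T (x - X w) - \int[Q]_w RT T (x - Y w).
Proof.
move=> T0.
have E : \int[P]_w RT T (x - X w) - \int[Q]_w RT T (x - Y w) =
  (mass T + \int[P]_w RT T (x - X w)) - (mass T + \int[Q]_w RT T (x - Y w)).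
  by rewrite opprD addrACA subrr add0r.
rewrite E -!rhop_cdf_integral// -RintegralB//.
- by apply: eq_Rintegral => y _; rewrite -mulrBr /F /G; congr (_ * _); ring.
- apply: (integrable_rhop_bounded (eta := 1) T0 (measurable_fine_cdf X)) => u.
  by have := fine_cdf_bounds X u; rewrite /F ler_norml; lra.
- apply: (integrable_rhop_bounded (eta := 1) T0 (measurable_fine_cdf Y)) => u.
  by have := fine_cdf_bounds Y u; rewrite /G ler_norml; lra.
Qed.

Variables (T B l h lam : R).
Hypotheses (T0 : 0 < T) (l0 : 0 <= l) (hT : pi / T < h) (lam0 : 0 < lam).
Hypothesis SB : forall x,
  `|\int[P]_w RT T (x - X w) - \int[Q]_w RT T (x - Y w)| <= B.
Hypothesis Gl : forall a b, a <= b -> G b - G a <= l * (b - a).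
Hypothesis tail_le : tail0 T h <= lam / (2 * (1 + lam)).

(** Near a point where |F - G| almost reaches its supremum eta, monotonicity of F and the slope of G
    keep the difference large on one side, where the kernel is placed. The tail costs 2 * eta *
    tail0, and since (1 + lam) * 2 * tail0 <= lam this share of eta is absorbed on the left, at the
    price of the factor 1 + lam. *)
Lemma cdf_distance_smoothing a :
  `|F a - G a| <= (1 + lam) * (B + l * (h + tail1 T h)).
Proof.
pose D : set R := [set `|F a - G a| | a in [set: R]].
have Fb u := fine_cdf_bounds X u; have Gb u := fine_cdf_bounds Y u.
have supD : has_sup D.
  split; first by exists `|F 0 - G 0|, 0.
  exists 1 => _ [u _ <-]; have := Fb u; have := Gb u; rewrite -/(F u) -/(G u) ler_norml; lra.
set eta := sup D.
have Deta u : `|F u - G u| <= eta by apply: sup_upper_bound => //; exists u.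
have p0 : 0 <= tail0 T h.
  by apply: Rintegral_ge0 => y _; rewrite mulr_ge0// ?rhop_ge0// indicE.
have h0 : 0 < h by rewrite (lt_trans _ hT)// divr_gt0 ?pi_gt0.
have J0 : 0 <= tail1 T h.
  apply: Rintegral_ge0 => y _; have [y0|y0] := ltP y 0.
    by rewrite (rhop_lt0 T y0) mulr0 mul0r.
  by apply: mulr_ge0; [apply: mulr_ge0 => //; exact: rhop_ge0|rewrite indicE].
have B0 : 0 <= B := le_trans (normr_ge0 _) (SB 0).
have eta0 : 0 <= eta := le_trans (normr_ge0 _) (Deta 0).
have N := mass_ge_half T0.
have key (e' : R) (D' : R -> R) u : measurable_fun setT D' -> (forall v, `|D' v| <= eta) ->
    (forall s, 0 <= s -> e' - l * s <= D' (u + s)) ->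
    (\int[leb]_y (rhop T y * (D' (u + h + y) + D' (u + h - y))) <= B) ->
    e' <= B + l * (h + tail1 T h) + 2 * eta * tail0 T h.
  move=> mD' D'eta Du SB'.
  have := rhop_lower_bound T0 mD' D'eta l0 Du hT.
  move=> /le_trans/(_ SB') => K.
  have lJ : 0 <= l * tail1 T h by rewrite mulr_ge0.
  have ep : 0 <= 2 * eta * tail0 T h by rewrite !mulr_ge0.
  (* The bound 2 * mass >= 1 can be applied only to a nonnegative e' - l * h; otherwise e' < l * h
     already gives the claim. *)
  rewrite mulrDr; have [lh|lh] := leP (l * h) e'; last by lra.
  have : (e' - l * h) <= 2 * mass T * (e' - l * h).
    by rewrite ler_peMl ?subr_ge0//; lra.
  lra.
have mF := measurable_fine_cdf X; have mG := measurable_fine_cdf Y.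
(* The supremum need not be attained, hence the slack e. *)
have main e : 0 < e -> eta - e <= B + l * (h + tail1 T h) + 2 * eta * tail0 T h.
  move=> e0; have [_ [u _ <-] ue] := sup_adherent e0 supD.
  rewrite (le_trans (ltW ue))//.
  have [D0|D0] := leP 0 (F u - G u).
    rewrite ger0_norm//; apply: (key _ (fun v => F v - G v) u) => //.
    - exact: measurable_funB.
    - move=> s s0; have us : u <= u + s by rewrite lerDl.
      have := fine_cdf_nd X us; have := Gl us; rewrite -/(F _) -/(F _) addrAC subrr add0r; lra.
    - by rewrite rhop_cdfB_integral// (le_trans (ler_norm _)).
  (* When F lies below G, the difference stays large to the left of u; reflecting the line brings
     this back to the previous case. *)
  rewrite ltr0_norm//; apply: (key _ (fun v => - (F (- v) - G (- v))) (- u)).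
  - apply: measurable_funN; apply: measurable_funB.
      by apply: (measurableT_comp mF); exact: oppr_measurable.
    by apply: (measurableT_comp mG); exact: oppr_measurable.
  - by move=> v; rewrite normrN.
  - move=> s s0; have -> : - (- u + s) = u - s by ring.
    have us : u - s <= u by rewrite gerBl.
    have := fine_cdf_nd X us; have := Gl us; have -> : u - (u - s) = s by ring.
    rewrite -/(F _) -/(F _); lra.
  - have -> : \int[leb]_y (rhop T y * (- (F (- (- u + h + y)) - G (- (- u + h + y))) +
      - (F (- (- u + h - y)) - G (- (- u + h - y))))) =
      - \int[leb]_y (rhop T y * ((F (u - h + y) - G (u - h + y)) + (F (u - h - y) - G (u - h - y)))).
      rewrite -[RHS]mulN1r -RintegralZl//; last first.
        apply: (@integrable_rhop_bounded _ T (fun v => F v - G v) eta) => //.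
        exact: measurable_funB.
      apply: eq_Rintegral => y _.
      have -> : - (- u + h + y) = u - h - y by ring.
      have -> : - (- u + h - y) = u - h + y by ring.
      ring.
    rewrite rhop_cdfB_integral// (le_trans (ler_norm _))// normrN; exact: SB.
have etaB : eta <= B + l * (h + tail1 T h) + 2 * eta * tail0 T h.
  by apply/ler_addgt0Pr => e e0; rewrite -lerBlDr main.
rewrite (le_trans (Deta a))//.
have lp : (1 + lam) * (2 * tail0 T h) <= lam.
  move: tail_le; rewrite ler_pdivlMr; last by rewrite mulr_gt0// addr_gt0.
  lra.
have : eta * ((1 + lam) * (2 * tail0 T h)) <= eta * lam by rewrite ler_wpM2l.
have : (1 + lam) * eta <= (1 + lam) * (B + l * (h + tail1 T h) + 2 * eta * tail0 T h).
  by rewrite ler_wpM2l// addr_ge0// ltW.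
rewrite [in X in _ -> _ -> X]mulrDr; lra.
Qed.

End smoothing_inequality.

(** * From characteristic functions to distribution functions *)

Section kernel_functional_bounds.
Context (R : realType).
Local Notation leb := (@lebesgue_measure R).

Lemma Rintegral_le_itv (W g : R -> R) (T : R) :
  leb.-integrable setT (EFin \o W) -> leb.-integrable `]0, T] (EFin \o g) ->
  (forall xi, 0 < xi <= T -> `|W xi| <= g xi) ->
  (forall xi, ~~ (0 < xi <= T) -> W xi = 0) ->
  `|\int[leb]_xi W xi| <= \int[leb]_(xi in `]0, T]) g xi.
Proof.
move=> iW ig Wg W0; rewrite (le_trans (le_normr_Rintegral _ iW))//.
rewrite [leRHS]Rintegral_mkcond; apply: le_Rintegral => //.
- exact: (integrable_norm iW).
- by rewrite -restrict_EFin; apply: (@integrable_mkcond _ _ _ leb _ _ _).1.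
move=> xi _; rewrite patchE mem_setE in_itv/=.
by case: ifPn => [/Wg//|/W0 ->]; rewrite normr0.
Qed.

(** Cauchy-Schwarz by Lagrange's identity; moduli of complex numbers stay in the form of real sums
    of squares. *)
Lemma trig_comb_sqr_le (s c u v : R) : (s * u - c * v) ^+ 2 <= (s ^+ 2 + c ^+ 2) * (u ^+ 2 + v ^+ 2).
Proof.
rewrite -subr_ge0; have -> : (s ^+ 2 + c ^+ 2) * (u ^+ 2 + v ^+ 2) - (s * u - c * v) ^+ 2 =
  (s * v + c * u) ^+ 2 by ring.
exact: sqr_ge0.
Qed.

Lemma norm_le_of_sqr (u v : R) : 0 <= v -> u ^+ 2 <= v ^+ 2 -> `|u| <= v.
Proof.
by move=> v0 uv; rewrite -(@ler_pXn2r _ 2)// ?nnegrE// real_normK// num_real.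
Qed.

Section one_variable.
Context d (Om : measurableType d) (P : probability Om R).
Variable X : {RV P >-> R}.

(** The Lipschitz constant T / pi gives pointwise convergence, and the bound on the mass, uniform in
    T, the dominating constant. This disposes of the auxiliary kernel of small radius. *)
Lemma RT_expectation_cvg0 x :
  \int[P]_w RT (n.+1%:R^-1) (x - X w) @[n --> \oo] --> (0 : R).
Proof.
have n0 n : (0 : R) < n.+1%:R^-1 by rewrite invr_gt0 ltr0n.
have mf n : measurable_fun setT (fun w => (RT (n.+1%:R^-1) (x - X w))%:E).
  by apply/measurable_EFinP; apply: measurable_RT_RV; exact: ltW.
have h1 w : [set: Om] w -> (RT (n.+1%:R^-1) (x - X w))%:E @[n --> \oo] --> (0%:E : \bar R).
  move=> _; apply: cvg_EFin; first by apply: nearW.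
  have hc : (n.+1%:R^-1 / pi * `|x - X w|) @[n --> \oo] --> (0 / pi * `|x - X w| : R).
    apply: cvgM; last exact: cvg_cst.
    by apply: cvgM; [exact: cvg_harmonic|exact: cvg_cst].
  rewrite !mul0r in hc; move/cvgrPdist_le : hc => hc.
  apply/cvgrPdist_le => e e0; have := hc _ e0; apply: filterS => n /=.
  rewrite !sub0r !normrN => /(le_trans _); apply.
  have := RT_lipschitz (x - X w) 0 (ltW (n0 n)); rewrite RT0 !subr0 => /le_trans; apply.
  exact: ler_norm.
have h2 : {ae P, forall w, [set: Om] w ->
    (RT (n.+1%:R^-1) (x - X w))%:E @[n --> \oo] --> (0%:E : \bar R)}.
  exact: aeW.
have i3 : P.-integrable setT (EFin \o (fun=> 3 : R)).
  exact: finite_measure_integrable_cst.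
have h3 : {ae P, forall w n, [set: Om] w ->
    (`|(RT (n.+1%:R^-1) (x - X w))%:E| <= (3 : R)%:E)%E}.
  apply: aeW => w n _; rewrite lee_fin (le_trans (RT_norm_le (n0 n) _))//.
  exact: mass_le3.
have [_ _] := dominated_convergence measurableT mf (measurable_cst _) h2 i3 h3.
rewrite integral0 => /fine_cvgP[_]; apply: cvg_trans.
by apply: near_eq_cvg; apply: nearW => n.
Qed.

Lemma lerB_add_increment (t1 t2 t3 t4 u v : R) :
  (t1 - t2) - (t3 - t4) <= u -> t2 - t4 <= v -> t1 - t3 <= u + v.
Proof. lra. Qed.

Section density.
Variables (m : R) (g : R -> R).
Hypothesis g0 : forall xi, 0 < xi -> 0 <= g xi.
Hypothesis ig : forall T, leb.-integrable `]0, T] (EFin \o g).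
Hypothesis gm : forall T, 0 < T -> pi^-1 * \int[leb]_(xi in `]0, T]) g xi <= m.
Hypothesis phig : forall xi, 0 < xi ->
  complex.Re (charfun P X xi) ^+ 2 + complex.Im (charfun P X xi) ^+ 2 <= g xi ^+ 2.

(** The phases at a and b differ by at most xi (b - a). This cancels the factor 1 / xi and leaves
    the integral of the modulus of the characteristic function, which [g] bounds. *)
Lemma RT_increment_le (T a b : R) : 0 < T -> a <= b ->
  \int[P]_w (RT T (b - X w) - RT T (a - X w)) <= m * (b - a).
Proof.
move=> T0 ab; have ba : 0 <= b - a by rewrite subr_ge0.
apply/ler_addgt0Pr => e e0.
(* Small enough for the auxiliary kernel, whose primitive has Lipschitz constant ee / pi, to
   contribute at most e. *)
pose ee := Num.min T (e / ((b - a) / pi + 1)).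
have q0 : 0 < (b - a) / pi + 1 by rewrite ltr_wpDl// divr_ge0 ?pi_ge0.
have ee0 : 0 < ee by rewrite lt_min T0 divr_gt0.
have eeT : ee <= T by rewrite ge_min lexx.
have iT u := integrable_RT_RV X u T0; have ie u := integrable_RT_RV X u ee0.
have iB u : P.-integrable setT (EFin \o (fun w => RT T (u - X w) - RT ee (u - X w))).
  by have := integrableB measurableT (iT u) (ie u); apply: eq_integrable.
have main : \int[P]_w (RT T (b - X w) - RT ee (b - X w)) -
    \int[P]_w (RT T (a - X w) - RT ee (a - X w)) <= m * (b - a).
  rewrite !expectation_RTB// -mulrBr -RintegralB//; [|exact: integrable_wexp|exact: integrable_wexp].
  rewrite (le_trans (ler_norm _))// normrM ger0_norm ?invr_ge0 ?pi_ge0//.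
  apply: (@le_trans _ _ (pi^-1 * \int[leb]_(xi in `]0, T]) (g xi * (b - a)))); last first.
    by rewrite RintegralZr// mulrA ler_wpM2r// gm.
  rewrite ler_pM2l ?invr_gt0 ?pi_gt0//; apply: Rintegral_le_itv.
  - have := integrableB measurableT (integrable_wexp X b ee0 eeT) (integrable_wexp X a ee0 eeT).
    by apply: eq_integrable.
  - have mI : measurable (`]0, T]%classic : set (measurableTypeR R)) by [].
    by have := integrableZr mI (b - a) (ig T); apply: eq_integrable.
  - move=> xi /andP[x0 xT]; rewrite !wexpE -mulrBr normrM.
    apply: (@le_trans _ _ (xi^-1 * (xi * (g xi * (b - a))))); last by rewrite mulrA mulVf ?gt_eqF// mul1r.
    apply: ler_pM => //.
      rewrite (le_trans (wker_le_inv _ eeT))// indicE mem_setE in_itv/= x0 xT mulr1//.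
    apply: norm_le_of_sqr; first by rewrite !mulr_ge0 ?g0// ltW.
    set u := complex.Re _; set v := complex.Im _.
    have -> : sin (xi * b) * u - cos (xi * b) * v - (sin (xi * a) * u - cos (xi * a) * v) =
      (sin (xi * b) - sin (xi * a)) * u - (cos (xi * b) - cos (xi * a)) * v by ring.
    rewrite (le_trans (trig_comb_sqr_le _ _ _ _))//.
    have -> : (xi * (g xi * (b - a))) ^+ 2 = (xi * (b - a)) ^+ 2 * g xi ^+ 2 by ring.
    apply: ler_pM; rewrite ?addr_ge0 ?sqr_ge0//; last exact: phig.
    (* The squared length of a chord of the unit circle, which is at most the square of the
       angle. *)
    have -> : (sin (xi * b) - sin (xi * a)) ^+ 2 + (cos (xi * b) - cos (xi * a)) ^+ 2 =
       2 - 2 * cos (xi * b - xi * a).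
      rewrite cosB; have := cos2Dsin2 (xi * b); have := cos2Dsin2 (xi * a).
      move: (cos _) (cos _) (sin _) (sin _) => c1 c2 s1 s2 E1 E2.
      transitivity ((c1 ^+ 2 + s1 ^+ 2) + (c2 ^+ 2 + s2 ^+ 2) - 2 * (c1 * c2 + s1 * s2)).
        by ring.
      by rewrite E1 E2; ring.
    rewrite -mulrBr; have := @cos_ge_sqr R (xi * (b - a)) _.
    move=> H; have {}H : 1 - (xi * (b - a)) ^+ 2 / 2 <= cos (xi * (b - a)).
      by apply: H; rewrite mulr_ge0// ltW.
    lra.
  - move=> xi xT; rewrite !wexpE -mulrBr.
    have := @wker_le_inv R T ee xi eeT; rewrite indicE mem_setE in_itv/= (negbTE xT) mulr0.
    by rewrite normr_le0 => /eqP ->; rewrite mul0r.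
have small : \int[P]_w (RT ee (b - X w) - RT ee (a - X w)) <= e.
  apply: (@le_trans _ _ (ee / pi * (b - a))).
    rewrite (le_trans (ler_norm _))//; apply: Rintegral_bounded.
      by apply: measurable_funB; apply: measurable_RT_RV; exact: ltW.
    move=> w; rewrite (le_trans (RT_lipschitz _ _ (ltW ee0)))//.
    have -> : b - X w - (a - X w) = b - a by ring.
    by rewrite ger0_norm.
  have : ee <= e / ((b - a) / pi + 1) by rewrite ge_min lexx orbT.
  rewrite ler_pdivlMr// mulrDr mulr1 mulrA => K.
  by rewrite mulrAC (le_trans _ K)// lerDl ltW.
have EB (U V b' a' : R) (i1 : P.-integrable setT (EFin \o (fun w => RT U (b' - X w))))
    (i2 : P.-integrable setT (EFin \o (fun w => RT V (a' - X w)))) :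
    \int[P]_w (RT U (b' - X w) - RT V (a' - X w)) =
    \int[P]_w RT U (b' - X w) - \int[P]_w RT V (a' - X w).
  exact: (RintegralB measurableT i1 i2).
rewrite (EB _ _ _ _ (iT b) (ie b)) (EB _ _ _ _ (iT a) (ie a)) in main.
rewrite (EB _ _ _ _ (ie b) (ie a)) in small; rewrite (EB _ _ _ _ (iT b) (iT a)).
exact: lerB_add_increment main small.
Qed.

(** As T grows, RT T (b - X) - RT T (a - X) approaches a function that is at least 1 as soon as X
    keeps a margin s from both a and b. The bound on its expectation does not depend on T. *)
Lemma cdf_lipschitz_open (a b s : R) : 0 < s -> a + s <= b - s ->
  fine (cdf X (b - s)) - fine (cdf X (a + s)) <= m * (b - a).
Proof.
move=> s0 abs; have ab : a <= b by lra.
apply/ler_addgt0Pr => e e0.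
(* The first bound places s at twice the pole pi / T or beyond, so that s^2 - (pi / T)^2 >= 3 (pi /
   T)^2; the second makes twice the tail at most e. *)
pose T := Num.max (2 * pi / s) (2 / (s * e)).
have p0 := @pi_gt0 R.
have T0 : 0 < T by rewrite lt_max divr_gt0// mulr_gt0.
have T1 : 2 * pi / s <= T by rewrite le_max lexx.
have T2 : 2 / (s * e) <= T by rewrite le_max lexx orbT.
have pTs : 2 * (pi / T) <= s.
  by rewrite mulrA ler_pdivrMr// (mulrC s) -ler_pdivrMr.
have pT0 : 0 < pi / T by rewrite divr_gt0.
have hT : pi / T < s by lra.
have tau : 2 * tail0 T s <= e.
  have p2 := @pi_ge2 R.
  have D0 : 3 * (pi / T) ^+ 2 <= s ^+ 2 - (pi / T) ^+ 2 by nra.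
  have h1 : tail1 T s <= 2 / (3 * pi * T).
    rewrite (le_trans (tail1_le T0 hT))// ler_pdivrMr; last first.
      by rewrite (lt_le_trans _ D0)// mulr_gt0// exprn_gt0.
    apply: (@le_trans _ _ (2 / (3 * pi * T) * (3 * (pi / T) ^+ 2))).
      rewrite le_eqVlt; apply/orP; left; apply/eqP.
      have := lt0r_neq0 p0; have := lt0r_neq0 T0; generalize (@pi R) => p ? ?.
      by field; apply/andP.
    by rewrite ler_wpM2l// divr_ge0// !mulr_ge0// ltW.
  have h2 := tail0_le T0 hT.
  have h3 : tail0 T s <= 2 / (3 * pi * T) / s.
    by rewrite (le_trans h2)// ler_pM2r ?invr_gt0.
  apply: (@le_trans _ _ (2 * (2 / (3 * pi * T) / s))); first by rewrite ler_pM2l.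
  have -> : 2 * (2 / (3 * pi * T) / s) = 4 / (3 * pi * T * s).
    have := lt0r_neq0 p0; have := lt0r_neq0 T0; have := lt0r_neq0 s0; generalize (@pi R) => p ? ? ?.
    by field; apply/and3P.
  have Ts : 0 < T * s by rewrite mulr_gt0.
  rewrite ler_pdivrMr; last by rewrite !mulr_gt0.
  move: T2; rewrite ler_pdivrMr ?mulr_gt0// => T2.
  have -> : e * (3 * pi * T * s) = 3 * pi * (T * (s * e)) by ring.
  nra.
have N := mass_ge_half T0.
have s01 (u : R) : 0 <= step u <= 1 by rewrite /step indicE; case: (_ \in _); rewrite ?lexx ?ler01.
have := RT_increment_le T0 ab.
have iS u : P.-integrable setT (EFin \o (fun w => step (u - X w))).
  apply: (@bounded_integrable _ _ _ _ _ 1) => [|w].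
    by apply: (measurableT_comp (@measurable_step R)); apply: measurable_funB.
  by have := s01 (u - X w); rewrite ler_norml; lra.
have iSB : P.-integrable setT (EFin \o (fun w => step (b - s - X w) - step (a + s - X w))).
  by have := integrableB measurableT (iS (b - s)) (iS (a + s)); apply: eq_integrable.
have : \int[P]_w ((1 - 2 * tail0 T s) * (step (b - s - X w) - step (a + s - X w))) <=
    \int[P]_w (RT T (b - X w) - RT T (a - X w)).
  apply: le_Rintegral => //.
  - exact: (integrableZl measurableT (1 - 2 * tail0 T s) iSB).
  - by have := integrableB measurableT (integrable_RT_RV X b T0) (integrable_RT_RV X a T0);
      apply: eq_integrable.
  move=> w _; have nd : RT T (a - X w) <= RT T (b - X w) by apply: RT_nd => //; lra.
  rewrite /step !indicE !mem_setE !in_itv/= !andbT.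
  have [h1|h1] := leP 0 (b - s - X w); have [h2|h2] := leP 0 (a + s - X w).
  - by rewrite subrr mulr0 subr_ge0.
  (* X lies between a + s and b - s: the two arguments of [RT] are on opposite sides of 0 at
     distance at least s, and each contributes at least 1 / 2 - tail0. *)
  - rewrite subr0 mulr1.
    have r1 := RT_ge_tail T0 hT.
    have : RT T s <= RT T (b - X w) by apply: RT_nd => //; lra.
    have : RT T s <= RT T (- (a - X w)) by apply: RT_nd => //; lra.
    rewrite RTN; lra.
  - lra.
  - by rewrite subrr mulr0 subr_ge0.
rewrite RintegralZl// RintegralB// -!cdf_step => K1 K2.
have := le_trans K1 K2.
have := fine_cdf_bounds X (b - s); have := fine_cdf_bounds X (a + s).
have := @fine_cdf_nd R _ _ _ X _ _ abs.
move: (fine _) (fine _) tau => F1 F2 tau.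
nra.
Qed.

Lemma cdf_lipschitz (a b : R) : a <= b ->
  fine (cdf X b) - fine (cdf X a) <= m * (b - a).
Proof.
move=> ab.
have m0 : 0 <= m.
  apply: le_trans (gm ltr01); rewrite mulr_ge0 ?invr_ge0 ?pi_ge0//.
  by apply: Rintegral_ge0 => xi /=; rewrite in_itv/= => /andP[/g0].
apply/ler_addgt0Pr => e e0.
(* The margin lost in [cdf_lipschitz_open] is regained by widening the interval by s on both sides,
   which costs 2 * m * s <= e. *)
pose s := e / (2 * m + 1).
have q0 : 0 < 2 * m + 1 by rewrite ltr_wpDl// mulr_ge0.
have s0 : 0 < s by rewrite divr_gt0.
have := @cdf_lipschitz_open (a - s) (b + s) s s0.
rewrite subrK addrK => /(_ ab); move=> /le_trans; apply.
have -> : m * (b + s - (a - s)) = m * (b - a) + 2 * m * s by ring.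
rewrite lerD2l; have : s * (2 * m + 1) = e by rewrite /s divfK// gt_eqF.
have := ltW s0; nra.
Qed.

End density.
End one_variable.

Section two_variables.
Context d (Om : measurableType d) (P : probability Om R).
Context d' (Om' : measurableType d') (Q : probability Om' R).
Variables (X : {RV P >-> R}) (Y : {RV Q >-> R}).

(** The estimate is proved after subtraction of the kernel of radius e, with a bound independent of
    e; then e tends to 0. *)
Lemma RT_expectation_difference (T x : R) (g : R -> R) : 0 < T ->
  (forall xi, 0 < xi <= T -> 0 <= g xi) -> leb.-integrable `]0, T] (EFin \o g) ->
  (forall xi, 0 < xi <= T ->
    (complex.Re (charfun P X xi) - complex.Re (charfun Q Y xi)) ^+ 2 +
    (complex.Im (charfun P X xi) - complex.Im (charfun Q Y xi)) ^+ 2 <= (xi * g xi) ^+ 2) ->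
  `|\int[P]_w RT T (x - X w) - \int[Q]_w RT T (x - Y w)| <=
    pi^-1 * \int[leb]_(xi in `]0, T]) g xi.
Proof.
move=> T0 g0 ig phig.
pose A e := (\int[P]_w RT T (x - X w) - \int[P]_w RT e (x - X w)) -
            (\int[Q]_w RT T (x - Y w) - \int[Q]_w RT e (x - Y w)).
have AB e : 0 < e -> e <= T -> `|A e| <= pi^-1 * \int[leb]_(xi in `]0, T]) g xi.
  move=> e0 eT; rewrite /A.
  rewrite -RintegralB//; [|exact: integrable_RT_RV|exact: integrable_RT_RV].
  rewrite -RintegralB//; [|exact: integrable_RT_RV|exact: integrable_RT_RV].
  rewrite !expectation_RTB// -mulrBr -RintegralB//; [|exact: integrable_wexp|exact: integrable_wexp].
  rewrite normrM ger0_norm ?invr_ge0 ?pi_ge0//.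
  rewrite ler_pM2l ?invr_gt0 ?pi_gt0//; apply: Rintegral_le_itv => //.
  - have := integrableB measurableT (integrable_wexp X x e0 eT) (integrable_wexp Y x e0 eT).
    by apply: eq_integrable.
  - move=> xi /andP[x0 xT]; rewrite !wexpE -mulrBr normrM.
    apply: (@le_trans _ _ (xi^-1 * (xi * g xi))); last by rewrite mulrA mulVf ?gt_eqF// mul1r.
    apply: ler_pM => //.
      rewrite (le_trans (wker_le_inv _ eT))// indicE mem_setE in_itv/= x0 xT mulr1//.
    apply: norm_le_of_sqr; first by rewrite mulr_ge0 ?g0 ?x0// ltW.
    set u := complex.Re _; set v := complex.Im _; set u' := complex.Re _; set v' := complex.Im _.
    have -> : sin (xi * x) * u - cos (xi * x) * v - (sin (xi * x) * u' - cos (xi * x) * v') =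
      sin (xi * x) * (u - u') - cos (xi * x) * (v - v') by ring.
    rewrite (le_trans (trig_comb_sqr_le _ _ _ _))//.
    by rewrite addrC cos2Dsin2 mul1r phig// x0.
  - move=> xi xT; rewrite !wexpE -mulrBr.
    have := @wker_le_inv R T e xi eT; rewrite indicE mem_setE in_itv/= (negbTE xT) mulr0.
    by rewrite normr_le0 => /eqP ->; rewrite mul0r.
have cA : A (n.+1%:R^-1) @[n --> \oo] --> ((\int[P]_w RT T (x - X w) - 0) -
    (\int[Q]_w RT T (x - Y w) - 0) : R).
  apply: cvgB; apply: cvgB; [exact: cvg_cst|exact: RT_expectation_cvg0|
    exact: cvg_cst|exact: RT_expectation_cvg0].
rewrite !subr0 in cA.
have cnA : `|A n.+1%:R^-1| @[n --> \oo] -->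
    `|\int[P]_w RT T (x - X w) - \int[Q]_w RT T (x - Y w)| by exact: cvg_norm cA.
rewrite -(cvg_lim _ cnA)//; apply: limr_le; first by apply/cvg_ex; eexists; exact: cnA.
near=> n; apply: AB; first by rewrite invr_gt0 ltr0n.
near: n; have /cvgrPdist_le/(_ _ T0) := @cvg_harmonic R; apply: filterS => n.
by rewrite sub0r normrN ger0_norm ?harmonic_ge0.
Unshelve. all: by end_near. Qed.

End two_variables.
End kernel_functional_bounds.

(** * Integrals of Gamma type *)

Section Gamma_integral.
Context (R : realType).
Local Notation leb := (@lebesgue_measure R).

(** Exhausts the half-line by compact intervals away from 0, on which primitives and substitutions
    raise no question of convergence. *)
Lemma ge0_integral_0y_le (f : R -> R) (M : R) : measurable_fun setT f ->
  (forall x, 0 < x -> 0 <= f x) ->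
  (forall a b, 0 < a -> a <= b -> (\int[leb]_(x in `[a, b]) (f x)%:E <= M%:E)%E) ->
  (\int[leb]_(x in `]0%R, +oo[) (f x)%:E <= M%:E)%E.
Proof.
move=> mf f0 fM.
pose F (n : nat) : set (measurableTypeR R) := `[(n.+1%:R)^-1, n.+1%:R]%classic.
have FE : \bigcup_n F n = `]0, +oo[%classic.
  apply/seteqP; split=> x /=; rewrite in_itv/= ?andbT.
    by move=> [n _]; rewrite /F/= in_itv/= => /andP[+ _]; apply: lt_le_trans; rewrite invr_gt0 ltr0n.
  (* The successor of this index exceeds both x and 1 / x. *)
  move=> x0; exists (Num.truncn (x + x^-1)) => //; rewrite /F/= in_itv/=.
  have xn := truncnS_gt (x + x^-1).
  apply/andP; split; last by rewrite ltW// (lt_trans _ xn)// ltrDl invr_gt0.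
  by rewrite invf_ple ?posrE// ltW// (lt_trans _ xn)// ltrDr.
have Fnd : nondecreasing_seq F.
  move=> n m nm; rewrite subsetEset => x; rewrite /F/= !in_itv/= => /andP[x1 x2].
  apply/andP; split.
    by rewrite (le_trans _ x1)// lef_pV2 ?posrE ?ltr0n// ler_nat ltnS.
  by rewrite (le_trans x2)// ler_nat ltnS.
have mF n : measurable (F n) by exact: measurable_itv.
have mfF n : measurable_fun (F n) (EFin \o f).
  by apply/measurable_EFinP; exact: measurable_funS mf.
have f0F n x : F n x -> (0 <= (EFin \o f) x)%E.
  rewrite /F/= in_itv/= => /andP[x1 _]; rewrite lee_fin f0//.
  by rewrite (lt_le_trans _ x1)// invr_gt0 ltr0n.
have := @ge0_nondecreasing_set_cvg_integral _ _ _ F (EFin \o f) leb Fnd mF mfF f0F.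
rewrite FE => cv; rewrite -(cvg_lim _ cv)//; apply: lime_le.
  by apply/cvg_ex; eexists; exact: cv.
apply: nearW => n; apply: fM; first by rewrite invr_gt0 ltr0n.
by rewrite (@le_trans _ _ 1)// ?invf_le1 ?ltr0n// ler1n.
Qed.

Lemma FTC2_gt0 (f F : R -> R) (a b : R) : 0 < a -> a <= b ->
  (forall x : R, 0 < x -> is_derive x (1 : R) F (f x)) ->
  (forall x : R, 0 < x -> {for x, continuous f}) ->
  (\int[leb]_(x in `[a, b]) (f x)%:E = (F b - F a)%:E)%E.
Proof.
move=> a0; rewrite le_eqVlt => /predU1P[<- _ _|ab dF cf].
  by rewrite subrr set_itv1 integral_set1.
have b0 := lt_trans a0 ab.
have cF x : 0 < x -> {for x, continuous F}.
  by move=> /dF dFx; apply/differentiable_continuous/derivable1_diffP.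
rewrite (@continuous_FTC2 _ f F)//.
- apply: continuous_in_subspaceT => x; rewrite inE/= in_itv/= => /andP[ax _].
  by apply: cf; exact: lt_le_trans ax.
- split.
  + by move=> x; rewrite in_itv/= => /andP[ax _]; have := dF _ (lt_trans a0 ax).
  + by apply: cvg_at_right_filter; exact: cF.
  + by apply: cvg_at_left_filter; exact: cF.
- move=> x; rewrite in_itv/= => /andP[ax _].
  by have dFx := dF _ (lt_trans a0 ax); rewrite derive1E derive_val.
Qed.

Lemma continuous_powR_gt0 (p x : R) : 0 < x -> {for x, continuous (fun u : R => u `^ p)}.
Proof.
move=> x0; apply/differentiable_continuous/derivable1_diffP.
by have [] := is_derive1_powR p x0.
Qed.

Lemma measurable_powR_exp (p k q : R) :
  measurable_fun setT (fun u : R => u `^ p * expR (- (k * u `^ q))).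
Proof.
apply: measurable_funM; first exact: measurable_powR.
apply: measurableT_comp; first exact: measurable_expR.
apply: measurable_funN; apply: measurable_funM => //; exact: measurable_powR.
Qed.

(* Bounds the integrand of [Gamma s] by a multiple of the derivative of
   - 1 / (1 + x^s), which is integrable at both ends. *)
Lemma powR_exp_bounded (s : R) : 0 < s ->
  exists2 C : R, 0 < C & forall x, 0 < x -> (1 + x `^ s) ^+ 2 * expR (- x) <= C.
Proof.
(* x^s is at most 1 + x^N, and the square of x^N is controlled by the term of degree 2 N in the
   exponential series. *)
move=> s0; pose N := (Num.truncn s).+1.
have sN : s <= N%:R.
  by rewrite ltW// truncnS_gt.
pose k := (N * 2)%N.
have kE : k = (k.-1).+1 by rewrite prednK// muln_gt0.
exists (8 + 2 * k`!%:R); first by rewrite ltr_pwDl// mulr_ge0// ler0n.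
move=> x x0; have x00 := ltW x0.
have xs : x `^ s <= 1 + x ^+ N.
  have [x1|x1] := leP x 1.
    rewrite (@le_trans _ _ 1)// ?lerDl ?exprn_ge0//.
    rewrite (@le_trans _ _ (1 `^ s)) ?powR1//.
    by rewrite -[leRHS](congr1 (@^~ s) (powR1 R)) ge0_ler_powR ?nnegrE ?ler01 ?(ltW s0).
  rewrite (@le_trans _ _ (x ^+ N))// ?lerDr ?ler01// -powR_mulrn//.
  by rewrite ler_powR// ltW.
have e1 : 1 + x ^+ k / k`!%:R <= expR x by rewrite kE; exact: expR_ge1Dxn.
have k0 : 0 < k`!%:R :> R by rewrite ltr0n fact_gt0.
have xk : x ^+ k <= k`!%:R * expR x.
  by rewrite mulrC -ler_pdivrMr// (le_trans _ e1)// lerDr ler01.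
have ex1 : 1 <= expR x by rewrite -expR0 ler_expR.
rewrite expRN ler_pdivrMr ?expR_gt0//.
have y0 : 0 <= x `^ s := powR_ge0 _ _.
have z0 : 0 <= x ^+ N by rewrite exprn_ge0.
have zk : x ^+ k = (x ^+ N) ^+ 2 by rewrite /k exprM.
rewrite zk in xk; move: xs xk ex1 y0 z0 k0.
move: (x `^ s) (x ^+ N) (expR x) (k`!%:R : R) => y z E K.
move=> h1 h2 h3 h4 h5 h6.
have : (1 + y) ^+ 2 <= (2 + z) ^+ 2 by rewrite !expr2; nra.
have : (2 + z) ^+ 2 <= 8 + 2 * z ^+ 2.
  by have := sqr_ge0 (z - 2); rewrite !expr2; lra.
rewrite mulrDl; lra.
Qed.

Definition gammaf (s x : R) := x `^ (s - 1) * expR (- x).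

Lemma measurable_gammaf s : measurable_fun setT (gammaf s).
Proof.
apply: measurable_funM; first exact: measurable_powR.
by apply: measurableT_comp; [exact: measurable_expR|exact: oppr_measurable].
Qed.

Lemma continuous_gammaf (s x : R) : 0 < x -> {for x, continuous (gammaf s)}.
Proof.
move=> x0; apply: cvgM; first exact: continuous_powR_gt0.
apply: (@continuous_comp _ _ _ (fun u : R => - u) expR); last exact: continuous_expR.
by apply: cvgN; exact: cvg_id.
Qed.

Lemma gammaf_ge0 s x : 0 <= gammaf s x.
Proof. by rewrite mulr_ge0 ?powR_ge0 ?expR_ge0. Qed.

Lemma gammaf_integral_fin s : 0 < s ->
  (\int[leb]_(x in `]0%R, +oo[) (gammaf s x)%:E < +oo)%E.
Proof.
move=> s0; have [C C0 HC] := powR_exp_bounded s0.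
apply: (@le_lt_trans _ _ (C / s)%:E); last exact: ltry.
apply: ge0_integral_0y_le; first exact: measurable_gammaf.
  by move=> x _; exact: gammaf_ge0.
move=> a b a0 ab.
pose F (x : R) := - (C / s * (1 + x `^ s)^-1).
pose f (x : R) := C * (x `^ (s - 1) / (1 + x `^ s) ^+ 2).
have q0 (x : R) : 0 < 1 + x `^ s by rewrite ltr_pwDl// powR_ge0.
have dF (x : R) : 0 < x -> is_derive x (1 : R) F (f x).
  move=> x0; apply: is_derive_exists; eexists; split.
    rewrite /F; notypeclasses refine (is_derive_oppr _).
    notypeclasses refine (is_derive_mulr _ _); first exact: is_derive_cst.
    notypeclasses refine (is_derive_invr _ _); first by rewrite gt_eqF.
    notypeclasses refine (is_derive_addr _ _); first exact: is_derive_cst.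
    exact: is_derive1_powR.
  by rewrite /= /f; field; rewrite !gt_eqF.
have cf (x : R) : 0 < x -> {for x, continuous f}.
  move=> x0; apply: cvgM; first exact: cvg_cst.
  apply: cvgM; first exact: continuous_powR_gt0.
  apply: cvgV; first by rewrite expf_neq0// gt_eqF.
  have c1 : {for x, continuous (fun u : R => 1 + u `^ s)}.
    by apply: cvgD; [exact: cvg_cst|exact: continuous_powR_gt0].
  by apply: cvgM; exact: c1.
apply: (@le_trans _ _ (\int[leb]_(x in `[a, b]) (f x)%:E)%E).
  apply: ge0_le_integral => //.
  - by move=> x _; rewrite lee_fin gammaf_ge0.
  - by apply/measurable_EFinP; apply: measurable_funTS; exact: measurable_gammaf.
  - apply/measurable_EFinP; apply: measurable_funTS; apply: measurable_funM => //.
    apply: measurable_funM; first exact: measurable_powR.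
    apply: measurableT_comp; first exact: measurable_invr.
    by apply: measurable_funX; apply: measurable_funD => //; exact: measurable_powR.
  - move=> x /=; rewrite in_itv/= => /andP[ax _]; have x0 := lt_le_trans a0 ax.
    rewrite lee_fin /gammaf /f mulrCA ler_wpM2l ?powR_ge0//.
    by rewrite ler_pdivlMr ?exprn_gt0// mulrC HC.
rewrite (FTC2_gt0 a0 ab dF cf) lee_fin /F.
have Cs : 0 < C / s by rewrite divr_gt0.
have i1 : 0 <= C / s * (1 + b `^ s)^-1 by rewrite mulr_ge0 ?invr_ge0 ?(ltW (q0 _))// ltW.
have i2 : C / s * (1 + a `^ s)^-1 <= C / s.
  by rewrite ler_piMr ?(ltW Cs)// invf_le1// lerDl powR_ge0.
lra.
Qed.

(** Finiteness excludes the default value that [fine] takes at infinity. *)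
Lemma gammaf_integralE s : 0 < s ->
  (\int[leb]_(x in `]0%R, +oo[) (gammaf s x)%:E = (Gamma s)%:E)%E.
Proof.
move=> s0; rewrite /Gamma /Rintegral fineK// ge0_fin_numE ?gammaf_integral_fin//.
by apply: integral_ge0 => x _; rewrite lee_fin gammaf_ge0.
Qed.

Lemma Gamma_gt0 (s : R) : 0 < s -> 0 < Gamma s.
Proof.
move=> s0; rewrite -lte_fin -gammaf_integralE//.
(* A lower bound of the integrand on [1, 2]; the absolute value covers both signs of s - 1. *)
pose c := expR (- (`|s - 1| * ln 2) - 2).
apply: (@lt_le_trans _ _ (\int[leb]_(x in `[1%R, 2%R]) (c%:E))%E).
  rewrite integral_cst//= lebesgue_measure_itv/= lte_fin ltr1n.
  by rewrite -EFinB -EFinM lte_fin mulr_gt0 ?expR_gt0//; lra.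
apply: (@le_trans _ _ (\int[leb]_(x in `[1%R, 2%R]) (gammaf s x)%:E)%E).
  apply: ge0_le_integral => //.
  - by move=> x _; rewrite lee_fin expR_ge0.
  - by apply/measurable_EFinP; apply: measurable_funTS; exact: measurable_gammaf.
  - move=> x /=; rewrite in_itv/= => /andP[x1 x2].
    have x0 : 0 < x := lt_le_trans ltr01 x1.
    rewrite lee_fin /gammaf /c expRD /powR gt_eqF// ler_pM ?expR_ge0//.
      rewrite ler_expR lerNl -mulNr (le_trans (ler_norm _))// normrM normrN ler_wpM2l//.
      by rewrite ger0_norm ?ln_ge0// ler_ln ?posrE.
    by rewrite ler_expR lerN2.
apply: ge0_subset_integral => //.
- by apply/measurable_EFinP; apply: measurable_funTS; exact: measurable_gammaf.
- by move=> x _; rewrite lee_fin gammaf_ge0.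
- by move=> x /=; rewrite !in_itv/= andbT => /andP[x1 _]; exact: lt_le_trans x1.
Qed.

Lemma powR_substitution (g : R -> R) (k q a b : R) : 0 < k -> 0 < q ->
  0 < a -> a <= b -> (forall x, 0 < x -> {for x, continuous g}) ->
  (\int[leb]_(x in `[(k * a `^ q)%R, (k * b `^ q)%R]) (g x)%:E =
   \int[leb]_(u in `[a, b]) (g (k * u `^ q) * (k * (q * u `^ (q - 1))))%:E)%E.
Proof.
move=> k0 q0 a0 ab cg.
pose phi (u : R) := k * u `^ q; pose phi' (u : R) := k * (q * u `^ (q - 1)).
have dphi (u : R) : 0 < u -> is_derive u (1 : R) phi (phi' u).
  move=> u0; apply: is_derive_exists; eexists; split.
    notypeclasses refine (is_derive_mulr _ _); first exact: is_derive_cst.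
    exact: is_derive1_powR.
  by rewrite /= mulr0 addr0.
have cphi (u : R) : 0 < u -> {for u, continuous phi}.
  by move=> /dphi ?; apply/differentiable_continuous/derivable1_diffP.
have cphi' (u : R) : 0 < u -> {for u, continuous phi'}.
  move=> u0; apply: cvgM; first exact: cvg_cst.
  by apply: cvgM; [exact: cvg_cst|exact: continuous_powR_gt0].
have phiE (u : R) : 0 < u -> phi^`()%classic u = phi' u.
  by move=> /dphi ?; rewrite derive1E derive_val.
have cdphi (u : R) : 0 < u -> {for u, continuous (phi^`()%classic)}.
  move=> u0; rewrite /prop_for /continuous_at phiE//.
  apply: cvg_trans (cphi' _ u0); apply: near_eq_cvg.
  have : \forall v \near u, 0 < v by exact: lt_nbhsr.
  by apply: filterS => v v0; rewrite phiE.
have b0 := lt_le_trans a0 ab.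
rewrite -/(phi a) -/(phi b) (@integration_by_substitution_increasing _ phi g a b)//.
- by apply: eq_integral => u; rewrite inE/= in_itv/= => /andP[au _];
    rewrite fctE /= phiE// (lt_le_trans a0).
- move=> x y; rewrite !in_itv/= => /andP[ax _] /andP[ay _] xy.
  rewrite ltr_pM2l// gt0_ltr_powR// ?nnegrE ltW//.
    exact: lt_le_trans ax.
  exact: lt_le_trans ay.
- by move=> x; rewrite in_itv/= => /andP[ax _]; apply: cdphi; exact: lt_trans ax.
- by apply/cvg_ex; eexists; apply: cvg_at_right_filter; exact: cdphi.
- by apply/cvg_ex; eexists; apply: cvg_at_left_filter; exact: cdphi.
- split.
  + by move=> x; rewrite in_itv/= => /andP[ax _]; have := dphi _ (lt_trans a0 ax).
  + by apply: cvg_at_right_filter; exact: cphi.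
  + by apply: cvg_at_left_filter; exact: cphi.
- apply: continuous_in_subspaceT => x; rewrite inE/= in_itv/= => /andP[ax _].
  by apply: cg; apply: lt_le_trans ax; rewrite mulr_gt0// powR_gt0.
Qed.

(** On a compact interval the substitution x = k u^q turns the integrand into a multiple of that of
    Gamma (s / q), and the image interval stays inside ]0, +oo[. *)
Lemma powR_exp_integral_le (s k q : R) : 0 < s -> 0 < k -> 0 < q ->
  (\int[leb]_(u in `]0%R, +oo[) (u `^ (s - 1) * expR (- (k * u `^ q)))%:E <=
   (q^-1 * (k `^ (s / q))^-1 * Gamma (s / q))%:E)%E.
Proof.
move=> s0 k0 q0; have sq0 : 0 < s / q by rewrite divr_gt0.
have ks0 : 0 < k `^ (s / q) by rewrite powR_gt0.
apply: ge0_integral_0y_le; first exact: measurable_powR_exp.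
  by move=> x _; rewrite mulr_ge0 ?powR_ge0 ?expR_ge0.
move=> a b a0 ab.
have E (u : R) : 0 < u -> u `^ (s - 1) * expR (- (k * u `^ q)) =
    q^-1 * (k `^ (s / q))^-1 * (gammaf (s / q) (k * u `^ q) * (k * (q * u `^ (q - 1)))).
  move=> u0; rewrite /gammaf powRM ?powR_ge0 ?(ltW k0)//.
  rewrite -(powRrM u).
  have -> : q * (s / q - 1) = (s - 1) - (q - 1) by field; rewrite gt_eqF.
  have u1 := lt0r_neq0 u0; have k1 := lt0r_neq0 k0.
  rewrite (@powRB _ u (s - 1) (q - 1)) ?u1 ?implybT//.
  rewrite (@powRB _ k (s / q) 1) ?k1 ?implybT// powRr1 ?(ltW k0)//.
  by field; rewrite !gt_eqF// powR_gt0.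
rewrite (_ : (\int[leb]_(x in _) _ = \int[leb]_(u in `[a, b])
   ((q^-1 * (k `^ (s / q))^-1)%:E *
    (gammaf (s / q) (k * u `^ q) * (k * (q * u `^ (q - 1))))%:E))%E); last first.
  apply: eq_integral => u; rewrite inE/= in_itv/= => /andP[au _].
  by rewrite -EFinM E// (lt_le_trans a0).
have c0 : 0 <= q^-1 * (k `^ (s / q))^-1 by rewrite mulr_ge0 ?invr_ge0 ?powR_ge0 ?(ltW q0).
have mg : measurable_fun setT (fun u : R => gammaf (s / q) (k * u `^ q) * (k * (q * u `^ (q - 1)))).
  apply: measurable_funM.
    apply: (measurableT_comp (@measurable_gammaf (s / q))).
    by apply: measurable_funM => //; exact: measurable_powR.
  apply: measurable_funM => //; apply: measurable_funM => //; exact: measurable_powR.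
rewrite ge0_integralZl//.
- rewrite [leRHS]EFinM lee_pmul2l ?fin_numE//; last by rewrite lte_fin mulr_gt0 ?invr_gt0.
  rewrite -(powR_substitution k0 q0 a0 ab); last by move=> x; exact: continuous_gammaf.
  rewrite -gammaf_integralE//; apply: ge0_subset_integral => //.
  + by apply/measurable_EFinP; apply: measurable_funTS; exact: measurable_gammaf.
  + by move=> x _; rewrite lee_fin gammaf_ge0.
  + move=> x /=; rewrite !in_itv/= andbT => /andP[+ _]; apply: lt_le_trans.
    by rewrite mulr_gt0// powR_gt0.
- by apply/measurable_EFinP; apply: measurable_funTS.
- move=> u _; rewrite lee_fin mulr_ge0 ?gammaf_ge0// !mulr_ge0 ?powR_ge0 ?(ltW k0) ?(ltW q0)//.
Qed.

Lemma powR_exp_integrable (s k q T : R) : 0 < s -> 0 < k -> 0 < q ->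
  leb.-integrable `]0, T] (EFin \o (fun u : R => u `^ (s - 1) * expR (- (k * u `^ q)))).
Proof.
move=> s0 k0 q0; apply/integrableP; split.
  by apply/measurable_EFinP; apply: measurable_funTS; exact: measurable_powR_exp.
apply: (@le_lt_trans _ _ (q^-1 * (k `^ (s / q))^-1 * Gamma (s / q))%:E); last exact: ltry.
apply: le_trans (powR_exp_integral_le s0 k0 q0).
have f0 u : 0 <= u `^ (s - 1) * expR (- (k * u `^ q)) by rewrite mulr_ge0 ?powR_ge0 ?expR_ge0.
under eq_integral do rewrite /= ger0_norm//.
apply: ge0_subset_integral => //.
- by apply/measurable_EFinP; apply: measurable_funTS; exact: measurable_powR_exp.
- by move=> u _; rewrite lee_fin.
- by move=> x /=; rewrite !in_itv/= andbT => /andP[].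
Qed.

Lemma powR_exp_Rintegral_le (s k q T : R) : 0 < s -> 0 < k -> 0 < q ->
  \int[leb]_(u in `]0, T]) (u `^ (s - 1) * expR (- (k * u `^ q))) <=
  q^-1 * (k `^ (s / q))^-1 * Gamma (s / q).
Proof.
move=> s0 k0 q0; have i := powR_exp_integrable T s0 k0 q0.
rewrite -lee_fin /Rintegral fineK; last exact: integrable_fin_num.
apply: le_trans (powR_exp_integral_le s0 k0 q0).
apply: ge0_subset_integral => //.
- by apply/measurable_EFinP; apply: measurable_funTS; exact: measurable_powR_exp.
- by move=> u _; rewrite lee_fin mulr_ge0 ?powR_ge0 ?expR_ge0.
- by move=> x /=; rewrite !in_itv/= andbT => /andP[].
Qed.

End Gamma_integral.

(** * The explicit constant *)

Section minimum.
Context (R : realType).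

Lemma cube_root_cube (x : R) : 0 <= x -> (x `^ 3^-1) ^+ 3 = x.
Proof.
move=> x0; rewrite -powR_mulrn ?powR_ge0// -powRrM mulVf ?powRr1//.
Qed.

Lemma cube_root_ge (x y : R) : 0 <= x -> x ^+ 3 <= y -> x <= y `^ 3^-1.
Proof.
move=> x0 xy; have y0 : 0 <= y := le_trans (exprn_ge0 3 x0) xy.
by rewrite -(@ler_pXn2r _ 3)// ?nnegrE ?powR_ge0// cube_root_cube.
Qed.

Lemma minimum_exists (f : R -> R) (k q : R) : 0 < k -> 0 < q ->
  (forall x : R, 0 < x -> {for x, continuous f}) ->
  (forall x, 0 < x -> k * x <= f x) ->
  (forall x, 0 < x -> q * x^-1 `^ 3^-1 <= f x) ->
  exists C, is_minimum [set f x | x in `]0, +oo[] C.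
Proof.
move=> k0 q0 cf fk fq.
have f10 : 0 <= f 1 by rewrite (le_trans _ (fk _ ltr01))// mulr1 ltW.
(* Beyond b the linear bound exceeds f 1, and below a the bound in x^(-1/3) does, so a minimum over
   [a, b] is global. Both ends are compared with 1 so that 1 lies in [a, b]; the 1 added in a keeps
   the inverted quantity positive. *)
pose b := Num.max 1 (f 1 / k).
pose a := Num.min 1 ((f 1 / q) ^+ 3 + 1)^-1.
have s0 : 0 < (f 1 / q) ^+ 3 + 1 by rewrite ltr_wpDl// exprn_ge0// divr_ge0// ltW.
have a0 : 0 < a by rewrite lt_min ltr01 invr_gt0.
have a1 : a <= 1 by rewrite ge_min lexx.
have b1 : 1 <= b by rewrite le_max lexx.
have cfab : {within `[a, b], continuous f}.
  apply: continuous_in_subspaceT => x; rewrite inE/= in_itv/= => /andP[ax _].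
  by apply: cf; exact: lt_le_trans ax.
have [c] := EVT_min (le_trans a1 b1) cfab.
rewrite in_itv/= => /andP[ac cb] fmin.
have c1 : f c <= f 1 by apply: fmin; rewrite in_itv/= a1.
exists (f c); split.
  by exists c => //; rewrite /= in_itv/= andbT (lt_le_trans a0).
move=> _ [x + <-]; rewrite /= in_itv/= andbT => x0.
have [xa|xa] := leP a x; last first.
  rewrite (le_trans c1)// (le_trans _ (fq _ x0))// mulrC -ler_pdivrMr//.
  apply: cube_root_ge; first by rewrite divr_ge0// ltW.
  have : x <= ((f 1 / q) ^+ 3 + 1)^-1.
    by rewrite (le_trans (ltW xa))// ge_min lexx orbT.
  rewrite -[x in X in X -> _]invrK lef_pV2 ?posrE ?invr_gt0// => /(le_trans _); apply.
  by rewrite lerDl.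
have [xb|xb] := leP x b; first by apply: fmin; rewrite in_itv/= xa.
rewrite (le_trans c1)// (le_trans _ (fk _ x0))// mulrC -ler_pdivrMr//.
by rewrite (le_trans _ (ltW xb))// le_max lexx orbT.
Qed.

(** Retains the term linear in x; [le_prod_affine2] retains the one in z, later x^(-1/3). They are
    the growth of [Kol_bound] at infinity and at 0. *)
Let le_prod_affine (m A D q y x : R) : 0 <= m -> 0 <= A -> 0 <= D -> 0 <= q ->
  0 <= y -> 0 <= x -> m * (D * q * x) <= (1 + x) * m * (A + D * (4 * y + q)).
Proof.
move=> m0 A0 D0 q0 y0 x0.
have h1 : 0 <= m * (1 + x) * A by rewrite mulr_ge0// mulr_ge0//; lra.
have h2 : 0 <= m * (1 + x) * (D * (4 * y)).
  by rewrite mulr_ge0 ?mulr_ge0//; lra.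
have h3 : 0 <= m * (D * q) by rewrite mulr_ge0 ?mulr_ge0.
lra.
Qed.

Let le_prod_affine2 (m A D q z y x : R) : 0 <= m -> 0 <= A -> 0 <= D -> 0 <= q ->
  0 <= z -> z <= y -> 0 <= x -> m * (D * 4) * z <= (1 + x) * m * (A + D * (4 * y + q)).
Proof.
move=> m0 A0 D0 q0 z0 zy x0.
have y0 := le_trans z0 zy.
have h1 : 0 <= m * (1 + x) * A by rewrite mulr_ge0// mulr_ge0//; lra.
have h2 : 0 <= m * x * (D * (4 * y)).
  by rewrite mulr_ge0 ?mulr_ge0//; lra.
have h3 : 0 <= (1 + x) * (m * (D * q)) by rewrite mulr_ge0 ?mulr_ge0//; lra.
have h4 : 0 <= m * D * (y - z) by rewrite mulr_ge0 ?mulr_ge0// subr_ge0.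
lra.
Qed.

Lemma Kol_bound_minimum (alpha c v K K1 : R) : 0 < alpha -> 0 < c -> 0 < v ->
  0 < K -> 0 < K1 ->
  exists C, is_minimum [set Kol_bound alpha c v K K1 lambda | lambda in `]0, +oo[] C.
Proof.
move=> al0 c0 v0 K0 K10.
pose m := (alpha * pi * c)^-1.
pose A := 2 `^ (v / alpha) * Gamma (v / alpha) * K1 / c `^ (v - 1).
pose D := Gamma alpha^-1 / (pi `^ (3^-1) * K).
pose q : R := 3 * 3 `^ (3^-1).
have p0 := @pi_gt0 R.
have m0 : 0 < m by rewrite invr_gt0 !mulr_gt0.
have A0 : 0 < A.
  by rewrite divr_gt0 ?powR_gt0// !mulr_gt0 ?powR_gt0// Gamma_gt0// divr_gt0.
have D0 : 0 < D.
  by rewrite divr_gt0 ?mulr_gt0 ?powR_gt0// Gamma_gt0// invr_gt0.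
have q0 : 0 < q by rewrite mulr_gt0// powR_gt0.
have D40 : 0 < D * 4 by rewrite pmulr_lgt0.
apply: (minimum_exists (mulr_gt0 m0 (mulr_gt0 D0 q0)) (mulr_gt0 m0 D40)).
- move=> x x0; rewrite /Kol_bound -/A -/D -/q.
  have cV : {for x, continuous (fun u : R => 1 + u^-1)}.
    apply: cvgD; first exact: cvg_cst.
    by apply: cvgV; [rewrite gt_eqF|exact: cvg_id].
  have cR : {for x, continuous (fun u : R => (1 + u^-1) `^ 3^-1)}.
    apply: (@continuous_comp _ _ _ (fun u : R => 1 + u^-1) (fun u => u `^ 3^-1)) => //.
    by apply: continuous_powR_gt0; rewrite addr_gt0// invr_gt0.
  have c1 : {for x, continuous (fun u : R => 1 + u)}.
    by apply: cvgD; [exact: cvg_cst|exact: cvg_id].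
  apply: cvgM; first by apply: cvgM; [exact: c1|exact: cvg_cst].
  apply: cvgD; first exact: cvg_cst.
  apply: cvgM; first exact: cvg_cst.
  apply: cvgD; last exact: cvg_cst.
  by apply: cvgM; [exact: cvg_cst|exact: cR].
- move=> x x0; rewrite /Kol_bound -/A -/D -/q -/m.
  have : 0 <= (1 + x^-1) `^ 3^-1 := powR_ge0 _ _.
  move: ((1 + x^-1) `^ 3^-1) => y y0.
  apply: (le_trans _ (le_prod_affine (ltW m0) (ltW A0) (ltW D0) (ltW q0) y0 (ltW x0))); by rewrite !mulrA lexx.
- move=> x x0; rewrite /Kol_bound -/A -/D -/q -/m.
  have y0 : 0 <= x^-1 `^ 3^-1 := powR_ge0 _ _.
  have : x^-1 `^ 3^-1 <= (1 + x^-1) `^ 3^-1.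
    by rewrite ge0_ler_powR ?nnegrE ?invr_ge0 ?addr_ge0 ?invr_ge0 ?(ltW x0)// lerDr ler01.
  move: (x^-1 `^ 3^-1) y0 ((1 + x^-1) `^ 3^-1) => z z0 y zy.
  exact: (le_prod_affine2 (ltW m0) (ltW A0) (ltW D0) (ltW q0) z0 zy (ltW x0)).
Qed.

End minimum.

Section truncation_parameter.
Context (R : realType) (T lam : R).
Hypotheses (T0 : 0 < T) (lam0 : 0 < lam).

Let P : R := pi `^ 3^-1.
Let x := (1 + lam^-1) `^ 3^-1.
Let y := 4 * x / P.

(* Since the tail of the kernel beyond y / T is of order 1 / (y^3 pi), the
   radius is dictated by y^3 pi = 64 (1 + 1 / lam). *)
Definition trunc_radius := (y + 2) / T.

Let P0 : 0 < P. Proof. by rewrite powR_gt0// pi_gt0. Qed.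
Let PE : P ^+ 3 = pi. Proof. by rewrite cube_root_cube// pi_ge0. Qed.
Let xE : x ^+ 3 = 1 + lam^-1.
Proof. by rewrite cube_root_cube// addr_ge0// invr_ge0 ltW. Qed.

Let yE : y ^+ 3 * pi = 64 * (1 + lam^-1).
Proof. by rewrite -xE -PE /y; field; rewrite gt_eqF. Qed.

Let y_ge : 27 / 10 <= y.
Proof.
have p1 := @pi_lt_16div5 R; have p0 := @pi_gt0 R.
have x1 : 1 <= x by apply: cube_root_ge => //; rewrite expr1n lerDl invr_ge0 ltW.
rewrite /y ler_pdivlMr//.
(* 1.48^3 exceeds 16/5, and 4 / 1.48 exceeds 27/10. *)
have : P <= 148 / 100.
  rewrite -(@ler_pXn2r _ 3)// ?nnegrE ?(ltW P0)// PE !exprS expr0; lra.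
lra.
Qed.

Lemma trunc_radius_gt : pi / T < trunc_radius.
Proof.
rewrite /trunc_radius ltr_pM2r ?invr_gt0//.
by have := y_ge; have := @pi_lt_16div5 R; lra.
Qed.

Let tail1_bound : tail1 T trunc_radius <= 2 * pi / ((y + 2) ^+ 2 - pi ^+ 2) / T.
Proof.
have hT := trunc_radius_gt.
rewrite (le_trans (tail1_le T0 hT))// /trunc_radius.
have -> : 4 * pi / T ^+ 3 / 2 / (((y + 2) / T) ^+ 2 - (pi / T) ^+ 2) =
    2 * pi / ((y + 2) ^+ 2 - pi ^+ 2) / T; last by [].
have d0 : (y + 2) ^+ 2 - pi ^+ 2 != 0.
  rewrite gt_eqF// subr_sqr mulr_gt0//; have := y_ge; have := @pi_lt_16div5 R; have := @pi_gt0 R; lra.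
have T1 := lt0r_neq0 T0.
rewrite !exprMn -mulrBl; move: d0; move: (_ - _) => d d0; generalize (@pi R) => p.
by field; rewrite d0 T1.
Qed.

(** The shift by 2 in the radius compensates pi^2: since y >= 27/10, 4 y + 4 >= 14.8 exceeds
    (16/5)^2. *)
Let denom_ge : y ^+ 2 <= (y + 2) ^+ 2 - pi ^+ 2.
Proof.
have := y_ge; have := @pi_lt_16div5 R; have := @pi_gt0 R; nra.
Qed.

Lemma trunc_radius_tail0 : tail0 T trunc_radius <= lam / (2 * (1 + lam)).
Proof.
have hT := trunc_radius_gt.
have y0 : 0 < y by apply: lt_le_trans y_ge; lra.
have p0 := @pi_gt0 R.
have r0 : 0 < trunc_radius by rewrite divr_gt0// addr_gt0.
have d0 : 0 < (y + 2) ^+ 2 - pi ^+ 2 by rewrite (lt_le_trans _ denom_ge)// exprn_gt0.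
rewrite (le_trans (tail0_le T0 hT))// ler_pdivrMr// (le_trans tail1_bound)//.
rewrite /trunc_radius mulrA ler_pM2r ?invr_gt0// ler_pdivrMr//.
(* The tail is at most 2 pi / y^3, so that with this form of the target only pi^2 <= 16 is left to
   check. *)
have -> : lam / (2 * (1 + lam)) = 32 / (y ^+ 3 * pi).
  by rewrite yE; field; rewrite gt_eqF// ?gt_eqF// addr_gt0.
have y30 : 0 < y ^+ 3 by rewrite exprn_gt0.
have -> : 32 / (y ^+ 3 * pi) * (y + 2) = 32 * (y + 2) / (y ^+ 3 * pi) by rewrite mulrAC.
rewrite [leRHS]mulrAC ler_pdivlMr; last exact: mulr_gt0 y30 p0.
have p1 := @pi_lt_16div5 R.
have yy : y ^+ 3 <= (y + 2) * ((y + 2) ^+ 2 - pi ^+ 2).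
  by rewrite exprS ler_pM// ?exprn_ge0 ?(ltW y0)// lerDl.
have pp : pi ^+ 2 <= 16 :> R by nra.
have -> : 2 * pi * (y ^+ 3 * pi) = 2 * pi ^+ 2 * y ^+ 3 by ring.
rewrite -[leRHS]mulrA; apply: ler_pM => //.
  - by rewrite mulr_ge0 ?sqr_ge0.
  - exact: ltW.
by lra.
Qed.

Lemma trunc_radius_tail1 : trunc_radius + tail1 T trunc_radius <=
  (4 * x + 3 * 3 `^ 3^-1) / (P * T).
Proof.
have y0 : 0 < y by apply: lt_le_trans y_ge; lra.
have p0 := @pi_gt0 R; have p1 := @pi_lt_16div5 R.
have d0 : 0 < (y + 2) ^+ 2 - pi ^+ 2 by rewrite (lt_le_trans _ denom_ge)// exprn_gt0.
rewrite -lerBrDl (le_trans tail1_bound)// lerBrDl /trunc_radius -mulrDl invfM mulrA.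
rewrite ler_pM2r ?invr_gt0// [in leRHS]mulrDl -/y -addrA lerD2l.
(* The summand 3 * 3^(1/3) / P is thus at least 27/10: the shift of the radius takes 2 of it and the
   first moment of the tail at most 7/10. *)
have q9 : 9 / 10 <= 3 `^ 3^-1 / P.
  rewrite ler_pdivlMr//; apply: cube_root_ge; first by rewrite mulr_ge0 ?(ltW P0)//; lra.
  by rewrite exprMn PE !exprS expr0; lra.
have : 2 * pi / ((y + 2) ^+ 2 - pi ^+ 2) <= 7 / 10.
  by rewrite ler_pdivrMr//; have := y_ge; nra.
by move: q9; rewrite -[3 * _ / P]mulrA; lra.
Qed.

End truncation_parameter.

(** * Zone of control *)

Section affine_charfun.
Context (R : realType) d (Om : measurableType d) (P : probability Om R).

Lemma charfun_affine (X Z : {RV P >-> R}) (r s xi : R) : (forall w, Z w = X w * r - s) ->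
  complex.Re (charfun P Z xi) = cos (xi * s) * complex.Re (charfun P X (xi * r)) +
    sin (xi * s) * complex.Im (charfun P X (xi * r)) /\
  complex.Im (charfun P Z xi) = cos (xi * s) * complex.Im (charfun P X (xi * r)) -
    sin (xi * s) * complex.Re (charfun P X (xi * r)).
Proof.
move=> ZE; set k := xi * r.
have ic : P.-integrable setT (EFin \o (fun w => cos (k * X w))).
  apply: (@bounded_integrable _ _ _ _ _ 1) => [|w]; last exact: cos_max.
  by apply: (measurable_RV_comp X (f := fun u => cos (k * u))); continuous_tac.
have iS : P.-integrable setT (EFin \o (fun w => sin (k * X w))).
  apply: (@bounded_integrable _ _ _ _ _ 1) => [|w]; last exact: sin_max.
  by apply: (measurable_RV_comp X (f := fun u => sin (k * u))); continuous_tac.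
have kZ w : xi * Z w = k * X w - xi * s by rewrite ZE /k; ring.
split; rewrite ?Re_charfun ?Im_charfun -!RintegralZl//.
- rewrite -RintegralD//.
  + by apply: eq_Rintegral => w _; rewrite kZ cosB; ring.
  + exact: (integrableZl measurableT _ ic).
  + exact: (integrableZl measurableT _ iS).
- rewrite -RintegralB//.
  + by apply: eq_Rintegral => w _; rewrite kZ sinB; ring.
  + exact: (integrableZl measurableT _ iS).
  + exact: (integrableZl measurableT _ ic).
Qed.

Lemma charfun_distribution (Y : {RV P >-> R}) (xi : R) :
  charfun (distribution P Y) (fun x => x) xi = charfun P Y xi.
Proof.
have E (f : R -> R) : continuous f -> (forall u, `|f u| <= 1) ->
    Rintegral (distribution P Y) setT f = Rintegral P setT (f \o Y).
  move=> cf f1; rewrite /Rintegral /distribution integral_pushforward//.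
  - by apply/measurable_EFinP; exact: continuous_measurable_fun.
  - apply: (@bounded_integrable _ _ _ _ _ 1) => [|w]; last exact: f1.
    exact: measurable_RV_comp.
rewrite /charfun /cintegral /=; congr Complex.
- rewrite (E (fun x => expR 0 * cos (xi * x)))//; first by continuous_tac.
  by move=> u; rewrite expR0 mul1r cos_max.
- rewrite (E (fun x => expR 0 * sin (xi * x)))//; first by continuous_tac.
  by move=> u; rewrite expR0 mul1r sin_max.
Qed.

Lemma normc_le_sqr (z : R[i]) (k : R) : `|z| <= k%:C%C ->
  complex.Re z ^+ 2 + complex.Im z ^+ 2 <= k ^+ 2.
Proof.
rewrite normc_def lecR => zk.
have s0 : 0 <= complex.Re z ^+ 2 + complex.Im z ^+ 2 by rewrite addr_ge0 ?sqr_ge0.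
rewrite -[leLHS]sqr_sqrtr// ler_pXn2r// ?nnegrE ?sqrtr_ge0//.
exact: le_trans (sqrtr_ge0 _) zk.
Qed.

Lemma stable_etaE (c alpha beta xi : R) : stable_eta c alpha beta xi =
  Complex (- `|c * xi| `^ alpha)
    (`|c * xi| `^ alpha * (beta * stable_h alpha xi * Num.sg xi)).
Proof. by rewrite /stable_eta; apply/eqP; rewrite eq_complex /=; apply/andP; split; apply/eqP; ring. Qed.

(** For z = a + i b, this is |z e^(A - i om) - 1| = e^A |z - e^(-A + i om)| in squared real form,
    with E = e^A, E' = e^(-A), C = cos om and S = sin om. *)
Let sqr_rotation (a b E E' C S k : R) : E * E' = 1 -> C ^+ 2 + S ^+ 2 = 1 ->
  (a * (E * C) - b * (E * - S) - 1) ^+ 2 + (a * (E * - S) + b * (E * C) - 0) ^+ 2 <= k ^+ 2 ->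
  (a - E' * C) ^+ 2 + (b - E' * S) ^+ 2 <= (E' * k) ^+ 2.
Proof.
move=> EE CS H.
have e0 : E' != 0 by apply: contra_eqN EE => /eqP ->; rewrite mulr0 eq_sym oner_eq0.
have EV : E = E'^-1 by apply: (mulIf e0); rewrite EE mulVf.
rewrite EV in H.
have /(ler_wpM2l (sqr_ge0 E')) := H; rewrite exprMn; apply: le_trans.
rewrite le_eqVlt; apply/orP; left; apply/eqP.
transitivity ((a ^+ 2 + b ^+ 2) * (C ^+ 2 + S ^+ 2) - 2 * E' * (a * C + b * S) + E' ^+ 2).
  rewrite -[X in _ = _ + X]mulr1 -CS CS mulr1.
  have -> : E' ^+ 2 = E' ^+ 2 * (C ^+ 2 + S ^+ 2) by rewrite CS mulr1.
  by rewrite -[a ^+ 2 + b ^+ 2]mulr1; ring: CS.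
by field.
Qed.

(* Multiplying [theta - 1] by the modulus of the stable factor undoes the normalization. *)
Lemma theta_sub1_sqr (c alpha beta t : R) (X : {RV P >-> R}) (xi k A om : R) :
  A = t * `|c * xi| `^ alpha ->
  om = t * (`|c * xi| `^ alpha * (beta * stable_h alpha xi * Num.sg xi)) ->
  `|theta c alpha beta t X xi - 1| <= k%:C%C ->
  (complex.Re (charfun P X xi) - expR (- A) * cos om) ^+ 2 +
  (complex.Im (charfun P X xi) - expR (- A) * sin om) ^+ 2 <= (expR (- A) * k) ^+ 2.
Proof.
move=> AE omE /normc_le_sqr.
rewrite /theta stable_etaE.
have -> : - t%:C%C * Complex (- `|c * xi| `^ alpha)
    (`|c * xi| `^ alpha * (beta * stable_h alpha xi * Num.sg xi)) = Complex A (- om).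
  by rewrite AE omE; apply/eqP; rewrite eq_complex /=; apply/andP; split; apply/eqP; ring.
rewrite /cexp /= cosN sinN; case: (charfun P X xi) => a b /=.
by apply: sqr_rotation => //; [rewrite expRN divff// gt_eqF// expR_gt0|exact: cos2Dsin2].
Qed.

End affine_charfun.

Section normalization.
Context (R : realType) (c alpha beta t : R).
Hypotheses (c0 : 0 < c) (al0 : 0 < alpha) (t0 : 0 < t).

Let r := (t `^ alpha^-1)^-1.

Let r0 : 0 < r. Proof. by rewrite invr_gt0 powR_gt0. Qed.

Let rpow (p : R) : r `^ p = t `^ (- (p / alpha)).
Proof. by rewrite /r -powRN -powRrM mulNr mulrC. Qed.

Lemma dilation_scale (xi : R) : 0 <= xi ->
  t * `|c * (xi * r)| `^ alpha = `|c * xi| `^ alpha.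
Proof.
move=> xi0; rewrite mulrA normrM powRM// (gtr0_norm r0) rpow mulfV ?gt_eqF//.
by rewrite powR_inv1 ?(ltW t0)// mulrCA mulfV ?mulr1// gt_eqF.
Qed.

(** For alpha = 1 the logarithm breaks the scaling: ln (xi / t) = ln xi - ln t leaves a phase linear
    in xi, which the translation in [normalized_rv] is designed to remove. Otherwise s = 0. *)
Lemma normalized_affine d (Om : measurableType d) (P : probability Om R)
  (X : {RV P >-> R}) : exists s, 
  (forall w, normalized_rv c alpha beta t X w = X w * r - s) /\
  forall xi : R, 0 < xi ->
    t * (`|c * (xi * r)| `^ alpha * (beta * stable_h alpha (xi * r) * Num.sg (xi * r))) =
    `|c * xi| `^ alpha * (beta * stable_h alpha xi * Num.sg xi) + xi * s.
Proof.
have sgE (xi : R) : 0 < xi -> Num.sg (xi * r) = Num.sg xi.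
  by move=> xi0; rewrite !gtr0_sg// mulr_gt0.
have [al1|al1] := eqVneq alpha 1; last first.
  exists 0; split => [w|xi xi0]; first by rewrite /normalized_rv (negbTE al1) /= subr0.
  rewrite mulrA dilation_scale ?(ltW xi0)// sgE// mulr0 addr0.
  by rewrite /stable_h (negbTE al1).
exists (2 * c * beta / pi * ln t); split => [w|xi xi0].
  by rewrite /normalized_rv al1 eqxx /= /r al1 invr1 powRr1// ltW.
rewrite mulrA dilation_scale ?(ltW xi0)// sgE// gtr0_sg// /stable_h al1 eqxx.
rewrite powRr1// gtr0_norm ?mulr_gt0// gtr0_norm ?mulr_gt0// gtr0_norm//.
rewrite lnM ?posrE// {1}/r al1 invr1 powRr1 ?(ltW t0)// lnV ?posrE//.
by move: (pi^-1) => p; ring.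
Qed.

(** A translation multiplies both characteristic functions by the same number of modulus 1, which
    preserves their distance. *)
Let rotation_norm (a b E C S k l : R) : k ^+ 2 + l ^+ 2 = 1 ->
  (k * a + l * b - E * (C * k + S * l)) ^+ 2 + (k * b - l * a - E * (S * k - C * l)) ^+ 2 =
  (a - E * C) ^+ 2 + (b - E * S) ^+ 2.
Proof. by move=> kl; rewrite -[RHS]mulr1 -kl; ring. Qed.

Lemma normalized_charfun_dist d (Om : measurableType d) (P : probability Om R)
  (X : {RV P >-> R}) (xi k : R) : 0 < xi ->
  `|theta c alpha beta t X (xi * r) - 1| <= k%:C%C ->
  (complex.Re (charfun P (normalized_rv c alpha beta t X) xi) -
   complex.Re (cexp (stable_eta c alpha beta xi))) ^+ 2 +
  (complex.Im (charfun P (normalized_rv c alpha beta t X) xi) -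
   complex.Im (cexp (stable_eta c alpha beta xi))) ^+ 2 <=
  (expR (- `|c * xi| `^ alpha) * k) ^+ 2.
Proof.
move=> xi0; have [s [ZE etaE]] := normalized_affine X.
move=> /(theta_sub1_sqr (esym (dilation_scale (ltW xi0))) erefl).
rewrite etaE//.
have [-> ->] := charfun_affine xi ZE.
rewrite stable_etaE /cexp /=.
move: (_ * (_ * Num.sg xi)) => om.
have cs : cos (xi * s) ^+ 2 + sin (xi * s) ^+ 2 = 1 := cos2Dsin2 _.
have -> : cos om = cos (om + xi * s) * cos (xi * s) + sin (om + xi * s) * sin (xi * s).
  by rewrite -cosB addrK.
have -> : sin om = sin (om + xi * s) * cos (xi * s) - cos (om + xi * s) * sin (xi * s).
  by rewrite -sinB addrK.
by rewrite rotation_norm.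
Qed.

Section zone_exponent.
Context (K gamma w K2 : R).
Hypotheses (t1 : 1 <= t) (K20 : 0 < K2) (Z2 : zone_Z2 c alpha K gamma w K2).

Let T := K * t `^ (gamma + alpha^-1).

Lemma zone_radius (xi : R) : 0 < xi <= T -> 0 < xi * r <= K * t `^ gamma.
Proof.
move=> /andP[xi0 xiT]; rewrite mulr_gt0//= ler_pdivrMr ?powR_gt0// -mulrA -powRD//.
by rewrite (gt_eqF t0) implybT.
Qed.

(** Write u^w = u^alpha * u^(w - alpha) with u = xi * r. The bound on K controls K^(w - alpha), and
    the one on gamma gives t^(gamma (w - alpha)) <= t, as t >= 1. The growth allowed in the zone
    thus consumes at most half of the decay of the stable characteristic function. *)
Lemma zone_exponent_le (xi : R) : 0 < xi <= T ->
  K2 * (xi * r) `^ w <= c `^ alpha / 2 * xi `^ alpha.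
Proof.
move=> xiT; have /andP[u0 uK] := zone_radius xiT; have /andP[xi0 _] := xiT.
have [alw _ K0 Zlt Zeq] := Z2.
have ua : (xi * r) `^ alpha = xi `^ alpha / t.
  rewrite powRM ?(ltW xi0) ?(ltW r0)// rpow mulfV ?gt_eqF//.
  by rewrite powR_inv1 ?(ltW t0).
have xa : 0 <= xi `^ alpha := powR_ge0 _ _.
have ca : 0 <= c `^ alpha := powR_ge0 _ _.
move: alw; rewrite le_eqVlt => /predU1P[alw|alw].
  have := Zeq (esym alw); rewrite ler_pdivlMr ?mulr_gt0// mul1r => cK.
  rewrite -alw ua mulrCA -[leRHS]mulrC ler_wpM2l//.
  rewrite ler_pdivrMr//; have : 0 <= c `^ alpha * (t - 1) by rewrite mulr_ge0// subr_ge0.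
  by lra.
have [gw Kw] := Zlt alw.
have wa : 0 < w - alpha by rewrite subr_gt0.
have uw : (xi * r) `^ (w - alpha) <= c `^ alpha / (2 * K2) * t.
  apply: (@le_trans _ _ ((K * t `^ gamma) `^ (w - alpha))).
    by apply: ge0_ler_powR; rewrite ?nnegrE ?(ltW wa) ?(ltW u0)// (le_trans (ltW u0)).
  rewrite powRM ?(ltW K0) ?powR_ge0//; apply: ler_pM; rewrite ?powR_ge0//.
    have cK : 0 <= c `^ alpha / (2 * K2) by rewrite divr_ge0// mulr_ge0// ltW.
    have := ge0_ler_powR (ltW wa) (_ : K \in Num.nneg) (_ : _ \in Num.nneg) Kw.
    by rewrite -powRrM mulVf ?gt_eqF// powRr1//; apply; rewrite nnegrE ?powR_ge0// ltW.
  rewrite -powRrM -[leRHS](powRr1 (ltW t0)); apply: ler_powR => //.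
  by rewrite -ler_pdivlMr// mul1r.
have -> : (xi * r) `^ w = (xi * r) `^ alpha * (xi * r) `^ (w - alpha).
  by rewrite -powRD ?(gt_eqF u0) ?implybT// addrC subrK.
rewrite ua; apply: (@le_trans _ _ (K2 * (xi `^ alpha / t * (c `^ alpha / (2 * K2) * t)))).
  by rewrite ler_wpM2l ?(ltW K20)// ler_wpM2l// divr_ge0// ltW.
rewrite le_eqVlt; apply/orP; left; apply/eqP; field.
by rewrite !gt_eqF.
Qed.

End zone_exponent.

Section stable_charfun.
Context d' (Om' : measurableType d') (Q : probability Om' R) (Y : {RV Q >-> R}).
Hypothesis Y_stable : is_stable_law c alpha beta (distribution Q Y).

Lemma stable_charfun (xi : R) : charfun Q Y xi = cexp (stable_eta c alpha beta xi).
Proof. by rewrite -charfun_distribution. Qed.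

Lemma stable_cdf_lipschitz (a b : R) : a <= b ->
  fine (cdf Y b) - fine (cdf Y a) <= Gamma alpha^-1 / (alpha * pi * c) * (b - a).
Proof.
have ca : 0 < c `^ alpha by rewrite powR_gt0.
(* The majorant is the modulus of the characteristic function itself: the power with exponent 1 - 1
   is 1, also at 0, and gives it the shape of a Gamma-type integrand with s = 1. *)
apply: (@cdf_lipschitz _ _ _ _ _ _
  (fun u : R => u `^ (1 - 1) * expR (- (c `^ alpha * u `^ alpha)))).
- by move=> xi _; rewrite mulr_ge0 ?powR_ge0 ?expR_ge0.
- by move=> T; exact: powR_exp_integrable.
- move=> T _; apply: le_trans (ler_wpM2l _ (powR_exp_Rintegral_le T ltr01 ca al0)) _.
    by rewrite invr_ge0 pi_ge0.
  rewrite -powRrM mul1r mulfV ?gt_eqF// powRr1 ?(ltW c0)//.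
  have pn := lt0r_neq0 (@pi_gt0 R); move: pn; move: (@pi R) (Gamma _) => p G pn.
  by rewrite le_eqVlt; apply/orP; left; apply/eqP; field; rewrite pn !gt_eqF.
- move=> xi xi0; rewrite stable_charfun stable_etaE /cexp /=.
  rewrite subrr powRr0 mul1r !exprMn -mulrDr cos2Dsin2 mulr1.
  by rewrite normrM !gtr0_norm// powRM// ltW.
Qed.

End stable_charfun.

(** * Assembling the Kolmogorov bound *)

Section kolmogorov_bound.
Context d (Om : measurableType d) (P : probability Om R) (X : {RV P >-> R}).
Context d' (Om' : measurableType d') (Q : probability Om' R) (Y : {RV Q >-> R}).
Context (K gamma v w K1 K2 : R).
Hypotheses (t1 : 1 <= t) (v0 : 0 < v) (K10 : 0 < K1) (K20 : 0 < K2).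
Hypothesis Z2 : zone_Z2 c alpha K gamma w K2.
Hypothesis Z1 : forall xi : R, - (K * t `^ gamma) <= xi <= K * t `^ gamma ->
  `|theta c alpha beta t X xi - 1| <= (K1 * `|xi| `^ v * expR (K2 * `|xi| `^ w))%:C%C.
Hypothesis gamma_le : gamma <= (v - 1) / alpha.
Hypothesis Y_stable : is_stable_law c alpha beta (distribution Q Y).

Let T := K * t `^ (gamma + alpha^-1).
Let Z := normalized_rv c alpha beta t X.

(** Majorant of the distance of the characteristic functions divided by xi, hence the exponent v -
    1; the decay that remains is the half left by [zone_exponent_le]. *)
Let g (xi : R) := K1 * r `^ v * (xi `^ (v - 1) * expR (- (c `^ alpha / 2 * xi `^ alpha))).

Lemma zone_charfun_dist (xi : R) : 0 < xi <= T ->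
  (complex.Re (charfun P Z xi) - complex.Re (charfun Q Y xi)) ^+ 2 +
  (complex.Im (charfun P Z xi) - complex.Im (charfun Q Y xi)) ^+ 2 <= (xi * g xi) ^+ 2.
Proof.
move=> xiT; have /andP[xi0 _] := xiT; have /andP[u0 uK] := zone_radius xiT.
rewrite !(stable_charfun Y_stable).
have uZ : - (K * t `^ gamma) <= xi * r <= K * t `^ gamma.
  by rewrite uK andbT lerNl (le_trans _ (le_trans (ltW u0) uK))// oppr_le0 ltW.
apply: le_trans (normalized_charfun_dist xi0 (Z1 uZ)) _.
have g0 : 0 <= xi * g xi.
  rewrite /g; apply: mulr_ge0; first exact: ltW.
  by apply: mulr_ge0; apply: mulr_ge0; rewrite ?expR_ge0 ?powR_ge0// ltW.
rewrite ler_pXn2r// ?nnegrE; last first.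
  by apply: mulr_ge0; [exact: expR_ge0|apply: mulr_ge0; rewrite ?expR_ge0//; apply: mulr_ge0; rewrite ?powR_ge0// ltW].
rewrite (gtr0_norm u0) /g.
have -> : xi * (K1 * r `^ v * (xi `^ (v - 1) * expR (- (c `^ alpha / 2 * xi `^ alpha)))) =
    K1 * (xi * r) `^ v * expR (- (c `^ alpha / 2 * xi `^ alpha)).
  by rewrite powRM ?(ltW xi0) ?(ltW r0)// -(mulr_powRB1 (ltW xi0) v0); ring.
rewrite mulrCA ler_wpM2l ?mulr_ge0 ?powR_ge0 ?(ltW K10)// -expRD ler_expR.
rewrite normrM !gtr0_norm// [(c * xi) `^ _]powRM ?(ltW c0) ?(ltW xi0)//.
have := zone_exponent_le t1 K20 Z2 xiT.
by move: (K2 * _) (c `^ alpha) (xi `^ alpha) => z p q; lra.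
Qed.

Let B := pi^-1 * (K1 * r `^ v * (alpha^-1 / (c `^ alpha / 2) `^ (v / alpha) * Gamma (v / alpha))).

Let K0 : 0 < K. Proof. by case: Z2. Qed.

Let T0 : 0 < T. Proof. by apply: mulr_gt0 => //; rewrite powR_gt0. Qed.

Let ca0 : 0 < c `^ alpha / 2. Proof. by rewrite divr_gt0// powR_gt0. Qed.

Let smoothed_dist (x : R) :
  `|\int[P]_u RT T (x - Z u) - \int[Q]_u RT T (x - Y u)| <= B.
Proof.
have ig := powR_exp_integrable T v0 ca0 al0.
have mI : measurable (`]0, T]%classic : set (measurableTypeR R)) by [].
have k0 : 0 <= K1 * r `^ v by rewrite mulr_ge0 ?powR_ge0// ltW.
have igg : lebesgue_measure.-integrable `]0, T] (EFin \o g).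
  exact: (integrableZl mI (K1 * r `^ v) ig).
apply: le_trans (RT_expectation_difference x T0 _ igg zone_charfun_dist) _.
  move=> xi _; apply: mulr_ge0 => //.
  by apply: mulr_ge0; rewrite ?powR_ge0 ?expR_ge0.
rewrite /B /g RintegralZl// ler_wpM2l ?invr_ge0 ?pi_ge0// ler_wpM2l//.
exact: powR_exp_Rintegral_le.
Qed.

(** The Fourier part decays like t^(- v / alpha) and the smoothing part like 1 / T; the assumption
    gamma <= (v - 1) / alpha makes the second rate the dominant one. *)
Let rv_le : r `^ v <= (t `^ (alpha^-1 + gamma))^-1.
Proof.
rewrite rpow -powRN ler_powR// lerN2.
have -> : v / alpha = alpha^-1 + (v - 1) / alpha by rewrite mulrBl mul1r addrC subrK.
by rewrite lerD2l.
Qed.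

Let bound_algebra (p P1 G1 G2 k cv1 tv tau h lam : R) :
  p != 0 -> P1 != 0 -> k != 0 -> cv1 != 0 -> tau != 0 ->
  (1 + lam) * (p^-1 * (K1 * tau^-1 * (alpha^-1 / (c * cv1 / tv) * G1)) +
     G2 / (alpha * p * c) * (h / (P1 * (k * tau)))) =
  (1 + lam) / (alpha * p * c) * (tv * G1 * K1 / cv1 + G2 / (P1 * k) * h) * tau^-1.
Proof.
move=> p0 P10 k0 cv0 tau0.
have al_neq0 := lt0r_neq0 al0; have c_neq0 := lt0r_neq0 c0.
have -> : (c * cv1 / tv)^-1 = tv / (c * cv1) by rewrite invf_div.
by field; rewrite p0 P10 k0 cv0 tau0 al_neq0 c_neq0.
Qed.

Lemma normalized_cdf_dist (lam a : R) : 0 < lam ->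
  `|fine (cdf Z a) - fine (cdf Y a)| <=
  Kol_bound alpha c v K K1 lam * (t `^ (alpha^-1 + gamma))^-1.
Proof.
move=> lam0; have p0 := @pi_gt0 R.
have G0 : 0 <= Gamma alpha^-1 by apply/ltW/Gamma_gt0; rewrite invr_gt0.
have l0 : 0 <= Gamma alpha^-1 / (alpha * pi * c).
  by rewrite divr_ge0// ltW// !mulr_gt0.
have := cdf_distance_smoothing T0 l0 (trunc_radius_gt T0 lam0) lam0 smoothed_dist
  (stable_cdf_lipschitz Y_stable) (trunc_radius_tail0 T0 lam0) a.
move=> /le_trans; apply.
set tau := t `^ (alpha^-1 + gamma).
have tau0 : 0 < tau by rewrite powR_gt0.
rewrite /Kol_bound -bound_algebra; last 5 first.
- exact: lt0r_neq0.
- by rewrite gt_eqF// powR_gt0.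
- exact: lt0r_neq0.
- by rewrite gt_eqF// powR_gt0.
- exact: lt0r_neq0.
rewrite ler_wpM2l ?addr_ge0// ?(ltW lam0)//; apply: lerD.
- rewrite mulr_powRB1 ?(ltW c0)//.
  have <- : (c `^ alpha / 2) `^ (v / alpha) = c `^ v / 2 `^ (v / alpha).
    rewrite powRM ?powR_ge0// -powRrM mulrCA mulfV ?gt_eqF// mulr1; congr (_ * _).
    by rewrite -powR_inv1// -powRrM mulN1r powRN.
  rewrite /B ler_wpM2l ?invr_ge0 ?pi_ge0// ler_wpM2r//; last by apply: ler_wpM2l rv_le; exact: ltW.
  apply/ltW/mulr_gt0; last exact/Gamma_gt0/divr_gt0.
  by apply: divr_gt0; rewrite ?invr_gt0 ?powR_gt0.
- rewrite ler_wpM2l//.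
  have -> : K * tau = T by rewrite /T /tau addrC.
  exact: trunc_radius_tail1.
Qed.

End kolmogorov_bound.

End normalization.

Theorem theorem20 (R : realType) (c alpha beta : R)
  (c_gt0 : 0 < c) (alpha_gt0 : 0 < alpha) (alpha_le2 : alpha <= 2)
  (beta_geN1 : -1 <= beta) (beta_le1 : beta <= 1)
  (t : nat -> R) (t_gt0 : forall n, 0 < t n) (t_cvg : t n @[n --> \oo] --> +oo)
  (d : nat -> measure_display) (T : forall n, measurableType (d n))
  (P : forall n, probability (T n) R) (X : forall n, {RV (P n) >-> R})
  (v w gamma K K1 K2 : R) (v_gt0 : 0 < v) (w_gt0 : 0 < w)
  (zoneX : zone_of_control c alpha beta t X K gamma v w K1 K2)
  (gamma_le : gamma <= (v - 1) / alpha)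
  (d' : measure_display) (T' : measurableType d') (Q : probability T' R)
  (Y : {RV Q >-> R}) (Y_stable : is_stable_law c alpha beta (distribution Q Y)) :
  exists C : R,
    is_minimum [set Kol_bound alpha c v K K1 lambda | lambda in `]0, +oo[] C /\
    forall n, 1 <= t n ->
      dKol (normalized_rv c alpha beta (t n) (X n)) Y
        <= C * (t n `^ (alpha^-1 + gamma))^-1.

Proof.
have [K10 K20 Z1 Z2] := zoneX.
have K0 : 0 < K by case: Z2.
have [C [[lam lam0 CE] Cmin]] := Kol_bound_minimum alpha_gt0 c_gt0 v_gt0 K0 K10.
exists C; split; first by split => //; exists lam.
move=> n tn1; rewrite /= in_itv/= andbT in lam0.
apply: ge_sup => [|_ [a _ <-]]; first by exists `|fine (cdf (normalized_rv c alpha beta (t n) (X n)) 0) - fine (cdf Y 0)|, 0.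
(* The estimate holds for every positive lambda, hence at the minimiser. *)
rewrite -CE; exact: (normalized_cdf_dist c_gt0 alpha_gt0 (t_gt0 n) tn1 v_gt0 K10 K20 Z2 (Z1 n) gamma_le Y_stable a lam0).
Qed.
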